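(* Suppose $\mu:=\mathbb{E}[\xi]\in(0,\infty)$ and $\sigma^2:=\mathrm{Var}[\xi]\in(0,\infty)$. Let $(B(u))_{u\ge0}$ be a standard Brownian motion. (1) If $\mathbb{E}[\eta^+]<\infty$, then $$\Big(\frac{\tau(ut)-\mu^{-1}ut}{(\sigma^2\mu^{-3}t)^{1/2}}\Big)_{u\ge0}\ \overset{\mathrm{f.d.}}{\Longrightarrow}\ (B(u))_{u\ge0},\quad t\to\infty.$$ (2) If $\mathbb{E}[\eta^-]<\infty$, then $$\Big(\frac{\rho(ut)-\mu^{-1}ut}{(\sigma^2\mu^{-3}t)^{1/2}}\Big)_{u\ge0}\ \overset{\mathrm{f.d.}}{\Longrightarrow}\ (B(u))_{u\ge0},\quad t\to\infty.$$ (3) If $\mathbb{E}[\eta]\in(-\infty,\infty)$, then $$\Big(\Big(\frac{\tau(ut)-\mu^{-1}ut}{(\sigma^2\mu^{-3}t)^{1/2}}\Big)_{u\ge0},\Big(\frac{N(ut)-\mu^{-1}ut}{(\sigma^2\mu^{-3}t)^{1/2}}\Big)_{u\ge0},\Big(\frac{\rho(ut)-\mu^{-1}ut}{(\sigma^2\mu^{-3}t)^{1/2}}\Big)_{u\ge0}\Big)\ \overset{\mathrm{f.d.}}{\Longrightarrow}\ \big((B(u))_{u\ge0},(B(u))_{u\ge0},(B(u))_{u\ge0}\big)$$ as $t\to\infty$, where the same Brownian motion $B$ appears in all three components of the limit.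
   Context: Let $(\xi_1,\eta_1),(\xi_2,\eta_2),\ldots$ be independent copies of an $\mathbb{R}^2$-valued random vector $(\xi,\eta)$ with arbitrarily dependent components. Put $S_0:=0$, $S_n:=\xi_1+\ldots+\xi_n$ for $n\in\mathbb{N}=\{1,2,\ldots\}$, and $T_n:=S_{n-1}+\eta_n$ for $n\in\mathbb{N}$ (the globally perturbed random walk). For $t\in\mathbb{R}$ define the first passage time $\tau(t):=\inf\{n\ge1:T_n>t\}$, the number of visits $N(t):=\sum_{n\ge1}\mathbf{1}_{\{T_n\le t\}}$ to $(-\infty,t]$, and the last exit time $\rho(t):=\sup\{n\ge1:T_n\le t\}$, with the conventions $\sup\varnothing=0$ and $\inf\varnothing=\infty$. Here $x^+=\max(x,0)$ and $x^-=\max(-x,0)$ for $x\in\mathbb{R}$. The symbol $\overset{\mathrm{f.d.}}{\Longrightarrow}$ denotes weak convergence of finite-dimensional distributions. *)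

(* Defs.v *)
From HB Require Import structures.
From mathcomp Require Import all_boot all_order all_algebra finmap.
From mathcomp Require Import all_classical all_reals all_analysis.

Set Implicit Arguments.
Unset Strict Implicit.
Unset Printing Implicit Defensive.

Import Order.TTheory GRing.Theory Num.Theory.
Import numFieldNormedType.Exports.

Local Open Scope classical_set_scope.
Local Open Scope ring_scope.
Local Open Scope ereal_scope.

Definition mutually_independent (R : realType) (d d' : measure_display)
    (Om : measurableType d) (P : probability Om R) (E : measurableType d')
    (I : choiceType) (X : I -> Om -> E) : Prop :=
  forall (J : {fset I}) (A : I -> set E),
    (forall i, i \in J -> measurable (A i)) ->
    P (\bigcap_(i in [set` J]) X i @^-1` A i) =
    \prod_(i <- J) P (X i @^-1` A i).

Definition independent_copies (R : realType) (d0 d d' : measure_display)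
    (Om0 : measurableType d0) (P0 : probability Om0 R)
    (Om : measurableType d) (P : probability Om R) (E : measurableType d')
    (X : Om0 -> E) (Xs : nat -> Om -> E) : Prop :=
  mutually_independent P Xs /\
  forall n (A : set E), measurable A -> P (Xs n @^-1` A) = P0 (X @^-1` A).

(* The family is indexed from 0: [xi k] and [eta k] stand for the usual
   xi_(k+1) and eta_(k+1), whereas [S_n] and [T_n] keep their usual indices,
   with [T_n] meaningful for n >= 1 only. *)
Definition random_walk (R : realType) (T : Type) (xi : nat -> T -> R)
    (n : nat) (w : T) : R :=
  (\sum_(k < n) xi k w)%R.

Definition perturbed_walk (R : realType) (T : Type) (xi eta : nat -> T -> R)
    (n : nat) (w : T) : R :=
  (random_walk xi n.-1 w + eta n.-1 w)%R.

Section passage.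
Context (R : realType) (T : Type) (xi eta : nat -> T -> R).
Let Tn := perturbed_walk xi eta.

Definition first_passage (t : R) (w : T) : \bar R :=
  ereal_inf [set n%:R%:E | n in [set n : nat | (1 <= n)%N /\ (t < Tn n w)%R]].

Definition nb_visits (t : R) (w : T) : \bar R :=
  \sum_(1 <= n <oo) (\1_[set x : R | (x <= t)%R] (Tn n w))%:E.

(* Adjoining 0 implements the convention sup set0 = 0 (instead of -oo); it
   changes nothing when the set of indices n >= 1 is nonempty. *)
Definition last_exit (t : R) (w : T) : \bar R :=
  ereal_sup (0 |` [set n%:R%:E | n in
    [set n : nat | (1 <= n)%N /\ (Tn n w <= t)%R]]).

End passage.

(* The value at time [u] of the process V, sped up by [t], centered and
   normalized. *)
Definition rescaled (R : realType) (T : Type) (mu sigma2 : R)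
    (V : R -> T -> \bar R) (t u : R) (w : T) : \bar R :=
  (V (u * t)%R w - (mu^-1 * (u * t))%:E) *
  ((Num.sqrt (sigma2 * mu ^- 3 * t))^-1)%:E.

(* Standard Brownian motion on [0, +oo[; the values B u for u < 0 are
   irrelevant. [normal_prob] takes a standard deviation, and is not a normal
   law when that deviation is 0, hence the strict inequality s < t. *)
Definition standard_brownian_motion (R : realType) (d : measure_display)
    (Om : measurableType d) (P : probability Om R) (B : R -> {RV P >-> R}) :
    Prop :=
  [/\ {ae P, forall w, B 0%R w = 0%R},
      forall t : nat -> R, (0 <= t 0%N)%R -> nondecreasing_seq t ->
        mutually_independent P
          (fun (i : nat) (w : Om) => (B (t i.+1) w - B (t i) w)%R),
      forall s t : R, (0 <= s)%R -> (s < t)%R ->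
        forall A : set R, measurable A ->
          P ((fun w => (B t w - B s w)%R) @^-1` A) =
          normal_prob 0%R (Num.sqrt (t - s)) A &
      {ae P, forall w, {within `[0%R, +oo[%classic,
                          continuous (fun u : R => B u w)}}].

(* Weak convergence, as t --> +oo, of the finite-dimensional distributions of
   R^m-valued processes indexed by [0, +oo[; the values of the m components at
   k time points are the entries of an m x k matrix. The components of X may
   take infinite values: the law of the matrix is then a sub-probability on
   the m x k real matrices, and the case g = 1 forces the mass of the infinite
   values to vanish in the limit. *)
Definition fdd_cvg (R : realType) (d d' : measure_display)
    (Om : measurableType d) (P : probability Om R)
    (Om' : measurableType d') (P' : probability Om' R) (m : nat)
    (X : 'I_m -> R -> R -> Om -> \bar R) (Y : 'I_m -> R -> Om' -> R) : Prop :=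
  forall (k : nat) (u : 'I_k -> R), (forall j, 0 <= u j)%R ->
  forall g : 'M[R]_(m, k) -> R, continuous g -> bounded_fun g ->
    \int[P]_(w in [set w | forall i j, X i t (u j) w \is a fin_num])
      (g (\matrix_(i, j) fine (X i t (u j) w)))%:E
    @[t --> +oo%R] -->
    \int[P']_w (g (\matrix_(i, j) Y i (u j) w))%:E.

(* Main.v *)
Require Import Defs.
From HB Require Import structures.
From mathcomp Require Import all_boot all_order all_algebra finmap.
From mathcomp Require Import all_classical all_reals all_analysis.
From mathcomp Require Import measurable_realfun ring lra zify.

Set Implicit Arguments.
Unset Strict Implicit.
Unset Printing Implicit Defensive.

Import Order.TTheory GRing.Theory Num.Theory.
Import numFieldNormedType.Exports.

Local Open Scope classical_set_scope.
Local Open Scope ring_scope.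


(** Up to time [ut] the walk makes about [n = ut / mu] steps, and the three
    passage times all differ from [n] by the time that the drift needs to
    compensate the fluctuation of the walk at this one deterministic index:
    their rescalings are close in probability to
      [W_t(u) = - (S_n - n mu) / sqrt (sigma2 t / mu)],
    written [walk_approx] below. The theorem then is the central limit theorem for
    the finite-dimensional distributions of [W_t]; that the limits in its last
    part are three copies of the same Brownian motion expresses that the same
    [W_t] approximates the three processes.

    Closeness in probability ([close_first_passage], [close_last_exit],
    [close_nb_visits]). It is enough to compare a passage time with [W_t] at a
    fixed level ([unlikely_grid]). Two of the four comparisons only look at one
    index: there the perturbation is bounded in probability, and by Chebyshev's
    inequality the walk has moved by [o(sqrt t)] since the index [n]
    ([first_passage_upper], [last_exit_lower]). The other two exclude that an
    index far from the level is responsible for the passage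
    ([first_passage_lower], [last_exit_upper]): over [k] steps the walk moves by
    at least [mu k / 2 - K] for all [k] at once ([walk_lower]), while an
    integrable perturbation stays below [mu k / 2 + K] ([perturbation_upper]).
    For the first passage, which concerns the indices before the level, these
    bounds are applied to the sequence reversed in time. This is where the
    integrability of the positive part of [eta] serves [tau], and that of its
    negative part [rho]. The number of visits lies between [tau - 1] and [rho].

    Central limit theorem ([clt_prod]). Brownian increments are sums of normal
    steps, as many as the walk makes ([brownian_step_op]), so that Lindeberg's
    replacement of the steps one by one ([lindeberg]) applies; as only two moments
    of [xi] are available, the test functions have a second order expansion with
    error [min(h^2, |h|^3)]. Products of such functions of disjoint increments
    reduce to a single increment by independence ([mean_prod_blocks]).

    From products to continuous functions ([fdd_limit]). Cubic B-splines are
    admissible test functions and form a partition of unity, so that on a cube a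
    continuous function of the increments is uniformly close to a linear
    combination of products of splines ([spline_approx_close]); the increments are
    tight, and the cube misses a small probability only. *)

(** * Real expectations *)

Definition mean (R : realType) (d : measure_display) (T : measurableType d)
  (P : probability T R) (f : T -> R) : R := Rintegral P setT f.

Definition L1 (R : realType) (d : measure_display) (T : measurableType d)
  (P : probability T R) (f : T -> R) : Prop := P.-integrable setT (EFin \o f).

Section mean_theory.
Context (R : realType) (d : measure_display) (T : measurableType d).
Variable P : probability T R.
Implicit Types (f g : T -> R) (A : set T).

Lemma L1_measurable f : L1 P f -> measurable_fun setT f.
Proof. by move=> /measurable_int /measurable_EFinP. Qed.

Lemma le_L1 f g : measurable_fun setT f -> (forall w, `|f w| <= `|g w|) ->
  L1 P g -> L1 P f.
Proof.
move=> mf fg Lg; apply: (le_integrable measurableT _ _ Lg) => //.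
  exact/measurable_EFinP.
by move=> w _ /=; rewrite lee_fin.
Qed.

Lemma bounded_L1 f (M : R) : measurable_fun setT f -> (forall w, `|f w| <= M) ->
  L1 P f.
Proof.
move=> mf fM; apply: (@le_L1 _ (cst M)) => //.
  by move=> w /=; apply: (le_trans (fM w)); rewrite ler_norm.
exact: finite_measure_integrable_cst.
Qed.

Lemma L1D f g : L1 P f -> L1 P g -> L1 P (fun w => f w + g w).
Proof. by move=> Lf Lg; apply: (integrableD measurableT Lf Lg). Qed.

Lemma L1B f g : L1 P f -> L1 P g -> L1 P (fun w => f w - g w).
Proof. by move=> Lf Lg; apply: (integrableB measurableT Lf Lg). Qed.

Lemma L1Z (k : R) f : L1 P f -> L1 P (fun w => k * f w).
Proof. by move=> Lf; apply: (integrableZl measurableT k Lf). Qed.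

Lemma L1_cst (k : R) : L1 P (fun=> k).
Proof. exact: finite_measure_integrable_cst. Qed.

Lemma L1_norm f : L1 P f -> L1 P (fun w => `|f w|).
Proof. exact: integrable_norm. Qed.

Lemma L1_sum (I : Type) (s : seq I) (h : I -> T -> R) :
  (forall i, L1 P (h i)) -> L1 P (fun w => \sum_(i <- s) h i w).
Proof.
move=> Lh; elim: s => [|i s IHs].
  by under eq_fun do rewrite big_nil; exact: L1_cst.
by under eq_fun do rewrite big_cons; exact: L1D.
Qed.

Lemma meanD f g : L1 P f -> L1 P g ->
  mean P (fun w => f w + g w) = mean P f + mean P g.
Proof. by move=> Lf Lg; rewrite /mean RintegralD. Qed.

Lemma meanB f g : L1 P f -> L1 P g ->
  mean P (fun w => f w - g w) = mean P f - mean P g.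
Proof. by move=> Lf Lg; rewrite /mean RintegralB. Qed.

Lemma meanZ (k : R) f : L1 P f -> mean P (fun w => k * f w) = k * mean P f.
Proof. by move=> Lf; rewrite /mean RintegralZl. Qed.

Lemma mean_cst (k : R) : mean P (fun=> k) = k.
Proof.
rewrite /mean Rintegral_cst//.
transitivity (k * fine 1%E); last by rewrite mulr1.
by congr (_ * fine _); exact: probability_setT.
Qed.

Lemma mean_sum (I : Type) (s : seq I) (h : I -> T -> R) :
  (forall i, L1 P (h i)) ->
  mean P (fun w => \sum_(i <- s) h i w) = \sum_(i <- s) mean P (h i).
Proof.
move=> Lh; elim: s => [|i s IHs].
  by under eq_fun do rewrite big_nil; rewrite big_nil mean_cst.
under eq_fun do rewrite big_cons.
by rewrite big_cons meanD// ?IHs//; exact: L1_sum.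
Qed.

Lemma eq_mean f g : f =1 g -> mean P f = mean P g.
Proof. by move=> /funext ->. Qed.

Lemma le_mean f g : L1 P f -> L1 P g -> (forall w, f w <= g w) ->
  mean P f <= mean P g.
Proof. by move=> Lf Lg fg; apply: le_Rintegral. Qed.

Lemma mean_ge0 f : (forall w, 0 <= f w) -> 0 <= mean P f.
Proof. by move=> f0; apply: Rintegral_ge0. Qed.

Lemma le_norm_mean f : L1 P f -> `|mean P f| <= mean P (fun w => `|f w|).
Proof. by move=> Lf; apply: le_normr_Rintegral. Qed.

Lemma norm_mean_le f g : L1 P g -> measurable_fun setT f ->
  (forall w, `|f w| <= g w) -> `|mean P f| <= mean P g.
Proof.
move=> Lg mf fg; have Lf : L1 P f.
  by apply: (le_L1 mf _ Lg) => w; rewrite (le_trans (fg w))// ler_norm.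
by apply: (le_trans (le_norm_mean Lf)); apply: le_mean => //; exact: L1_norm.
Qed.

Lemma norm_mean_bounded f (M : R) : measurable_fun setT f ->
  (forall w, `|f w| <= M) -> `|mean P f| <= M.
Proof.
move=> mf fM; rewrite -[leRHS](mean_cst M); apply: norm_mean_le => //.
exact: L1_cst.
Qed.

Lemma EFin_mean f : L1 P f -> (mean P f)%:E = (\int[P]_w (f w)%:E)%E.
Proof. by move=> Lf; rewrite /mean /Rintegral fineK// integrable_fin_num. Qed.

Lemma mean_indic A : measurable A -> mean P (\1_A) = fine (P A).
Proof. by move=> mA; rewrite /mean /Rintegral integral_indic// setIT. Qed.

Lemma L1_indic A : measurable A -> L1 P (\1_A).
Proof.
move=> mA; apply: (@bounded_L1 _ 1) => // w.
by rewrite indicE; case: (_ \in _); rewrite ?normr1 ?normr0.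
Qed.

(** Markov's inequality, for a pointwise comparison with an indicator. *)
Lemma mean_markov f A (e : R) : 0 < e -> L1 P f -> measurable A ->
  (forall w, 0 <= f w) -> (forall w, A w -> e <= f w) ->
  (P A <= (mean P f / e)%:E)%E.
Proof.
move=> e0 Lf mA f0 Af; rewrite -(fineK (fin_num_measure P _ mA)) lee_fin.
rewrite ler_pdivlMr// mulrC -mean_indic// -meanZ; last exact: L1_indic.
apply: le_mean => //; first exact/L1Z/L1_indic.
move=> w; rewrite indicE; have [|] := boolP (w \in A).
  by rewrite inE => /Af; rewrite mulr1.
by rewrite mulr0.
Qed.

Lemma mean_dominated_cvg0 (f : nat -> T -> R) g :
  (forall n, measurable_fun setT (f n)) -> L1 P g ->
  (forall n w, `|f n w| <= g w) -> (forall w, f n w @[n --> \oo] --> 0) ->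
  mean P (f n) @[n --> \oo] --> 0.
Proof.
move=> mf Lg fg f0.
have [||||_ _] := @dominated_convergence _ T R P setT measurableT
  (fun n w => (f n w)%:E) (cst 0%E) (fun w => (g w)%:E) _ _ _ Lg.
- by move=> n; exact/measurable_EFinP.
- exact: measurable_cst.
- by apply: aeW => w _; apply: cvg_EFin; [exact: nearW|exact: f0].
- by apply: aeW => w n _; rewrite lee_fin.
by rewrite integral0 => /fine_cvgP[_].
Qed.

End mean_theory.

(** * Laws and independence *)

Definition same_law (R : realType) (d d' e : measure_display)
    (T : measurableType d) (T' : measurableType d') (E : measurableType e)
    (P : probability T R) (P' : probability T' R)
    (X : T -> E) (X' : T' -> E) : Prop :=
  forall A, measurable A -> P (X @^-1` A) = P' (X' @^-1` A).

Section same_law.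
Context (R : realType) (d d' e : measure_display).
Context (T : measurableType d) (T' : measurableType d') (E : measurableType e).
Variables (P : probability T R) (P' : probability T' R).
Variables (X : T -> E) (X' : T' -> E).
Hypothesis mX : measurable_fun setT X.
Hypothesis mX' : measurable_fun setT X'.
Hypothesis XX' : same_law P P' X X'.

Lemma ge0_integral_same_law (f : E -> \bar R) : measurable_fun setT f ->
  (forall x, 0 <= f x)%E -> (\int[P]_w f (X w) = \int[P']_w f (X' w))%E.
Proof.
move=> mf f0.
rewrite -[LHS](ge0_integral_pushforward mX P (D := setT))//.
rewrite -[RHS](ge0_integral_pushforward mX' P' (D := setT))//.
by apply: eq_measure_integral => A mA _; exact: XX'.
Qed.

Lemma L1_same_law (f : E -> R) : measurable_fun setT f ->
  L1 P' (f \o X') -> L1 P (f \o X).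
Proof.
move=> mf /integrableP[_ fy]; apply/integrableP; split.
  exact/measurable_EFinP/measurableT_comp.
rewrite (@ge0_integral_same_law (fun x => `|(f x)%:E|%E))//.
by apply/measurableT_comp => //; exact/measurable_EFinP.
Qed.

Lemma mean_same_law (f : E -> R) : measurable_fun setT f ->
  L1 P' (f \o X') -> mean P (f \o X) = mean P' (f \o X').
Proof.
move=> mf Lf'; have Lf := L1_same_law mf Lf'.
have mEf : measurable_fun setT (EFin \o f) by exact/measurable_EFinP.
rewrite /mean /Rintegral; congr fine.
rewrite -[LHS](integral_pushforward mX (D := setT) mEf)//.
rewrite -[RHS](integral_pushforward mX' (D := setT) mEf)//.
by apply: eq_measure_integral => A mA _; exact: XX'.
Qed.

End same_law.

Definition indep (R : realType) (d e e' : measure_display)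
    (T : measurableType d) (E : measurableType e) (E' : measurableType e')
    (P : probability T R) (X : T -> E) (Y : T -> E') : Prop :=
  forall A B, measurable A -> measurable B ->
    P (X @^-1` A `&` Y @^-1` B) = (P (X @^-1` A) * P (Y @^-1` B))%E.

Definition mfun_pack d d' (T : measurableType d) (T' : measurableType d')
  (f : T -> T') (mf : measurable_fun setT f) : {mfun T >-> T'} :=
  MeasurableFun.Pack (MeasurableFun.Class (isMeasurableFun.Build _ _ _ _ _ mf)).

Section indep_fubini.
Context (R : realType) (d d' e e' : measure_display).
Context (T : measurableType d) (T' : measurableType d').
Context (E : measurableType e) (E' : measurableType e').
Variables (P : probability T R) (P' : probability T' R).
Variables (X : T -> E) (Y : T -> E') (Y' : T' -> E').
Hypothesis mX : measurable_fun setT X.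
Hypothesis mY : measurable_fun setT Y.
Hypothesis mY' : measurable_fun setT Y'.
Hypothesis XY : indep P X Y.
Hypothesis YY' : same_law P P' Y Y'.

Let mXY : measurable_fun setT (fun w => (X w, Y w)).
Proof. exact: measurable_fun_pair. Qed.

Let lawX : probability E R := distribution P (mfun_pack mX).
Let lawY : probability E' R := distribution P' (mfun_pack mY').
Let lawXY : probability (E * E')%type R := distribution P (mfun_pack mXY).

(** The joint law of independent variables is the product of their laws. *)
Lemma indep_product_law Q : measurable Q -> (lawX \x lawY)%E Q = lawXY Q.
Proof.
apply: (product_measure_unique (m' := lawXY)) => A B mA mB.
exact: etrans (XY mA mB) (congr1 (mule _) (YY' mB)).
Qed.

Lemma measurable_indep_section (f : E * E' -> R) (M : R) :
  measurable_fun setT f -> (forall z, `|f z| <= M) ->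
  measurable_fun setT (fun x => mean P' (fun w => f (x, Y' w))).
Proof.
move=> mf fM; have mEf : measurable_fun setT (EFin \o f).
  exact/measurable_EFinP.
have intf : (lawX \x lawY)%E.-integrable setT (EFin \o f).
  apply: (le_integrable measurableT (g := cst M%:E)) => //=.
    by move=> z _; rewrite lee_fin (le_trans (fM z))// ler_norm.
  exact: (@finite_measure_integrable_cst _ _ _
    (product_subprobability
      ((lawX : subprobability E R), (lawY : subprobability E' R))) setT M measurableT).
apply: measurableT_comp => //.
have := measurable_fubini_F intf; congr measurable_fun.
apply/funext => x; rewrite /fubini_F.
rewrite (integral_pushforward (D := setT) mY')//.
  by apply: measurableT_comp => //; exact: measurable_pair1.
rewrite preimage_setT; apply: (@bounded_L1 _ _ _ P' (fun w => f (x, Y' w)) M) => //.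
apply: measurableT_comp => //; exact: measurableT_comp.
Qed.

(** Fubini's theorem: a variable that is independent of [X] may be integrated out,
    on a probability space of its own. *)
Lemma integral_indep (f : E * E' -> R) : measurable_fun setT f ->
  L1 P (fun w => f (X w, Y w)) ->
  (forall x, L1 P' (fun w => f (x, Y' w))) ->
  (\int[P]_w (f (X w, Y w))%:E =
   \int[P]_w \int[P']_w' (f (X w, Y' w'))%:E)%E.
Proof.
move=> mf Lf Lsec; have mEf : measurable_fun setT (EFin \o f).
  exact/measurable_EFinP.
have intf : (lawX \x lawY)%E.-integrable setT (EFin \o f).
  apply/integrableP; split => //.
  rewrite (eq_measure_integral lawXY); last first.
    by move=> A mA _; exact: indep_product_law.
  have /integrableP[_] := integrable_pushforward mXY mEf Lf measurableT.
  by [].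
rewrite -[LHS](integral_pushforward mXY (D := setT) mEf)//.
rewrite (eq_measure_integral (lawX \x lawY)%E); last first.
  by move=> A mA _; rewrite [RHS]indep_product_law.
rewrite -(integral12_prod_meas1 intf).
have FE x : fubini_F lawY (EFin \o f) x = (\int[P']_w' (f (x, Y' w'))%:E)%E.
  rewrite /fubini_F (integral_pushforward mY' (D := setT) (f:=fun y => (f (x,y))%:E))//.
  - by apply: (measurableT_comp mEf); exact: measurable_pair1.
  - exact: Lsec.
have mF := measurable_fubini_F intf.
have iF := integrable_fubini_F intf.
rewrite (integral_pushforward mX (D := setT) mF)//; last first.
  apply/integrableP; split; first exact: measurableT_comp.
  have /integrableP[_] := iF.
  rewrite (ge0_integral_pushforward mX P (D := setT))//.
  exact: measurableT_comp.
by rewrite preimage_setT; apply: eq_integral => w _ /=; rewrite FE.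
Qed.

Lemma mean_indep_bounded (f : E * E' -> R) (M : R) : measurable_fun setT f ->
  (forall z, `|f z| <= M) ->
  mean P (fun w => f (X w, Y w)) =
  mean P (fun w => mean P' (fun w' => f (X w, Y' w'))).
Proof.
move=> mf fM; rewrite {1 2}/mean /Rintegral; congr fine.
have Lsec x : L1 P' (fun w => f (x, Y' w)).
  apply: (@bounded_L1 _ _ _ _ _ M) => //.
  apply: measurableT_comp => //; exact: measurable_fun_pair.
rewrite integral_indep//; last first.
  apply: (@bounded_L1 _ _ _ _ _ M) => //.
  exact: measurableT_comp.
by apply: eq_integral => w _; rewrite EFin_mean.
Qed.

End indep_fubini.

Lemma mean_indepM (R : realType) (d : measure_display) (T : measurableType d)
    (P : probability T R) (X Y : T -> R) :
  indep P X Y -> L1 P X -> L1 P Y -> L1 P (fun w => X w * Y w) ->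
  mean P (fun w => X w * Y w) = mean P X * mean P Y.
Proof.
move=> XY LX LY LXY; rewrite [in LHS]/mean /Rintegral.
have mX := L1_measurable LX; have mY := L1_measurable LY.
rewrite (@integral_indep _ _ _ _ _ _ _ _ _ P P X Y Y mX mY mY XY _
  (fun z => z.1 * z.2))//; last 2 first.
  exact: measurable_funM.
  by move=> x; exact: L1Z.
transitivity (fine (\int[P]_w (mean P Y * X w)%:E)%E).
  congr fine; apply: eq_integral => w _.
  by rewrite -EFin_mean; [rewrite meanZ// mulrC|exact: L1Z].
by rewrite -/(Rintegral P setT _) -/(mean _ _) meanZ// mulrC.
Qed.

(** * The past and the future of an independent sequence *)

Section adapted.
Context (R : realType) (d e : measure_display).
Context (Om : measurableType d) (E : measurableType e).
Variables (P : probability Om R) (X : nat -> Om -> E).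

Definition future_event (J : {fset nat}) (A : nat -> set E) : set Om :=
  \bigcap_(i in [set` J]) X i @^-1` A i.

(** [V] stands for a function of the past [X 0, ..., X n.-1], of which only the
    independence of the whole future [X n, X n.+1, ...] is retained. *)
Definition adapted (n : nat) (d' : measure_display) (M : measurableType d')
    (V : Om -> M) : Prop :=
  measurable_fun setT V /\
  forall (J : {fset nat}) (A : nat -> set E) (B : set M),
    (forall i, i \in J -> measurable (A i)) ->
    (forall i, i \in J -> (n <= i)%N) -> measurable B ->
    P (V @^-1` B `&` future_event J A) =
    (P (V @^-1` B) * P (future_event J A))%E.

Hypothesis mX : forall i, measurable_fun setT (X i).
Hypothesis indX : mutually_independent P X.

Lemma measurable_future_event (J : {fset nat}) (A : nat -> set E) :
  (forall i, i \in J -> measurable (A i)) -> measurable (future_event J A).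
Proof.
move=> mA; apply: bigcap_measurableType => i iJ.
by rewrite -[_ @^-1` _]setTI; apply: mX => //; exact: mA.
Qed.

Lemma adapted_cst n (d' : measure_display) (M : measurableType d') (v : M) :
  adapted n (fun=> v).
Proof.
split=> // J A B mA _ mB; rewrite preimage_cst; case: ifPn => _.
  by rewrite setTI probability_setT mul1e.
by rewrite set0I measure0 mul0e.
Qed.

Lemma adapted_comp n (d' d'' : measure_display) (M : measurableType d')
  (M' : measurableType d'') (V : Om -> M) (f : M -> M') :
  measurable_fun setT f -> adapted n V -> adapted n (f \o V).
Proof.
move=> mf [mV aV]; split=> [|J A B mA mJ mB]; first exact: measurableT_comp.
rewrite comp_preimage; apply: aV => //.
by rewrite -[_ @^-1` _]setTI; exact: mf.
Qed.

Let upd n (B : set E) (A : nat -> set E) i := if i == n then B else A i.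

Let future_eventU1 n (J : {fset nat}) A B : (forall i, i \in J -> (n < i)%N) ->
  future_event (n |` J)%fset (upd n B A) = X n @^-1` B `&` future_event J A.
Proof.
move=> nJ; rewrite /future_event bigcap_fsetU1 /upd eqxx; congr (_ `&` _).
apply: eq_bigcapr => i /= iJ; case: eqP => // iE.
by move: (nJ _ iJ); rewrite iE ltnn.
Qed.

Let measurable_upd n (J : {fset nat}) A B :
  (forall i, i \in J -> measurable (A i)) -> measurable B ->
  forall i, i \in (n |` J)%fset -> measurable (upd n B A i).
Proof.
by move=> mA mB i; rewrite !inE /upd; case: eqP => //= _ /mA.
Qed.

Lemma adapted_indep n (d' : measure_display) (M : measurableType d')
  (V : Om -> M) : adapted n V -> indep P V (X n).
Proof.
move=> [mV aV] A B mA mB.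
have := aV [fset n]%fset (fun=> B) A; rewrite /future_event.
rewrite set_fset1 bigcap_set1; apply => // i; rewrite !inE => /eqP -> //.
Qed.

Let prob_future_eventU1 n (J : {fset nat}) A B :
  (forall i, i \in J -> measurable (A i)) -> measurable B ->
  (forall i, i \in J -> (n < i)%N) ->
  P (X n @^-1` B `&` future_event J A) =
  (P (X n @^-1` B) * P (future_event J A))%E.
Proof.
move=> mA mB nJ; rewrite -future_eventU1// /future_event.
rewrite indX; last exact: measurable_upd.
rewrite indX// big_fsetU1 /=; last first.
  by apply/negP => /nJ; rewrite ltnn.
rewrite {1}/upd eqxx; congr (_ * _)%E; apply: eq_big_seq => i iJ.
rewrite /upd; case: eqP => // iE.
by move: (nJ _ iJ); rewrite iE ltnn.
Qed.

(** A new observation [X n] is absorbed by the past. The two sides agree when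
    the event concerning the pair [(V, X n)] is a rectangle; these generate the
    product sigma-algebra. *)
Lemma adapted_pair n (d' : measure_display) (M : measurableType d')
  (V : Om -> M) : adapted n V -> adapted n.+1 (fun w => (V w, X n w)).
Proof.
move=> aV; have [mV aVE] := aV.
have mZ : measurable_fun setT (fun w => (V w, X n w)).
  exact: measurable_fun_pair.
split=> // J A Q mA nJ mQ.
pose D := future_event J A.
have mD : measurable D by exact: measurable_future_event.
have fD : P D \is a fin_num by exact: fin_num_measure.
pose pD := NngNum (fine_ge0 (measure_ge0 P D)).
pose Z := mfun_pack mZ.
pose m1 : {measure set (M * E) -> \bar R} :=
  measure_function_pushforward__canonical__measure_function_Measure
    (mrestr P mD) mZ.
pose m2 : {measure set (M * E) -> \bar R} := mscale pD (distribution P Z).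
have m2E B : m2 B = (P (Z @^-1` B) * P D)%E.
  by rewrite muleC -[in RHS](fineK fD).
pose C : set (set (M * E)) :=
  [set B `*` B' | B in measurable & B' in measurable].
suff : m1 Q = m2 Q by rewrite m2E.
apply: (measure_unique C (fun=> setT)) => //.
- exact: measurable_prod_measurableType.
- move=> _ _ [B1 mB1 [B1' mB1' <-]] [B2 mB2 [B2' mB2' <-]].
  rewrite -setXI; exists (B1 `&` B2); first exact: measurableI.
  by exists (B1' `&` B2') => //; exact: measurableI.
- by move=> _; exists setT => //; exists setT => //; rewrite setXTT.
- by rewrite bigcup_const//; exists 0%N.
- move=> _ [B mB [B' mB' <-]]; rewrite m2E.
  transitivity (P (V @^-1` B `&` (X n @^-1` B' `&` D))).
    by rewrite setIA.
  transitivity (P (V @^-1` B `&` X n @^-1` B') * P D)%E; last by [].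
  rewrite -future_eventU1// aVE//; last 2 first.
    exact: measurable_upd.
    by move=> i; rewrite !inE => /predU1P[->//|/nJ/ltnW].
  rewrite future_eventU1// prob_future_eventU1//.
  by rewrite (adapted_indep aV)// muleA.
- move=> _; apply: le_lt_trans (ltry 1).
  by apply: probability_le1; rewrite preimage_setT setTI.
Qed.

Lemma adapted_step n (d' d'' : measure_display) (M : measurableType d')
  (M' : measurableType d'') (V : Om -> M) (phi : M * E -> M') :
  measurable_fun setT phi -> adapted n V ->
  adapted n.+1 (fun w => phi (V w, X n w)).
Proof. by move=> mphi aV; exact: (adapted_comp mphi (adapted_pair aV)). Qed.

End adapted.

Lemma mutually_independent_comp (R : realType) (d e e' : measure_display)
    (Om : measurableType d) (E : measurableType e) (E' : measurableType e')
    (P : probability Om R) (I : choiceType) (X : I -> Om -> E) (h : E -> E') :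
  measurable_fun setT h -> mutually_independent P X ->
  mutually_independent P (fun i => h \o X i).
Proof.
move=> mh iX J A mA; have := iX J (fun i => h @^-1` A i); apply => i iJ.
by rewrite -[_ @^-1` _]setTI; apply: mh => //; exact: mA.
Qed.

Lemma mutually_independent_indep (R : realType) (d e : measure_display)
    (Om : measurableType d) (E : measurableType e)
    (P : probability Om R) (I : choiceType) (X : I -> Om -> E) (i j : I) :
  i != j -> mutually_independent P X -> indep P (X i) (X j).
Proof.
move=> ij iX A B mA mB; pose C k := if k == i then A else B.
have := iX [fset i; j]%fset C.
rewrite bigcap_fsetU1 set_fset1 bigcap_set1 big_fsetU1 ?inE//= big_seq_fset1.
by rewrite /C eqxx eq_sym (negbTE ij); apply => k _; case: ifP.
Qed.

(** * Sums of independent variables *)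

(** One step of a random walk with increment [Y], read on test functions. *)
Definition step_op (R : realType) (d : measure_display) (T : measurableType d)
    (P : probability T R) (Y : T -> R) (f : R -> R) (x : R) : R :=
  mean P (fun w => f (x + Y w)).

Section step_op.
Context (R : realType) (d : measure_display) (T : measurableType d).
Variables (P : probability T R) (Y : T -> R).
Hypothesis mY : measurable_fun setT Y.

Let measurable_shift (f : R -> R) x : measurable_fun setT f ->
  measurable_fun setT (fun w => f (x + Y w)).
Proof.
by move=> mf; apply: measurableT_comp => //; exact: measurable_funD.
Qed.

Lemma L1_step (f : R -> R) (M : R) x : measurable_fun setT f ->
  (forall x, `|f x| <= M) -> L1 P (fun w => f (x + Y w)).
Proof. by move=> mf fM; apply: (@bounded_L1 _ _ _ _ _ M) => //; exact: measurable_shift. Qed.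

Lemma step_op_bounded (f : R -> R) (M : R) : measurable_fun setT f ->
  (forall x, `|f x| <= M) -> forall x, `|step_op P Y f x| <= M.
Proof.
by move=> mf fM x; apply: norm_mean_bounded => //; exact: measurable_shift.
Qed.

Lemma measurable_step_op (f : R -> R) (M : R) : measurable_fun setT f ->
  (forall x, `|f x| <= M) -> measurable_fun setT (step_op P Y f).
Proof.
move=> mf fM.
apply: (@measurable_indep_section R _ _ _ _ T T R R P P
  (fun=> 0) Y (measurable_cst _) mY (fun z => f (z.1 + z.2)) M) => //.
by apply: measurableT_comp => //; exact: measurable_funD.
Qed.

Lemma step_op_same_law (d' : measure_display) (T' : measurableType d')
  (P' : probability T' R) (Y' : T' -> R) (f : R -> R) (M : R) :
  measurable_fun setT Y' -> same_law P' P Y' Y ->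
  measurable_fun setT f -> (forall x, `|f x| <= M) ->
  step_op P' Y' f = step_op P Y f.
Proof.
move=> mY' YY' mf fM; apply/funext => x.
apply: (mean_same_law (f := fun y => f (x + y)) mY' mY YY').
  by apply: measurableT_comp => //; exact: measurable_funD.
exact: L1_step.
Qed.

End step_op.

Section walk.
Context (R : realType) (d : measure_display) (Om : measurableType d).
Variables (P : probability Om R) (X : nat -> Om -> R).
Hypothesis mX : forall i, measurable_fun setT (X i).
Hypothesis indX : mutually_independent P X.

Fixpoint walk_op n k (f : R -> R) : R -> R :=
  if k is k'.+1 then step_op P (X n) (walk_op n.+1 k' f) else f.

Lemma walk_op_bounded n k (f : R -> R) (M : R) : measurable_fun setT f ->
  (forall x, `|f x| <= M) ->
  measurable_fun setT (walk_op n k f) /\ (forall x, `|walk_op n k f x| <= M).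
Proof.
move=> mf fM; elim: k n => //= k IHk n; have [mg gM] := IHk n.+1.
split; first exact: (measurable_step_op _ (mX n) mg gM).
exact: step_op_bounded.
Qed.

(** The next step, independent of the past, is replaced by its operator; the
    weight [c], which belongs to the past, is carried along. *)
Lemma mean_adapted_walk n k (c s : Om -> R) (f : R -> R) (M M' : R) :
  adapted P X n (fun w => (c w, s w)) -> (forall w, `|c w| <= M') ->
  measurable_fun setT f -> (forall x, `|f x| <= M) ->
  mean P (fun w => c w * f (s w + \sum_(n <= i < n + k) X i w)) =
  mean P (fun w => c w * walk_op n k f (s w)).
Proof.
move=> + cM mf fM; elim: k n s => [|k IHk] n s acs.
  by apply: eq_mean => w; rewrite addn0 big_geq// addr0.
have [mg gM] := walk_op_bounded n.+1 k mf fM.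
(* [mean_indep_bounded] needs a function bounded everywhere, and not only at the
   values taken by [c]. *)
pose trunc (x : R) := Num.max (- M') (Num.min x M').
have truncE w : trunc (c w) = c w.
  have := cM w; rewrite ler_norml => /andP[h1 h2].
  by rewrite /trunc (min_idPl h2) (max_idPr h1).
have M'0 : 0 <= M'.
  by apply: le_trans (cM point); exact: normr_ge0.
have truncM x : `|trunc x| <= M'.
  rewrite ler_norml /trunc le_max lexx/= ge_max ge_min lexx orbT andbT.
  by rewrite ge0_cp.
have mtrunc : measurable_fun setT trunc.
  by apply: measurable_maxr => //; exact: measurable_minr.
transitivity (mean P (fun w =>
    c w * f (s w + X n w + \sum_(n.+1 <= i < n.+1 + k) X i w))).
  by apply: eq_mean => w; rewrite big_ltn ?addnS ?leq_addr// addrA addSn.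
rewrite (IHk n.+1 (fun w => s w + X n w)); last first.
  apply: (@adapted_step _ _ _ _ _ _ _ mX indX _ _ _ _ _ _
    (fun z : R * R * R => (z.1.1, z.1.2 + z.2)) _ acs).
  apply: measurable_fun_pair => /=; first exact: measurableT_comp.
  by apply: measurable_funD => //; exact: measurableT_comp.
have acsI := adapted_indep acs.
pose F (z : R * R * R) := trunc z.1.1 * walk_op n.+1 k f (z.1.2 + z.2).
have mF : measurable_fun setT F.
  apply: measurable_funM; first exact/measurableT_comp/measurableT_comp.
  apply: (measurableT_comp mg); apply: measurable_funD => //.
  exact: measurableT_comp.
have := @mean_indep_bounded R _ _ _ _ Om Om _ _ P P _ _ _ acs.1 (mX n) (mX n)
  acsI (fun _ _ => erefl) F (M' * M) mF.
rewrite /F /= => H; under eq_mean do rewrite -truncE.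
rewrite {}H; last by move=> z; rewrite normrM ler_pM.
apply: eq_mean => w; rewrite truncE meanZ//.
exact: (L1_step _ (mX n) _ mg gM).
Qed.

Lemma mean_walk n k (f : R -> R) (M : R) : measurable_fun setT f -> (forall x, `|f x| <= M) ->
  mean P (fun w => f (\sum_(n <= i < n + k) X i w)) = walk_op n k f 0.
Proof.
move=> mf fM.
have := @mean_adapted_walk n k (fun=> 1) (fun=> 0) f M 1.
under eq_mean do rewrite mul1r add0r.
under [RHS]eq_mean do rewrite mul1r.
rewrite mean_cst; apply => //; first exact: adapted_cst.
by rewrite normr1.
Qed.

Lemma adapted_walk n k (d' : measure_display) (M : measurableType d')
  (V : Om -> M) : adapted P X n V ->
  adapted P X (n + k) (fun w => (V w, \sum_(n <= i < n + k) X i w)).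
Proof.
move=> aV; elim: k => [|k IHk].
  rewrite addn0; under eq_fun do rewrite big_geq//.
  apply: (adapted_comp (f := fun v : M => (v, 0 : R)) _ aV).
  exact: measurable_fun_pair.
under eq_fun do rewrite addnS big_nat_recr ?leq_addr//=.
rewrite addnS.
apply: (@adapted_step _ _ _ _ _ _ _ mX indX _ _ _ _ _ _
  (fun z : M * R * R => (z.1.1, z.1.2 + z.2)) _ IHk).
apply: measurable_fun_pair => /=; first exact: measurableT_comp.
by apply: measurable_funD => //; exact: measurableT_comp.
Qed.

(** The increments of the walk over consecutive blocks are independent, in the
    form needed below: products of test functions. *)
Lemma mean_prod_blocks (b : nat -> nat) (f : nat -> R -> R) (M : R) r :
  {homo b : i j / (i <= j)%N} ->
  (forall j, measurable_fun setT (f j)) -> (forall j x, `|f j x| <= M) ->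
  mean P (fun w => \prod_(j < r) f j (\sum_(b j <= i < b j.+1) X i w)) =
  \prod_(j < r) mean P (fun w => f j (\sum_(b j <= i < b j.+1) X i w)).
Proof.
move=> ndb mf fM.
pose c q w := \prod_(j < q) f j (\sum_(b j <= i < b j.+1) X i w).
have cM q w : `|c q w| <= M ^+ q.
  rewrite /c normr_prod -[q in leRHS]card_ord -prodr_const.
  by apply: ler_prod => j _; rewrite normr_ge0/=.
have bS j : b j.+1 = (b j + (b j.+1 - b j))%N by rewrite subnKC// ndb.
have ac q : adapted P X (b q) (c q).
  elim: q => [|q IHq].
    rewrite /c; under eq_fun do rewrite big_ord0; exact: adapted_cst.
  rewrite /c; under eq_fun do rewrite big_ord_recr/=.
  rewrite -/(c q) bS.
  apply: (adapted_comp (f := fun z : R * R => z.1 * f q z.2) _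
    (adapted_walk _ IHq)).
  apply: measurable_funM => //; exact: measurableT_comp.
elim: r => [|r IHr].
  by under eq_mean do rewrite big_ord0; rewrite big_ord0 mean_cst.
under eq_mean do rewrite big_ord_recr/=.
rewrite big_ord_recr/= -IHr -/(c r).
have := @mean_adapted_walk (b r) (b r.+1 - b r) (c r) (fun=> 0) (f r) M _ _ (cM r).
rewrite -bS; under eq_mean do rewrite add0r; move=> ->//; last first.
  apply: (adapted_comp (f := fun z : R => (z, 0 : R)) _ (ac r)).
  exact: measurable_fun_pair.
have -> : mean P (fun w => f r (\sum_(b r <= i < b r.+1) X i w)) =
    walk_op (b r) (b r.+1 - b r) (f r) 0.
  by rewrite bS (mean_walk _ _ (mf r) (fM r)) addKn.
under eq_mean do rewrite mulrC; rewrite meanZ 1?mulrC//.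
by apply: (@bounded_L1 _ _ _ _ _ (M ^+ r)) => //; have [] := ac r.
Qed.

End walk.

(** For identically distributed steps the walk is described by the iterates of
    a single operator. *)
Lemma mean_iid_walk (R : realType) (d d' : measure_display)
    (Om : measurableType d) (P : probability Om R)
    (T : measurableType d') (P0 : probability T R) (Y : T -> R)
    (X : nat -> Om -> R) n k (f : R -> R) (M : R) :
  (forall i, measurable_fun setT (X i)) -> mutually_independent P X ->
  measurable_fun setT Y -> (forall i, same_law P P0 (X i) Y) ->
  measurable_fun setT f -> (forall x, `|f x| <= M) ->
  mean P (fun w => f (\sum_(n <= i < n + k) X i w)) =
  iter k (step_op P0 Y) f 0.
Proof.
move=> mX iX mY XY mf fM; rewrite (mean_walk mX iX n k mf fM).
congr (_ 0); elim: k n => //= k IHk n.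
have [mg gM] := walk_op_bounded P mX n.+1 k mf fM.
by rewrite (step_op_same_law (mY) (mX n) (XY n) mg gM) IHk.
Qed.

(** * Lindeberg's comparison of two random walks *)

Definition cubic_error (R : realType) (h : R) : R :=
  Num.min (h ^+ 2) (`|h| ^+ 3).

(** [f] has a second order expansion with the uniform error that a finite second
    moment can integrate. *)
Definition expansion2 (R : realType) (K : R) (f f1 f2 : R -> R) : Prop :=
  [/\ measurable_fun setT f, measurable_fun setT f1, measurable_fun setT f2,
      forall x, [/\ `|f x| <= K, `|f1 x| <= K & `|f2 x| <= K] &
      forall x h, `|f (x + h) - f x - f1 x * h - f2 x * h ^+ 2| <=
        K * cubic_error h].

Definition taylor2 (R : realType) (K : R) (f : R -> R) : Prop :=
  exists f1 f2 : R -> R, expansion2 K f f1 f2.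

Lemma taylor2_bounded (R : realType) (K : R) (f : R -> R) : taylor2 K f ->
  measurable_fun setT f /\ (forall x, `|f x| <= K).
Proof. by move=> [f1 [f2 [mf _ _ fK _]]]; split=> // x; case: (fK x). Qed.

Section cubic_error.
Context (R : realType).
Implicit Types h a : R.

Lemma cubic_error_ge0 h : 0 <= cubic_error h.
Proof. by rewrite /cubic_error le_min sqr_ge0/= exprn_ge0. Qed.

Lemma cubic_error_le_sqr h : cubic_error h <= h ^+ 2.
Proof. by rewrite /cubic_error ge_min lexx. Qed.

Lemma cubic_error_le_cube h : cubic_error h <= `|h| ^+ 3.
Proof. by rewrite /cubic_error ge_min lexx orbT. Qed.

Lemma measurable_cubic_error : measurable_fun setT (@cubic_error R).
Proof.
rewrite /cubic_error; apply: measurable_minr.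
  exact: exprn_measurable.
by apply: measurable_funX; exact: normr_measurable.
Qed.

End cubic_error.

Section taylor2_step.
Context (R : realType) (d : measure_display) (T : measurableType d).
Variables (P : probability T R) (Y : T -> R).
Hypothesis LY : L1 P Y.
Hypothesis LY2 : L1 P (fun w => Y w ^+ 2).

Let mY : measurable_fun setT Y := L1_measurable LY.

Lemma L1_cubic_error : L1 P (fun w => cubic_error (Y w)).
Proof.
apply: (le_L1 _ _ LY2); first exact: (measurableT_comp (@measurable_cubic_error R) mY).
move=> w; rewrite ger0_norm ?cubic_error_ge0// ger0_norm ?sqr_ge0//.
exact: cubic_error_le_sqr.
Qed.

(** Averaging over translations keeps the constant of the expansion, so that the
    operator can be iterated. *)
Lemma taylor2_step_op K f : taylor2 K f -> taylor2 K (step_op P Y f).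
Proof.
move=> [f1 [f2 [mf mf1 mf2 fK fh]]].
have K0 x : `|f x| <= K by case: (fK x).
have K1 x : `|f1 x| <= K by case: (fK x).
have K2 x : `|f2 x| <= K by case: (fK x).
exists (step_op P Y f1), (step_op P Y f2); split.
- exact: (measurable_step_op _ mY mf K0).
- exact: (measurable_step_op _ mY mf1 K1).
- exact: (measurable_step_op _ mY mf2 K2).
- by move=> x; split; apply: step_op_bounded.
move=> x h.
have L0 x' := L1_step P mY x' mf K0.
have L1' x' := L1_step P mY x' mf1 K1.
have L2 x' := L1_step P mY x' mf2 K2.
rewrite /step_op ![(mean _ _ * _)]mulrC -!meanZ// -!meanB//; last first.
- exact: L1Z.
- exact: L1B.
- exact: L1Z.
- by apply: L1B; [exact: L1B|exact: L1Z].
apply: norm_mean_bounded.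
  apply: (L1_measurable (P := P)).
  by apply: L1B; [apply: L1B; [exact: L1B|exact: L1Z]|exact: L1Z].
move=> w; have := fh (x + Y w) h.
by rewrite [x + Y w + h]addrAC [f1 _ * h]mulrC [f2 _ * _]mulrC.
Qed.

Lemma step_op_expansion K f f1 f2 x : expansion2 K f f1 f2 -> mean P Y = 0 ->
  `|step_op P Y f x - f x - f2 x * mean P (fun w => Y w ^+ 2)| <=
  K * mean P (fun w => cubic_error (Y w)).
Proof.
move=> [mf mf1 mf2 fK fh] EY.
have K0 x' : `|f x'| <= K by case: (fK x').
have L0 := L1_step P mY x mf K0.
have La : L1 P (fun w => f (x + Y w) - f x) by apply: L1B => //; exact: L1_cst.
have Lb : L1 P (fun w => f (x + Y w) - f x - f1 x * Y w).
  by apply: L1B => //; exact: L1Z.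
have -> : step_op P Y f x - f x - f2 x * mean P (fun w => Y w ^+ 2) =
    mean P (fun w => f (x + Y w) - f x - f1 x * Y w - f2 x * Y w ^+ 2).
  rewrite meanB//; last exact: L1Z.
  rewrite meanB//; last exact: L1Z.
  rewrite meanB//; last exact: L1_cst.
  by rewrite mean_cst !meanZ// EY mulr0 subr0.
rewrite -meanZ; last exact: L1_cubic_error.
apply: norm_mean_le => //; first exact/L1Z/L1_cubic_error.
by apply: (L1_measurable (P := P)); apply: L1B => //; exact: L1Z.
Qed.

End taylor2_step.

(** Replacing the steps [Y] of a random walk by steps [Z] one at a time: each
    replacement is a second order Taylor expansion, in which the means cancel,
    and the operators contract the supremum norm. *)
Lemma lindeberg (R : realType) (d d' : measure_display)
    (T : measurableType d) (T' : measurableType d')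
    (P : probability T R) (P' : probability T' R) (Y : T -> R) (Z : T' -> R)
    (K : R) f n x :
  L1 P Y -> L1 P (fun w => Y w ^+ 2) -> mean P Y = 0 ->
  L1 P' Z -> L1 P' (fun w => Z w ^+ 2) -> mean P' Z = 0 ->
  taylor2 K f ->
  `|iter n (step_op P Y) f x - iter n (step_op P' Z) f x| <=
    n%:R * (K * (`|mean P (fun w => Y w ^+ 2) - mean P' (fun w => Z w ^+ 2)| +
                 mean P (fun w => cubic_error (Y w)) +
                 mean P' (fun w => cubic_error (Z w)))).
Proof.
move=> LY LY2 EY LZ LZ2 EZ tf.
set e := K * _.
have mY := L1_measurable LY; have mZ := L1_measurable LZ.
have tY m : taylor2 K (iter m (step_op P Y) f).
  by elim: m => //= m; exact: taylor2_step_op.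
have tZ m : taylor2 K (iter m (step_op P' Z) f).
  by elim: m => //= m; exact: taylor2_step_op.
have step g : taylor2 K g -> forall y, `|step_op P Y g y - step_op P' Z g y| <= e.
  move=> [g1 [g2 xg]] y.
  have eY := step_op_expansion LY LY2 y xg EY.
  have eZ := step_op_expansion LZ LZ2 y xg EZ.
  have [_ _ _ gK _] := xg.
  move: eY eZ; rewrite /e.
  set vY := mean P _; set vZ := mean P' _; set qY := mean P _; set qZ := mean P' _.
  set sY := step_op P Y g y; set sZ := step_op P' Z g y => eY eZ.
  have g2K : `|g2 y * (vY - vZ)| <= K * `|vY - vZ|.
    by rewrite normrM ler_wpM2r//; case: (gK y).
  rewrite !mulrDr.
  have -> : sY - sZ = g2 y * (vY - vZ) + (sY - g y - g2 y * vY) -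
      (sZ - g y - g2 y * vZ) by ring.
  apply: (le_trans (ler_normB _ _)); apply: lerD => //.
  by apply: (le_trans (ler_normD _ _)); apply: lerD.
elim: n x => [|n IHn] x; first by rewrite subrr normr0 mul0r.
rewrite !iterS.
have [mgY bY] := taylor2_bounded (tY n); have [mgZ bZ] := taylor2_bounded (tZ n).
set gY := iter n (step_op P Y) f in mgY bY IHn *.
set gZ := iter n (step_op P' Z) f in mgZ bZ IHn *.
have -> : step_op P Y gY x - step_op P' Z gZ x =
  (step_op P Y gY x - step_op P Y gZ x) +
  (step_op P Y gZ x - step_op P' Z gZ x) by ring.
apply: (le_trans (ler_normD _ _)).
rewrite -natr1 mulrDl mul1r; apply: lerD; last exact: (step _ (tZ n)).
have LgY := L1_step P mY x mgY bY.
have LgZ := L1_step P mY x mgZ bZ.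
rewrite /step_op -meanB//; apply: norm_mean_bounded => //.
exact: (L1_measurable (L1B LgY LgZ)).
Qed.

(** * Cubic B-splines *)

Section spline.
Context (R : realType).
Implicit Types x h : R.

Let p x : R := Num.max x 0 ^+ 3.
Let p1 x : R := 3 * Num.max x 0 ^+ 2.
Let p2 x : R := 3 * Num.max x 0.

Let p_expansion x h :
  `|p (x + h) - p x - p1 x * h - p2 x * h ^+ 2| <= `|h| ^+ 3.
Proof.
rewrite /p /p1 /p2 -normrX.
have [x0|x0] := leP 0 x; have [y0|y0] := leP 0 (x + h).
- rewrite (_ : _ - _ = h ^+ 3)//; ring.
- have h0 : h < 0 by lra.
  rewrite (_ : _ - _ = h ^+ 3 - (x + h) ^+ 3); last by ring.
  have y3 : (x + h) ^+ 3 <= 0 by rewrite exprS mulr_le0_ge0 ?sqr_ge0// ltW.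
  have hy : h ^+ 3 <= (x + h) ^+ 3.
    rewrite -subr_ge0 (_ : _ - _ =
      x * ((x + h) ^+ 2 + (x + h) * h + h ^+ 2)); last by ring.
    by rewrite mulr_ge0//; nra.
  by rewrite !ler0_norm//; lra.
- have h0 : 0 < h by lra.
  rewrite (_ : _ - _ = (x + h) ^+ 3); last by ring.
  have y3 : 0 <= (x + h) ^+ 3 by rewrite exprn_ge0.
  have h3 : 0 <= h ^+ 3 by rewrite exprn_ge0// ltW.
  by rewrite !ger0_norm// lerXn2r ?nnegrE//; lra.
- by rewrite (_ : _ - _ = 0) ?normr0//; ring.
Qed.

Let mp (c : R) n : measurable_fun setT (fun x => Num.max (x - c) 0 ^+ n).
Proof.
apply: measurable_funX; apply: measurable_maxr => //; exact: measurable_funB.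
Qed.

(** A third difference of truncated cubes, which climbs from 0 to 1; its unit
    increments are the cubic B-splines. *)
Definition ramp x : R :=
  6^-1 * (p x - 3 * p (x - 1) + 3 * p (x - 2) - p (x - 3)).

Lemma ramp_le0 x : x <= 0 -> ramp x = 0.
Proof.
move=> x0; rewrite /ramp /p.
by rewrite !max_r; [ring|lra..].
Qed.

Lemma ramp_ge3 x : 3 <= x -> ramp x = 1.
Proof.
move=> x3; rewrite /ramp /p.
by rewrite !max_l; [field|lra..].
Qed.

Definition bspline x : R := ramp x - ramp (x - 1).

Let b1 x : R := 6^-1 *
  (p1 x - 4 * p1 (x - 1) + 6 * p1 (x - 2) - 4 * p1 (x - 3) + p1 (x - 4)).

Let b2 x : R := 6^-1 *
  (p2 x - 4 * p2 (x - 1) + 6 * p2 (x - 2) - 4 * p2 (x - 3) + p2 (x - 4)).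

Let bsplineE x : bspline x = 6^-1 *
  (p x - 4 * p (x - 1) + 6 * p (x - 2) - 4 * p (x - 3) + p (x - 4)).
Proof.
rewrite /bspline /ramp.
have -> : x - 1 - 1 = x - 2 by ring.
have -> : x - 1 - 2 = x - 3 by ring.
have -> : x - 1 - 3 = x - 4 by ring.
ring.
Qed.

(* On each unit interval the spline and its first two Taylor coefficients are
   polynomials in the distance [y] to the left endpoint. *)
Let pieces x : [\/ (x <= 0 \/ 4 <= x) /\ [/\ bspline x = 0, b1 x = 0 & b2 x = 0],
  (exists2 y : R, 0 <= y <= 1 & [/\ bspline x = y ^+ 3 / 6,
     b1 x = y ^+ 2 / 2 & b2 x = y / 2]),
  (exists2 y : R, 0 <= y <= 1 &
     [/\ bspline x = (1 + 3 * y + 3 * y ^+ 2 - 3 * y ^+ 3) / 6,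
     b1 x = (1 + 2 * y - 3 * y ^+ 2) / 2 & b2 x = (1 - 3 * y) / 2]) |
  (exists2 y : R, 0 <= y <= 1 &
     [/\ bspline x = (4 - 6 * y ^+ 2 + 3 * y ^+ 3) / 6,
     b1 x = (3 * y ^+ 2 - 4 * y) / 2 & b2 x = (3 * y - 2) / 2]) \/
  (exists2 y : R, 0 <= y <= 1 &
     [/\ bspline x = (1 - y) ^+ 3 / 6, b1 x = - (1 - y) ^+ 2 / 2 &
     b2 x = (1 - y) / 2])].
Proof.
rewrite bsplineE /b1 /b2 /p1 /p2 /p.
have [h0|h0] := leP x 0.
  apply: Or41; split; first by left.
  by rewrite !max_r; [|lra..]; split; ring.
have u0 := ltW h0.
have [h1|h1] := leP x 1.
  apply: Or42; exists x; first by lra.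
  by rewrite !max_r; [|lra..]; split; field.
have u1 : 0 <= x - 1 by lra.
have [h2|h2] := leP x 2.
  apply: Or43; exists (x - 1); first by lra.
  by rewrite (max_l u1) !max_r; [|lra..]; split; field.
have u2 : 0 <= x - 2 by lra.
have [h3|h3] := leP x 3.
  apply: Or44; left; exists (x - 2); first by lra.
  by rewrite (max_l u1) (max_l u2) !max_r; [|lra..]; split; field.
have [h4|h4] := leP x 4.
  have u4 : x - 4 <= 0 by lra.
  apply: Or44; right; exists (x - 3); first by lra.
  by rewrite (max_r u4) !max_l; [|lra..]; split; field.
apply: Or41; split; first by right; lra.
by rewrite !max_l; [|lra..]; split; field.
Qed.

Lemma bspline_support x : x <= 0 \/ 4 <= x -> bspline x = 0.
Proof.
rewrite bsplineE /p => -[h|h]; first by rewrite !max_r; [ring|lra..].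
by rewrite !max_l; [field|lra..].
Qed.

Let powers (y : R) : 0 <= y <= 1 -> [/\ 0 <= y ^+ 2, y ^+ 2 <= y, 0 <= y ^+ 3 &
  y ^+ 3 <= y ^+ 2].
Proof.
move=> /andP[y0 y1]; split; rewrite ?sqr_ge0 ?exprn_ge0//.
  by rewrite expr2 ler_piMr.
by rewrite [leLHS]exprS ler_piMl ?sqr_ge0.
Qed.

Let powers2 (y : R) : 0 <= y <= 1 -> [/\ 0 <= y ^+ 2, y ^+ 2 <= y, 0 <= y ^+ 3 &
  y ^+ 3 <= y ^+ 2] /\ [/\ 0 <= (1 - y) ^+ 2, (1 - y) ^+ 2 <= 1 - y,
  0 <= (1 - y) ^+ 3 & (1 - y) ^+ 3 <= (1 - y) ^+ 2].
Proof. by move=> yI; split; apply: powers => //; lra. Qed.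

Lemma bspline_ge0 x : 0 <= bspline x.
Proof.
have [[_ [-> _ _]]|[y yI [-> _ _]]|[y yI [-> _ _]]|[[y yI [-> _ _]]|[y yI [-> _ _]]]] := pieces x => //;
  have [[? ? ? ?] [? ? ? ?]] := powers2 yI; lra.
Qed.

Let bounds x : [/\ `|bspline x| <= 1, `|b1 x| <= 1 & `|b2 x| <= 1].
Proof.
have [[_ [-> -> ->]]|[y yI [-> -> ->]]|[y yI [-> -> ->]]|[[y yI [-> -> ->]]|[y yI [-> -> ->]]]] := pieces x;
  rewrite ?normr0//; have [[? ? ? ?] [? ? ? ?]] := powers2 yI;
  split; rewrite ler_norml; lra.
Qed.

Let measurable_bspline : measurable_fun setT bspline.
Proof.
have -> : bspline = (fun x => 6^-1 * (Num.max (x - 0) 0 ^+ 3 -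
    4 * Num.max (x - 1) 0 ^+ 3 + 6 * Num.max (x - 2) 0 ^+ 3 -
    4 * Num.max (x - 3) 0 ^+ 3 + Num.max (x - 4) 0 ^+ 3)).
  by apply/funext => x; rewrite bsplineE /p subr0.
by repeat first [exact: mp | exact: measurable_cst |
    apply: measurable_funB | apply: measurable_funD | apply: measurable_funM].
Qed.

(** For small [h] the expansions of the truncated cubes are combined; for large
    [h] the spline and its coefficients are bounded by 1. *)
Lemma taylor2_bspline : taylor2 3 bspline.
Proof.
exists b1, b2; split.
- exact: measurable_bspline.
- have -> : b1 = (fun x => 6^-1 * (3 * Num.max (x - 0) 0 ^+ 2 -
    4 * (3 * Num.max (x - 1) 0 ^+ 2) + 6 * (3 * Num.max (x - 2) 0 ^+ 2) -
    4 * (3 * Num.max (x - 3) 0 ^+ 2) + 3 * Num.max (x - 4) 0 ^+ 2)).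
    by apply/funext => x; rewrite /b1 /p1 subr0.
  by repeat first [exact: mp | exact: measurable_cst |
    apply: measurable_funB | apply: measurable_funD | apply: measurable_funM].
- have -> : b2 = (fun x => 6^-1 * (3 * Num.max (x - 0) 0 ^+ 1 -
    4 * (3 * Num.max (x - 1) 0 ^+ 1) + 6 * (3 * Num.max (x - 2) 0 ^+ 1) -
    4 * (3 * Num.max (x - 3) 0 ^+ 1) + 3 * Num.max (x - 4) 0 ^+ 1)).
    by apply/funext => x; rewrite /b2 /p2 subr0.
  by repeat first [exact: mp | exact: measurable_cst |
    apply: measurable_funB | apply: measurable_funD | apply: measurable_funM].
- by move=> x; have [u v w] := bounds x; split; apply: (le_trans _ (ler1n _ 3)).
move=> x h.
have [bx b1x b2x] := bounds x; have [bxh _ _] := bounds (x + h).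
rewrite /cubic_error /Num.min; case: ifPn => [h1|].
  have h2 : 1 <= `|h|.
    rewrite leNgt; apply/negP => hlt; move: h1; apply/negP.
    rewrite -leNgt -real_normK ?num_real// exprS ler_piMl ?sqr_ge0//; exact: ltW.
  have hh : h ^+ 2 = `|h| * `|h| by rewrite -real_normK ?num_real.
  have : `|b1 x * h| <= `|h| by rewrite normrM ler_piMl.
  have : `|b2 x * h ^+ 2| <= h ^+ 2.
    by rewrite normrM (ger0_norm (sqr_ge0 _)) ler_piMl ?sqr_ge0.
  have := bspline_ge0 x; have := bspline_ge0 (x + h).
  rewrite !ler_norml in bx b1x b2x bxh *.
  have : `|h| <= `|h| * `|h| by rewrite ler_peMl.
  have : 1 <= h ^+ 2 by rewrite hh; nra.
  rewrite hh; set a := `|h|; lra.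
move=> _.
have -> : bspline (x + h) - bspline x - b1 x * h - b2 x * h ^+ 2 =
   6^-1 * ((p (x + h) - p x - p1 x * h - p2 x * h ^+ 2)
  - 4 * (p (x - 1 + h) - p (x - 1) - p1 (x - 1) * h - p2 (x - 1) * h ^+ 2)
  + 6 * (p (x - 2 + h) - p (x - 2) - p1 (x - 2) * h - p2 (x - 2) * h ^+ 2)
  - 4 * (p (x - 3 + h) - p (x - 3) - p1 (x - 3) * h - p2 (x - 3) * h ^+ 2)
  + (p (x - 4 + h) - p (x - 4) - p1 (x - 4) * h - p2 (x - 4) * h ^+ 2)).
  rewrite !bsplineE /b1 /b2.
  by rewrite ![x + h - _]addrAC; ring.
have := p_expansion x h; have := p_expansion (x - 1) h.
have := p_expansion (x - 2) h; have := p_expansion (x - 3) h.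
have := p_expansion (x - 4) h; rewrite !ler_norml.
set A := p (x + h) - _ - _ - _; set B := p (x - 1 + h) - _ - _ - _.
set C := p (x - 2 + h) - _ - _ - _; set D := p (x - 3 + h) - _ - _ - _.
set E := p (x - 4 + h) - _ - _ - _.
have : 0 <= `|h| ^+ 3 by apply: exprn_ge0.
move: (`|h| ^+ 3) => r; lra.
Qed.

(** Integer translates of [bspline] form a partition of unity: the sum of
    finitely many of them telescopes, [bspline] being an increment of [ramp]. *)
Lemma sum_bspline (a : R) n x :
  \sum_(i < n) bspline (x - a - i%:R) = ramp (x - a) - ramp (x - a - n%:R).
Proof.
elim: n => [|n IHn]; first by rewrite big_ord0 subr0 subrr.
rewrite big_ord_recr /= IHn /bspline -natr1 opprD addrA.
by rewrite addrA subrK.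
Qed.

Lemma ramp_itv x : 0 <= ramp x <= 1.
Proof.
pose n := (Num.truncn `|x|).+1; have xn : `|x| < n%:R by exact: truncnS_gt.
move: xn; rewrite ltr_norml => /andP[nx xn].
have sum0 y : 0 <= \sum_(i < n) bspline (y - i%:R).
  by apply: sumr_ge0 => i _; exact: bspline_ge0.
apply/andP; split.
  have := sum_bspline 0 n x; rewrite subr0 [ramp (x - n%:R)]ramp_le0; last by lra.
  by rewrite subr0 => <-; under eq_bigr do rewrite -{1}[x]subr0.
have := sum_bspline 0 (n + 3) (x + (n + 3)%:R).
rewrite subr0 addrK ramp_ge3; last by rewrite natrD; lra.
move=> h; have : 0 <= 1 - ramp x.
  by rewrite -h; apply: sumr_ge0 => i _; exact: bspline_ge0.
lra.
Qed.

End spline.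

(** The constant is the same for all translations [c]: a whole grid of splines
    can share it. *)
Lemma taylor2_affine (R : realType) (K a : R) (f : R -> R) : taylor2 K f ->
  exists K', forall c, taylor2 K' (fun x => f (a * x + c)).
Proof.
move=> [f1 [f2 [mf mf1 mf2 fK fh]]].
have K0 : 0 <= K by case: (fK 0) => h _ _; apply: le_trans h.
pose m := 1 + `|a| + `|a| ^+ 2 + `|a| ^+ 3.
have a0 : 0 <= `|a| by [].
have a2 : 0 <= `|a| ^+ 2 by apply: exprn_ge0.
have a3 : 0 <= `|a| ^+ 3 by apply: exprn_ge0.
exists (K * m) => c.
have maff : measurable_fun setT (fun x => a * x + c).
  by apply: measurable_funD => //; exact: measurable_funM.
exists (fun x => a * f1 (a * x + c)), (fun x => a ^+ 2 * f2 (a * x + c)).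
split.
- exact: measurableT_comp.
- by apply: measurable_funM => //; exact: measurableT_comp.
- by apply: measurable_funM => //; exact: measurableT_comp.
- move=> x; have [h0 h1 h2] := fK (a * x + c).
  rewrite (normrM a) (normrM (a ^+ 2)) normrX /m; split.
  + apply: (le_trans h0); rewrite ler_peMr//; lra.
  + by rewrite mulrC ler_pM//; lra.
  + by rewrite mulrC ler_pM//; lra.
move=> x h; have := fh (a * x + c) (a * h).
rewrite (_ : a * (x + h) + c = a * x + c + a * h); last by ring.
rewrite (_ : a * f1 _ * h = f1 (a * x + c) * (a * h)); last by ring.
rewrite (_ : a ^+ 2 * f2 _ * _ = f2 (a * x + c) * (a * h) ^+ 2); last by ring.
move=> /le_trans; apply; rewrite -mulrA ler_wpM2l//.
rewrite /cubic_error !minr_pMr; last by rewrite /m; lra.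
rewrite le_min; apply/andP; split.
  rewrite ge_min; apply/orP; left; rewrite exprMn ler_wpM2r ?sqr_ge0//.
  by rewrite -[a ^+ 2]real_normK ?num_real// /m; lra.
rewrite ge_min; apply/orP; right; rewrite normrM exprMn ler_wpM2r ?exprn_ge0//.
by rewrite /m; lra.
Qed.

(** * Moments of the centered normal law *)

Definition normal_law (R : realType) (s : R) :
  probability (measurableTypeR R) R := normal_prob 0 s.

Section normal_moments.
Context (R : realType).
Local Notation lam := (@lebesgue_measure R).
Implicit Types s r : R.

Let mpdf s : measurable_fun setT (fun x : R => (normal_pdf 0 s x)%:E).
Proof. by apply/measurable_EFinP; exact: measurable_normal_pdf. Qed.

(** The Radon-Nikodym derivative of the normal law is its density, almost
    everywhere. *)
Lemma ge0_integral_normal_prob s (f : R -> \bar R) : measurable_fun setT f ->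
  (forall x, 0 <= f x)%E ->
  (\int[normal_prob 0 s]_x f x = \int[lam]_x (f x * (normal_pdf 0 s x)%:E))%E.
Proof.
move=> mf f0; have dom := @normal_prob_dominates R 0 s.
rewrite -(Radon_Nikodym_SigmaFinite.change_of_variables dom)//.
have iRN := Radon_Nikodym_SigmaFinite.f_integrable dom.
have RN : ae_eq lam setT
    (Radon_Nikodym_SigmaFinite.f (normal_prob 0 s) lam)
    (fun x : R => (normal_pdf 0 s x)%:E).
  apply: (integral_ae_eq measurableT iRN (mpdf s)) => A _ mA.
  by rewrite -Radon_Nikodym_SigmaFinite.f_integral.
apply: ge0_ae_eq_integral => //.
- apply: emeasurable_funM => //; exact: (measurable_int _ iRN).
- exact: (emeasurable_funM mf (mpdf s)).
- move=> x _; apply: mule_ge0 => //.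
  exact: Radon_Nikodym_SigmaFinite.f_ge0.
- by move=> x _; rewrite mule_ge0// lee_fin normal_pdf_ge0.
- by apply: (filterS _ RN) => x h _; rewrite h.
Qed.

Let integral_opp (f : R -> \bar R) : measurable_fun setT f ->
  (forall x, 0 <= f x)%E -> (\int[lam]_x f (- x)%R = \int[lam]_x f x)%E.
Proof.
move=> mf f0; have mN : measurable_fun setT (-%R : measurableTypeR R -> measurableTypeR R).
  exact: oppr_measurable.
rewrite -[LHS](ge0_integral_pushforward mN lam (D := setT))//.
by apply: eq_measure_integral => A mA _; exact: lebesgue_measureN.
Qed.

Let same_law_opp s : s != 0 ->
  same_law (normal_law s) (normal_law s) (-%R : measurableTypeR R -> R)
    (idfun : measurableTypeR R -> R).
Proof.
move=> s0 A mA.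
have mN : measurable_fun setT (-%R : R -> R) by exact: oppr_measurable.
have mNA : measurable (-%R @^-1` A : set R) by rewrite -[_ @^-1` _]setTI; exact: mN.
have mI (B : set R) : measurable B -> measurable_fun setT (fun x => (\1_B x)%:E : \bar R).
  by move=> mB; exact/measurable_EFinP/measurable_indic.
have I0 (B : set R) x : (0 <= (\1_B x)%:E :> \bar R)%E by rewrite lee_fin.
have normalE (B : set R) : measurable B -> normal_prob 0 s B =
    (\int[lam]_x ((\1_B x)%:E * (normal_pdf 0 s x)%:E))%E.
  by move=> mB; rewrite -(ge0_integral_normal_prob _ (mI _ mB) (I0 B))
    integral_indic// setIT.
apply: etrans (normalE _ mNA) _; apply: etrans _ (esym (normalE _ mA)).
rewrite -[RHS]integral_opp; last 2 first.
- exact: (emeasurable_funM (mI _ mA) (mpdf s)).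
- by move=> x; rewrite mule_ge0// lee_fin normal_pdf_ge0.
apply: eq_integral => x _; congr (_ * _)%E.
by rewrite !normal_pdfE// /normal_fun !subr0 sqrrN.
Qed.

Let peakE s : 0 < s -> normal_peak s = (Num.sqrt (pi *+ 2) * s)^-1.
Proof.
move=> s0; rewrite /normal_peak -mulrnAr sqrtrM ?sqr_ge0//.
by rewrite sqrtr_sqr gtr0_norm// mulrC.
Qed.

(** A Gaussian factor turns a normal density into a multiple of another. *)
Let pdf_gauss s r x : 0 < s -> 0 < r ->
  expR (- ((r ^+ 2 - 1) / (s ^+ 2 *+ 2) * x ^+ 2)) * normal_pdf 0 s x =
  r^-1 * normal_pdf 0 (s / r) x.
Proof.
move=> s0 r0; have sr0 : 0 < s / r by rewrite divr_gt0.
rewrite !normal_pdfE ?gt_eqF// !peakE// /normal_fun !subr0.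
have [sn rn] : s != 0 /\ r != 0 by rewrite !gt_eqF.
have q0 : Num.sqrt (pi *+ 2) != 0 :> R.
  by rewrite gt_eqF// sqrtr_gt0 mulrn_wgt0// pi_gt0.
rewrite mulrCA -expRD [RHS]mulrA; congr (_ * expR _); field.
  by rewrite q0 sn rn.
by rewrite sn rn.
Qed.

Let integral_gauss s r : 0 < s -> 0 < r ->
  (\int[normal_prob 0 s]_x
     (expR (- ((r ^+ 2 - 1) / (s ^+ 2 *+ 2) * x ^+ 2)))%:E = (r^-1)%:E)%E.
Proof.
move=> s0 r0; rewrite ge0_integral_normal_prob; last 2 first.
- apply/measurable_EFinP/measurableT_comp => //.
  apply: measurable_funN; apply: measurable_funM => //; exact: exprn_measurable.
- by move=> x; rewrite lee_fin expR_ge0.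
transitivity (\int[lam]_x ((r^-1)%:E * (normal_pdf 0 (s / r) x)%:E))%E.
  by apply: eq_integral => x _; rewrite -EFinM pdf_gauss// EFinM.
have pos x : setT x -> (0 <= (normal_pdf 0 (s / r) x)%:E)%E.
  by rewrite lee_fin normal_pdf_ge0.
have rpos : (0 <= (r^-1)%:E)%E by rewrite lee_fin invr_ge0 ltW.
rewrite (ge0_integralZl lam measurableT (mpdf (s / r)) pos rpos).
by rewrite integral_normal_pdf mule1.
Qed.

Variable s : R.
Hypothesis s0 : 0 < s.
Local Notation N := (normal_law s).

Let mgauss c : measurable_fun setT (fun x : R => expR (- (c * x ^+ 2))).
Proof.
apply: measurableT_comp => //.
apply: measurable_funN; apply: measurable_funM => //; exact: exprn_measurable.
Qed.

Let L1_gauss r : 0 < r ->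
  L1 N (fun x => expR (- ((r ^+ 2 - 1) / (s ^+ 2 *+ 2) * x ^+ 2))).
Proof.
move=> r0; apply/integrableP; split; first by apply/measurable_EFinP; exact: mgauss.
under eq_integral do rewrite /= ger0_norm ?expR_ge0//.
by rewrite integral_gauss// ltry.
Qed.

Let mean_gauss r : 0 < r ->
  mean N (fun x => expR (- ((r ^+ 2 - 1) / (s ^+ 2 *+ 2) * x ^+ 2))) = r^-1.
Proof. by move=> r0; rewrite /mean /Rintegral integral_gauss. Qed.

(* The exponential moment that controls the fourth one comes from [integral_gauss]
   with [r ^+ 2 = 1 / 2]. *)
Let r4 : R := (Num.sqrt 2)^-1.

Let r4_gt0 : 0 < r4. Proof. by rewrite invr_gt0 sqrtr_gt0. Qed.

Let bound4 x : x ^+ 4 <=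
  32 * s ^+ 4 * expR (- ((r4 ^+ 2 - 1) / (s ^+ 2 *+ 2) * x ^+ 2)).
Proof.
have -> : - ((r4 ^+ 2 - 1) / (s ^+ 2 *+ 2) * x ^+ 2) = (x / s) ^+ 2 / 4.
  rewrite /r4 exprVn sqr_sqrtr//; field; exact: lt0r_neq0.
have -> : x ^+ 4 = s ^+ 4 * (x / s) ^+ 4 by field; exact: lt0r_neq0.
set y := x / s.
have -> : 32 * s ^+ 4 * expR (y ^+ 2 / 4) = s ^+ 4 * (32 * expR (y ^+ 2 / 4)).
  by ring.
rewrite ler_wpM2l ?exprn_ge0 ?ltW//.
have := @expR_ge1Dxn R (y ^+ 2 / 4) 1 _.
rewrite divr_ge0 ?sqr_ge0// => /(_ isT).
have -> : (y ^+ 2 / 4) ^+ 2 / 2`!%:R = y ^+ 4 / 32 by rewrite /factorial; field.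
by lra.
Qed.

Lemma normal_L1_4 : L1 N (fun x => x ^+ 4).
Proof.
apply: (le_L1 _ _ (L1Z (32 * s ^+ 4) (L1_gauss r4_gt0))).
  exact: exprn_measurable.
move=> x; rewrite ger0_norm ?exprn_even_ge0//.
by apply: (le_trans (bound4 x)); rewrite ler_norm.
Qed.

Lemma normal_moment4_le : mean N (fun x => x ^+ 4) <= 32 * Num.sqrt 2 * s ^+ 4.
Proof.
apply: (le_trans (le_mean normal_L1_4 (L1Z (32 * s ^+ 4) (L1_gauss r4_gt0)) bound4)).
rewrite meanZ; last exact: L1_gauss.
by rewrite mean_gauss// /r4 invrK mulrAC.
Qed.

Lemma normal_L1_sqr : L1 N (fun x => x ^+ 2).
Proof.
apply: (le_L1 _ _ (L1D (L1_cst N 1) normal_L1_4)); first exact: exprn_measurable.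
move=> x; rewrite ger0_norm ?sqr_ge0// ger0_norm; last first.
  by rewrite addr_ge0// exprn_even_ge0.
by rewrite (exprM x 2 2); have := sqr_ge0 (x ^+ 2 - 1); nra.
Qed.

Lemma normal_L1 : L1 N (fun x => x).
Proof.
apply: (le_L1 _ _ (L1D (L1_cst N 1) normal_L1_sqr)) => // x.
rewrite [leRHS]ger0_norm; last by rewrite addr_ge0// sqr_ge0.
by rewrite -[x ^+ 2]real_normK ?num_real//; nra.
Qed.

(** By the symmetry of the law. *)
Lemma normal_mean : mean N (fun x => x) = 0.
Proof.
have mN : measurable_fun setT (-%R : measurableTypeR R -> R).
  exact: oppr_measurable.
have mI : measurable_fun setT (idfun : measurableTypeR R -> R).
  exact: measurable_id.
have mI' : measurable_fun setT (@idfun R) by exact: measurable_id.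
have := mean_same_law mN mI (same_law_opp (lt0r_neq0 s0)) mI' normal_L1.
have -> : mean N (@idfun R \o (-%R : measurableTypeR R -> R)) = - mean N (fun x => x).
  rewrite -[RHS]mulN1r -meanZ; last exact: normal_L1.
  by apply: eq_mean => x /=; rewrite mulN1r.
rewrite /=; move/eqP; rewrite -subr_eq0 => /eqP h.
have : - mean N (fun x => x) - mean N (fun x => x) = 0 by [].
by move=> ?; lra.
Qed.

Let expR_sandwich (u : R) : 0 <= u -> 0 <= expR (- u) - 1 + u <= u ^+ 2.
Proof.
move=> u0; apply/andP; split; first by have := expR_ge1Dx (- u); lra.
have : expR (- u) <= (1 + u)^-1.
  by rewrite expRN lef_pV2 ?posrE ?expR_gt0 ?expR_ge1Dx//; lra.
have : (1 + u)^-1 <= 1 - u + u ^+ 2.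
  rewrite -[leLHS]mul1r ler_pdivrMr; last by lra.
  have -> : (1 - u + u ^+ 2) * (1 + u) = 1 + u ^+ 3 by ring.
  by rewrite lerDl exprn_ge0.
lra.
Qed.

(** The Laplace transform of the square is given by [integral_gauss]; the variance
    is minus its derivative at 0, obtained from the fourth moment and
    [1 - u <= exp (- u) <= 1 - u + u ^ 2]. *)
Lemma normal_mean_sqr : mean N (fun x => x ^+ 2) = s ^+ 2.
Proof.
set V := mean N _; have L2 := normal_L1_sqr; have L4 := normal_L1_4.
pose M4 := mean N (fun x => x ^+ 4).
have M40 : 0 <= M4 by apply: mean_ge0 => x; rewrite exprn_even_ge0.
have s20 : 0 < s ^+ 2 by rewrite exprn_gt0.
have key (e c : R) : 0 < e -> c = ((1 + e) ^+ 2 - 1) / (s ^+ 2 *+ 2) ->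
    0 <= (1 + e)^-1 - 1 + c * V <= c ^+ 2 * M4.
  move=> e0 cE; have r0 : 0 < 1 + e by lra.
  have c0 : 0 <= c by rewrite cE divr_ge0 ?mulrn_wge0 ?ltW//; nra.
  have Lg := L1_gauss r0; rewrite -cE in Lg.
  have Lf : L1 N (fun x => expR (- (c * x ^+ 2)) - 1 + c * x ^+ 2).
    by apply: L1D; [apply: L1B => //; exact: L1_cst|exact: L1Z].
  have -> : (1 + e)^-1 - 1 + c * V =
      mean N (fun x => expR (- (c * x ^+ 2)) - 1 + c * x ^+ 2).
    rewrite meanD; [|by apply: L1B => //; exact: L1_cst|exact: L1Z].
    rewrite meanB//; last exact: L1_cst.
    by rewrite mean_cst meanZ// cE mean_gauss.
  have u0 x : 0 <= c * x ^+ 2 by rewrite mulr_ge0// sqr_ge0.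
  apply/andP; split.
    by apply: mean_ge0 => x; case/andP: (expR_sandwich (u0 x)).
  rewrite -meanZ//; apply: le_mean => //; first exact: L1Z.
  move=> x; case/andP: (expR_sandwich (u0 x)) => _ /le_trans; apply.
  by rewrite exprMn -exprM.
have keyV (e : R) : 0 < e <= 1 -> s ^+ 2 * (1 - 2 * e) <= V <= s ^+ 2 + 2 * e / s ^+ 2 * M4.
  move=> /andP[e0 e1]; have := key e _ e0 erefl.
  set c := _ / _.
  have c0 : 0 < c by rewrite divr_gt0 ?mulrn_wgt0//; nra.
  have cE : c = e * (2 + e) / (2 * s ^+ 2).
    by rewrite /c; field; rewrite lt0r_neq0.
  have -> : (1 + e)^-1 - 1 = - (c * (2 * s ^+ 2 / ((1 + e) * (2 + e)))).
    by rewrite cE; field; rewrite !lt0r_neq0//; lra.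
  rewrite addrC -mulrBr => /andP[h1 h2].
  have h3 : 2 * s ^+ 2 / ((1 + e) * (2 + e)) <= V.
    by rewrite -subr_ge0 -(pmulr_rge0 _ c0).
  have h4 : V <= 2 * s ^+ 2 / ((1 + e) * (2 + e)) + c * M4.
    by rewrite -lerBlDl -(ler_pM2l c0) (mulrA c c).
  apply/andP; split.
    apply: le_trans h3; rewrite ler_pdivlMr; last by nra.
    have : (1 - 2 * e) * ((1 + e) * (2 + e)) <= 2 by nra.
    by move: (s ^+ 2) s20 => q q0; nra.
  apply: (le_trans h4); apply: lerD.
    rewrite ler_pdivrMr; last by nra.
    have : 2 <= ((1 + e) * (2 + e)) by nra.
    by move: (s ^+ 2) s20 => q q0; nra.
  rewrite ler_wpM2r// cE ler_pdivrMr ?mulr_gt0//.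
  have -> : 2 * e / s ^+ 2 * (2 * s ^+ 2) = 4 * e by field; rewrite lt0r_neq0.
  nra.
apply/eqP; rewrite eq_le; apply/andP; split.
  apply/ler_addgt0Pr => d d0.
  pose k := 2 / s ^+ 2 * M4 + 1.
  have k0 : 0 < k by rewrite ltr_wpDl// mulr_ge0// divr_ge0// ltW.
  pose e := Num.min 1 (d / k).
  have e0 : 0 < e by rewrite lt_min ltr01 divr_gt0.
  have /andP[_ /le_trans->//] : s ^+ 2 * (1 - 2 * e) <= V <= s ^+ 2 + 2 * e / s ^+ 2 * M4.
    by apply: keyV; rewrite e0 ge_min lexx.
  rewrite lerD2l.
  have : e * k <= d by rewrite -ler_pdivlMr// ge_min lexx orbT.
  have -> : 2 * e / s ^+ 2 * M4 = e * (2 / s ^+ 2 * M4) by ring.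
  by rewrite /k mulrDr mulr1; lra.
apply/ler_addgt0Pr => d d0.
pose e := Num.min 1 (d / (2 * s ^+ 2)).
have e0 : 0 < e by rewrite lt_min ltr01 divr_gt0// mulr_gt0.
have /andP[h _] : s ^+ 2 * (1 - 2 * e) <= V <= s ^+ 2 + 2 * e / s ^+ 2 * M4.
  by apply: keyV; rewrite e0 ge_min lexx.
have : e * (2 * s ^+ 2) <= d.
  by rewrite -ler_pdivlMr ?mulr_gt0// ge_min lexx orbT.
by move: (s ^+ 2) h => q h; lra.
Qed.

End normal_moments.

(** * The central limit theorem for increments *)

Section min_cube.
Context (R : realType) (d : measure_display) (T : measurableType d).
Variables (P : probability T R) (Z : T -> R).
Hypotheses (mZ : measurable_fun setT Z) (LZ2 : L1 P (fun w => Z w ^+ 2)).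

Let min_cube (a : R) w := Num.min (Z w ^+ 2) (a * `|Z w| ^+ 3).

Let measurable_min_cube a : measurable_fun setT (min_cube a).
Proof.
apply: measurable_minr; first exact: measurable_funX.
apply: measurable_funM => //; apply: measurable_funX.
exact: measurableT_comp.
Qed.

Let min_cube_ge0 a w : 0 <= a -> 0 <= min_cube a w.
Proof. by move=> a0; rewrite le_min sqr_ge0 mulr_ge0// exprn_ge0. Qed.

Let min_cube_le a w : min_cube a w <= Z w ^+ 2.
Proof. by rewrite /min_cube /Num.min; case: ltP. Qed.

Lemma L1_min_cube a : 0 <= a ->
  L1 P (fun w => Num.min (Z w ^+ 2) (a * `|Z w| ^+ 3)).
Proof.
move=> a0; apply: (le_L1 (measurable_min_cube a) _ LZ2) => w.
by rewrite (ger0_norm (min_cube_ge0 _ a0)) (ger0_norm (sqr_ge0 _)) min_cube_le.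
Qed.

(** The third moment need not exist, but a vanishing factor in front of the cube
    makes dominated convergence applicable. *)
Lemma mean_min_cube_small (e : R) : 0 < e ->
  exists2 delta : R, 0 < delta & forall a : R, 0 <= a <= delta ->
    mean P (fun w => Num.min (Z w ^+ 2) (a * `|Z w| ^+ 3)) <= e.
Proof.
move=> e0; pose f (n : nat) := min_cube n.+1%:R^-1.
have /cvgr_lt /(_ _ e0) [n _ /(_ n (leqnn n)) /= fn] :
    mean P (f n) @[n --> \oo] --> 0.
  apply: (mean_dominated_cvg0 _ LZ2) => // [n|n w|w].
  - exact: measurable_min_cube.
  - by rewrite (ger0_norm (min_cube_ge0 _ _)) ?min_cube_le ?invr_ge0.
  - apply: (@squeeze_cvgr _ _ _ _ (cst 0) (fun n => `|Z w| ^+ 3 * harmonic n)).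
    + apply: nearW => n; rewrite min_cube_ge0 ?invr_ge0//= mulrC.
      by rewrite /f /min_cube /Num.min; case: ltP => // /ltW.
    + exact: cvg_cst.
    + rewrite -[X in _ --> X](mulr0 (`|Z w| ^+ 3)).
      by apply: cvgMr; exact: cvg_harmonic.
exists n.+1%:R^-1; first by rewrite invr_gt0.
move=> a /andP[a0 an]; apply: le_trans (ltW fn).
apply: le_mean; [exact: L1_min_cube|by apply: L1_min_cube; rewrite invr_ge0|].
move=> w; rewrite /f /min_cube le_min !ge_min lexx/=; apply/orP; right.
by rewrite ler_wpM2r// exprn_ge0.
Qed.

End min_cube.

(** The cube is bounded by a combination of the square and the fourth power, whose
    balance is set by [e]. *)
Lemma normal_cubic_error (R : realType) (s e : R) : 0 < s -> 0 < e ->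
  mean (normal_law s) (fun x => cubic_error x) <=
  (e * s ^+ 2 + 32 * Num.sqrt 2 * s ^+ 4 / e) / 2.
Proof.
move=> s0 e0; have L2 := normal_L1_sqr s0; have L4 := normal_L1_4 s0.
have LY : L1 (normal_law s) (fun x => x) by exact: normal_L1.
have Lf : L1 (normal_law s) (fun x => 2^-1 * (e * x ^+ 2 + e^-1 * x ^+ 4)).
  by apply: L1Z; apply: L1D; exact: L1Z.
apply: (@le_trans _ _ (mean (normal_law s)
    (fun x => 2^-1 * (e * x ^+ 2 + e^-1 * x ^+ 4)))).
  apply: le_mean => //; first exact: (L1_cubic_error LY L2).
  move=> x; apply: (le_trans (cubic_error_le_cube _)).
  have -> : x ^+ 4 = `|x| ^+ 4 by rewrite -normrX ger0_norm// exprn_even_ge0.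
  rewrite -[x ^+ 2]real_normK ?num_real//.
  move: `|x| (normr_ge0 x) => y y0.
  have -> : 2^-1 * (e * y ^+ 2 + e^-1 * y ^+ 4) =
    y ^+ 3 + 2^-1 * e^-1 * (y * (e - y)) ^+ 2 by field; rewrite lt0r_neq0.
  by rewrite lerDl mulr_ge0 ?sqr_ge0// mulr_ge0// invr_ge0 ltW.
rewrite meanZ; last by apply: L1D; exact: L1Z.
rewrite meanD ?meanZ//; [|exact: L1Z|exact: L1Z].
rewrite (normal_mean_sqr s0) mulrC ler_wpM2r ?invr_ge0// lerD2l mulrC.
by rewrite ler_wpM2r ?invr_ge0 ?(ltW e0)//; exact: normal_moment4_le.
Qed.

Section brownian_walk.
Context (R : realType) (d : measure_display) (Om : measurableType d).
Variables (P : probability Om R) (B : R -> {RV P >-> R}).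
Hypothesis BM : standard_brownian_motion B.

(** An increment of Brownian motion is a sum of as many independent normal
    variables as one wishes. *)
Lemma brownian_step_op (s h K : R) n (f : R -> R) : 0 <= s -> 0 < h ->
  measurable_fun setT f -> (forall x, `|f x| <= K) ->
  mean P (fun w => f (B (s + n%:R * h) w - B s w)) =
  iter n (step_op (normal_law (Num.sqrt h))
    (fun x : measurableTypeR R => x : R)) f 0.
Proof.
move=> s0 h0 mf fK; have [_ indB lawB _] := BM.
pose u i := s + i%:R * h.
have u0 : 0 <= u 0%N by rewrite /u mul0r addr0.
have uS i : u i.+1 - u i = h by rewrite /u -natr1; ring.
have ltu i : u i < u i.+1 by rewrite -subr_gt0 uS.
have ndu : nondecreasing_seq u by apply/nondecreasing_seqP => i; exact: ltW.
have ui i : 0 <= u i by apply: le_trans u0 (ndu _ _ (leq0n i)).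
rewrite -(@mean_iid_walk _ _ _ _ P _ (normal_law (Num.sqrt h)) _
  (fun i w => B (u i.+1) w - B (u i) w) 0 n f K) //.
- apply: eq_mean => w; congr (f _).
  by rewrite add0n telescope_sumr// /u mul0r addr0.
- by move=> i; apply: measurable_funB; exact: measurable_funPT.
- exact: indB.
- by move=> i A mA; rewrite (lawB _ _ (ui i) (ltu i) _ mA) uS.
Qed.

End brownian_walk.

Section clt.
Context (R : realType) (d0 d d' : measure_display).
Context (Om0 : measurableType d0) (Om : measurableType d).
Context (Om' : measurableType d').
Variables (P0 : probability Om0 R) (P : probability Om R).
Variables (P' : probability Om' R).
Variables (xi : Om0 -> R) (xs : nat -> Om -> R) (mu sigma2 : R).
Variable B : R -> {RV P' >-> R}.
Hypotheses (mu_gt0 : 0 < mu) (sigma2_gt0 : 0 < sigma2).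
Hypotheses (Lxi : L1 P0 xi) (Exi : mean P0 xi = mu).
Hypotheses (Lxi2 : L1 P0 (fun w => (xi w - mu) ^+ 2)).
Hypothesis (Vxi : mean P0 (fun w => (xi w - mu) ^+ 2) = sigma2).
Hypothesis (mxs : forall i, measurable_fun setT (xs i)).
Hypothesis (indxs : mutually_independent P xs).
Hypothesis (lawxs : forall i, same_law P P0 (xs i) xi).
Hypothesis BM : standard_brownian_motion B.

(** The number of steps made by the walk before it reaches the level [s * t],
    at its mean speed. *)
Definition nsteps (t s : R) : nat := Num.truncn (s * t / mu).

Definition scale (t : R) : R := (Num.sqrt (sigma2 * t / mu))^-1.

(* The sign is that of a passage time: large steps make it small. *)
Definition scaled_step (t y : R) : R := - scale t * (y - mu).

Lemma scale_gt0 t : 0 < t -> 0 < scale t.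
Proof. by move=> t0; rewrite invr_gt0 sqrtr_gt0 divr_gt0 ?mulr_gt0. Qed.

Lemma scale_sqr t : 0 < t -> scale t ^+ 2 = mu / (sigma2 * t).
Proof.
move=> t0; rewrite exprVn sqr_sqrtr ?invf_div//.
by rewrite divr_ge0 ?mulr_ge0 ?ltW.
Qed.

Lemma nsteps_itv t s : 0 < t -> 0 <= s ->
  (nsteps t s)%:R <= s * t / mu < (nsteps t s)%:R + 1.
Proof.
move=> t0 s0; rewrite natr1; apply: truncn_itv.
by rewrite divr_ge0 ?mulr_ge0// ltW.
Qed.

Lemma le_nsteps t s1 s2 : 0 < t -> s1 <= s2 ->
  (nsteps t s1 <= nsteps t s2)%N.
Proof.
move=> t0 s12; apply: le_truncn.
by rewrite ler_wpM2r ?invr_ge0 ?(ltW mu_gt0)// ler_wpM2r// ltW.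
Qed.

Lemma measurable_scaled_step t : measurable_fun setT (scaled_step t).
Proof.
by apply: measurable_funM => //; exact: measurable_funB.
Qed.

Let mxi : measurable_fun setT xi := L1_measurable Lxi.

Let L1_scaled t : L1 P0 (fun w => scaled_step t (xi w)).
Proof. by apply: L1Z; apply: L1B => //; exact: L1_cst. Qed.

Let mean_scaled t : mean P0 (fun w => scaled_step t (xi w)) = 0.
Proof.
rewrite meanZ; last by apply: L1B => //; exact: L1_cst.
by rewrite meanB ?mean_cst ?Exi ?subrr ?mulr0//; exact: L1_cst.
Qed.

Let scaled_sqr t w :
  scaled_step t (xi w) ^+ 2 = scale t ^+ 2 * (xi w - mu) ^+ 2.
Proof. by rewrite exprMn sqrrN. Qed.

Let L1_scaled_sqr t : L1 P0 (fun w => scaled_step t (xi w) ^+ 2).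
Proof. by under eq_fun do rewrite scaled_sqr; exact: L1Z. Qed.

Let mean_scaled_sqr t : 0 < t ->
  mean P0 (fun w => scaled_step t (xi w) ^+ 2) = mu / t.
Proof.
move=> t0; under eq_mean do rewrite scaled_sqr.
rewrite meanZ// Vxi scale_sqr//; field.
by rewrite !lt0r_neq0.
Qed.

Let cubic_scaled t w : 0 < t -> cubic_error (scaled_step t (xi w)) =
  scale t ^+ 2 * Num.min ((xi w - mu) ^+ 2) (scale t * `|xi w - mu| ^+ 3).
Proof.
move=> t0; rewrite minr_pMr ?sqr_ge0// /cubic_error scaled_sqr; congr Num.min.
rewrite /scaled_step normrM normrN (gtr0_norm (scale_gt0 t0)).
by ring.
Qed.

(** Lindeberg's method against the Brownian increment, cut into the same number
    of steps as the walk makes. *)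
Lemma clt_block (s1 s2 K : R) f : 0 <= s1 -> s1 <= s2 -> taylor2 K f ->
  mean P (fun w => f (\sum_(nsteps t s1 <= i < nsteps t s2)
                       scaled_step t (xs i w))) @[t --> +oo] -->
  mean P' (fun w => f (B s2 w - B s1 w)).
Proof.
move=> s10 s12 tf; have [mf fK] := taylor2_bounded tf.
move: s12; rewrite le_eqVlt => /predU1P[<-|s12].
  rewrite (_ : mean P' _ = f 0); last first.
    by under eq_mean do rewrite subrr; rewrite mean_cst.
  under eq_fun do under eq_mean do rewrite big_geq//.
  by under eq_fun do rewrite mean_cst; exact: cvg_cst.
have s20 : 0 <= s2 by rewrite (le_trans s10)// ltW.
have K0 : 0 <= K by apply: le_trans (fK 0).
pose c := s2 - s1; have c0 : 0 < c by rewrite subr_gt0.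
apply/cvgrPdist_le => e e0.
pose K1 := K + 1; have K10 : 0 < K1 by rewrite ltr_wpDl.
pose e1 := e / (3 * K1); have e10 : 0 < e1 by rewrite divr_gt0// mulr_gt0.
pose e2 := e1 / c; have e20 : 0 < e2 by rewrite divr_gt0.
pose e3 := e1 * sigma2 / (c + 1).
have e30 : 0 < e3 by apply: divr_gt0; [exact: mulr_gt0|exact: addr_gt0].
have mZ : measurable_fun setT (fun w => xi w - mu) by exact: measurable_funB.
have [delta delta0 small] := mean_min_cube_small mZ Lxi2 e30.
pose C : R := 32 * Num.sqrt 2; have C0 : 0 < C by rewrite mulr_gt0// sqrtr_gt0.
near=> t.
have t0 : 0 < t by near: t; exact: nbhs_pinfty_gt.
have t1 : mu <= t by near: t; apply: nbhs_pinfty_ge; exact: num_real.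
have t2 : 2 * mu / c <= t by near: t; apply: nbhs_pinfty_ge; exact: num_real.
have t3 : mu / e1 <= t by near: t; apply: nbhs_pinfty_ge; exact: num_real.
have t4 : mu / (sigma2 * delta ^+ 2) <= t.
  by near: t; apply: nbhs_pinfty_ge; exact: num_real.
have t5 : 2 * C * mu * c / (e2 * e1) <= t.
  by near: t; apply: nbhs_pinfty_ge; exact: num_real.
(* The Brownian increment over a time [c] is cut into [n] steps of variance [h],
   which is the variance [mu / t] of a walk step up to the rounding of [n]. *)
pose n := (nsteps t s2 - nsteps t s1)%N.
have nE : nsteps t s2 = (nsteps t s1 + n)%N by rewrite subnKC// le_nsteps// ltW.
have nR : n%:R = (nsteps t s2)%:R - (nsteps t s1)%:R :> R.
  by rewrite natrB// le_nsteps// ltW.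
have /andP[l1 u1] := nsteps_itv t0 s10; have /andP[l2 u2] := nsteps_itv t0 s20.
have cE : c * t / mu = s2 * t / mu - s1 * t / mu by rewrite /c; ring.
have nub : n%:R <= c * t / mu + 1 by rewrite cE nR; lra.
have nlb : c * t / mu - 1 <= n%:R by rewrite cE nR; lra.
have ct2 : 2 <= c * t / mu.
  by rewrite ler_pdivlMr// [leRHS]mulrC -ler_pdivrMr.
have n0 : 0 < n%:R :> R by lra.
pose h := c / n%:R; have h0 : 0 < h by rewrite divr_gt0.
have nh : n%:R * h = c by rewrite mulrC divfK// lt0r_neq0.
have hub : h <= 2 * mu / t.
  rewrite ler_pdivrMr//.
  have {1}-> : c = c * t / mu * (mu / t) by field; rewrite !lt0r_neq0.
  have -> : 2 * mu / t * n%:R = 2 * n%:R * (mu / t) by ring.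
  by rewrite ler_wpM2r ?divr_ge0 ?ltW//; lra.
have sh0 : 0 < Num.sqrt h by rewrite sqrtr_gt0.
have shE : Num.sqrt h ^+ 2 = h by rewrite sqr_sqrtr// ltW.
have -> : mean P' (fun w => f (B s2 w - B s1 w)) =
    iter n (step_op (normal_law (Num.sqrt h))
                    (fun x : measurableTypeR R => x : R)) f 0.
  rewrite -(brownian_step_op BM n s10 h0 mf fK) nh.
  by rewrite /c addrC subrK.
rewrite nE (mean_iid_walk (P := P) (P0 := P0) (Y := fun w => scaled_step t (xi w))
  (X := fun i w => scaled_step t (xs i w)) _ _ _ _ _ _ mf fK); last 4 first.
- by move=> i; exact: measurableT_comp (measurable_scaled_step t) (mxs i).
- exact: mutually_independent_comp (measurable_scaled_step t) indxs.
- exact: measurableT_comp (measurable_scaled_step t) mxi.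
- move=> i A mA; apply: (lawxs i (A := scaled_step t @^-1` A)).
  by rewrite -[_ @^-1` _]setTI; exact: measurable_scaled_step.
rewrite distrC.
apply: (le_trans (lindeberg n 0 (L1_scaled t) (L1_scaled_sqr t) (mean_scaled t)
  (normal_L1 sh0) (normal_L1_sqr sh0) (normal_mean sh0) tf)).
rewrite mean_scaled_sqr// (normal_mean_sqr sh0) shE.
set qY := mean P0 _; set qN := mean _ _.
(* The three contributions to the error of [lindeberg], in turn. *)
have bY : n%:R * qY <= e1.
  have -> : qY = scale t ^+ 2 * mean P0 (fun w => Num.min ((xi w - mu) ^+ 2) (scale t * `|xi w - mu| ^+ 3)).
    rewrite -meanZ; first by apply: eq_mean => w; rewrite cubic_scaled.
    by apply: L1_min_cube => //; rewrite ltW// scale_gt0.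
  have : scale t <= delta.
    have sg := ltW (scale_gt0 t0); have dg := ltW delta0.
    rewrite -ler_sqr ?nnegrE// scale_sqr// ler_pdivrMr ?mulr_gt0//.
    move: t4; rewrite ler_pdivrMr ?mulr_gt0 ?exprn_gt0// => /le_trans; apply.
    by rewrite le_eqVlt; apply/orP; left; apply/eqP; ring.
  move=> sd; have := small (scale t).
  rewrite sd ltW ?scale_gt0// => /(_ isT); set q := mean _ _ => qe.
  rewrite mulrA scale_sqr//.
  have q0 : 0 <= mu / (sigma2 * t) by rewrite ltW// divr_gt0// mulr_gt0.
  have : n%:R * (mu / (sigma2 * t)) <= (c + 1) / sigma2.
    have -> : (c + 1) / sigma2 = (c * t / mu + t / mu) * (mu / (sigma2 * t)).
      by field; rewrite !lt0r_neq0.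
    apply: ler_wpM2r; first exact: q0.
    by apply: (le_trans nub); rewrite lerD2l ler_pdivlMr// mul1r.
  move=> /(ler_wpM2r (_ : 0 <= e3)) => /(_ (ltW e30)).
  have -> : (c + 1) / sigma2 * e3 = e1.
    by rewrite /e3; field; rewrite !lt0r_neq0// addr_gt0.
  by apply: le_trans; rewrite ler_wpM2l// mulr_ge0.
have bN : n%:R * qN <= e1.
  have := normal_cubic_error sh0 e20; rewrite -/qN shE.
  rewrite (exprM _ 2 2) shE -/C => qb.
  have : n%:R * qN <= (e2 * c + C * c * h / e2) / 2.
    have -> : (e2 * c + C * c * h / e2) / 2 =
      n%:R * ((e2 * h + C * h ^+ 2 / e2) / 2).
      by rewrite -nh; field; rewrite !lt0r_neq0.
    by rewrite ler_wpM2l// ltW.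
  move=> /le_trans; apply.
  have -> : e2 * c = e1 by rewrite divfK// lt0r_neq0.
  suff : C * c * h / e2 <= e1 by lra.
  rewrite ler_pdivrMr//; apply: (@le_trans _ _ (C * c * (2 * mu / t))).
    by rewrite ler_wpM2l// mulr_ge0 ?ltW.
  rewrite mulrA ler_pdivrMr//; move: t5; rewrite ler_pdivrMr; last exact: mulr_gt0.
  by move=> h5; lra.
have bV : n%:R * `|mu / t - h| <= e1.
  rewrite -[X in X * _]ger0_norm// -normrM mulrBr nh.
  apply: (@le_trans _ _ (mu / t)); last first.
    by rewrite ler_pdivrMr// [leRHS]mulrC -ler_pdivrMr.
  have -> : n%:R * (mu / t) - c = (n%:R - c * t / mu) * (mu / t).
    by field; rewrite !lt0r_neq0.
  have mt0 : 0 <= mu / t by rewrite ltW// divr_gt0.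
  rewrite normrM [X in _ * X]ger0_norm//.
  by apply: ler_piMl => //; rewrite ler_norml; lra.
have -> : n%:R * (K * (`|mu / t - h| + qY + qN)) =
  K * (n%:R * `|mu / t - h| + n%:R * qY + n%:R * qN) by ring.
apply: (@le_trans _ _ (K * (3 * e1))).
  by rewrite ler_wpM2l//; lra.
have -> : e = K1 * (3 * e1) by rewrite /e1; field; rewrite lt0r_neq0.
by apply: ler_wpM2r; [rewrite mulr_ge0// ltW|rewrite /K1; lra].
Unshelve. all: by end_near. Qed.

(** Disjoint blocks are independent on both sides, so products of test
    functions of the increments need the one-dimensional statement only. *)
Lemma clt_prod (s : nat -> R) (f : nat -> R -> R) (K : R) r :
  0 <= s 0%N -> nondecreasing_seq s -> (forall j, taylor2 K (f j)) ->
  mean P (fun w => \prod_(j < r)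
    f j (\sum_(nsteps t (s j) <= i < nsteps t (s j.+1)) scaled_step t (xs i w)))
    @[t --> +oo] -->
  mean P' (fun w => \prod_(j < r) f j (B (s j.+1) w - B (s j) w)).
Proof.
move=> s00 nds tf.
have mf j : measurable_fun setT (f j) by case: (taylor2_bounded (tf j)).
have fK j x : `|f j x| <= K by case: (taylor2_bounded (tf j)).
have s0 j : 0 <= s j by apply: le_trans s00 (nds _ _ (leq0n j)).
have [_ indB _ _] := BM.
have mdB i : measurable_fun setT (fun w => B (s i.+1) w - B (s i) w).
  by apply: measurable_funB; exact: measurable_funPT.
have -> : mean P' (fun w => \prod_(j < r) f j (B (s j.+1) w - B (s j) w)) =
    \prod_(j < r) mean P' (fun w => f j (B (s j.+1) w - B (s j) w)).
  have := mean_prod_blocks mdB (indB _ s00 nds) (b := id) r _ mf fK.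
  under eq_mean do under eq_bigr do rewrite big_nat1.
  move=> ->; last by [].
  by apply: eq_bigr => j _; apply: eq_mean => w; rewrite big_nat1.
pose F t j := mean P (fun w => f j (\sum_(nsteps t (s j) <= i < nsteps t (s j.+1))
                       scaled_step t (xs i w))).
apply: (@cvg_trans _ ((\prod_(j < r) F t j) @[t --> +oo])).
  apply: near_eq_cvg; near=> t.
  have t0 : 0 < t by near: t; exact: nbhs_pinfty_gt.
  apply/esym; apply: (@mean_prod_blocks _ _ _ P (fun i w => scaled_step t (xs i w))
    _ _ (fun j => nsteps t (s j)) _ K) => //.
  - by move=> i; exact: (measurableT_comp (measurable_scaled_step t) (mxs i)).
  - exact: (mutually_independent_comp (measurable_scaled_step t) indxs).
  - by move=> i j ij; apply: le_nsteps => //; exact: nds.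
elim: r => [|r IHr].
  rewrite (_ : (fun t => _) = cst 1); last by apply/funext => t; rewrite big_ord0.
  by rewrite big_ord0; exact: cvg_cst.
rewrite big_ord_recr/=.
rewrite (_ : (fun t => _) = (fun t => (\prod_(j < r) F t j) * F t r)); last first.
  by apply/funext => t; rewrite big_ord_recr.
apply: cvgM => //.
by apply: clt_block => //; exact: nds.
Unshelve. all: by end_near. Qed.

End clt.

(** * Unlikely events *)

(** A bound on the outer probability: it spares measurability proofs for events
    that speak of passage times. *)
Definition prob_le (R : realType) (d : measure_display) (Om : measurableType d)
    (P : probability Om R) (Q : set Om) (delta : R) : Prop :=
  exists A, [/\ measurable A, (P A <= delta%:E)%E & Q `<=` A].

Section prob_le.
Context (R : realType) (d : measure_display) (Om : measurableType d).
Variable P : probability Om R.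
Implicit Types (Q : set Om) (delta : R).

Lemma prob_leS Q1 Q2 delta1 delta2 : Q1 `<=` Q2 -> delta2 <= delta1 ->
  prob_le P Q2 delta2 -> prob_le P Q1 delta1.
Proof.
move=> Q12 d12 [A [mA PA QA]]; exists A; split => //.
  by apply: (le_trans PA); rewrite lee_fin.
exact: subset_trans Q12 QA.
Qed.

Lemma prob_leU Q1 Q2 delta1 delta2 : prob_le P Q1 delta1 ->
  prob_le P Q2 delta2 -> prob_le P (Q1 `|` Q2) (delta1 + delta2).
Proof.
move=> [A1 [mA1 PA1 QA1]] [A2 [mA2 PA2 QA2]]; exists (A1 `|` A2); split.
- exact: measurableU.
- by apply: (le_trans (measureU2 P mA1 mA2)); rewrite EFinD leeD.
- exact: setUSS.
Qed.

Lemma prob_le0 delta : 0 <= delta -> prob_le P set0 delta.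
Proof. by move=> d0; exists set0; split => //; rewrite measure0 lee_fin. Qed.

Lemma prob_le_bigcup (Q : nat -> set Om) (dl : nat -> R) delta :
  (forall n, 0 <= dl n) ->
  (forall n, prob_le P (Q n) (dl n)) ->
  (forall m, \sum_(n < m) dl n <= delta) ->
  prob_le P (\bigcup_n Q n) delta.
Proof.
move=> dl0 /choice[A AE] sdl; exists (\bigcup_n A n); split.
- by apply: bigcupT_measurable => n; case: (AE n).
- apply: le_trans (generalized_Boole_inequality _ _ _) _.
  + by move=> n; case: (AE n).
  + by apply: bigcupT_measurable => n; case: (AE n).
  apply: lime_le; first exact: is_cvg_nneseries.
  apply: nearW => m; apply: le_trans (_ : ((\sum_(n < m) dl n)%:E <= _)%E).
    rewrite big_mkord -sumEFin; apply: lee_sum => n _.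
    by case: (AE n).
  by rewrite lee_fin.
- by move=> w [n _ Qw]; exists n => //; case: (AE n) => _ _; exact.
Qed.

Lemma prob_le_markov Q (f : Om -> R) (e delta : R) : 0 < e -> L1 P f ->
  (forall w, 0 <= f w) -> (forall w, Q w -> e <= f w) ->
  mean P f / e <= delta -> prob_le P Q delta.
Proof.
move=> e0 Lf f0 Qf fd; exists (f @^-1` `[e, +oo[); split.
- by rewrite -[_ @^-1` _]setTI; apply: (L1_measurable Lf) => //; exact: measurable_itv.
- apply: le_trans (mean_markov e0 Lf _ f0 _) _; last by rewrite lee_fin.
  + by rewrite -[_ @^-1` _]setTI; apply: (L1_measurable Lf) => //; exact: measurable_itv.
  + by move=> w /=; rewrite in_itv/= andbT.
- by move=> w /Qf /=; rewrite in_itv/= andbT.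
Qed.

Lemma measurable_norm_ge (K : R) : measurable [set y : R | K <= `|y|].
Proof.
rewrite (_ : mkset _ = (fun y : R => `|y|) @^-1` `[K, +oo[); last first.
  by apply/seteqP; split => y /=; rewrite in_itv/= andbT.
by rewrite -[X in measurable X]setTI; apply: normr_measurable.
Qed.

Lemma tail_small (Z : Om -> R) delta : measurable_fun setT Z -> 0 < delta ->
  exists K : R, (P (Z @^-1` [set y | (K <= `|y|)%R]) <= delta%:E)%E.
Proof.
move=> mZ delta0; pose I (k : nat) : set R := [set y | k%:R <= `|y|].
have mZI k : measurable (Z @^-1` I k).
  by rewrite -[X in measurable X]setTI; apply: mZ => //; exact: measurable_norm_ge.
have cv0 : mean P (\1_(Z @^-1` I k)) @[k --> \oo] --> 0.
  apply: (@mean_dominated_cvg0 _ _ _ P _ (cst 1)); [|exact: L1_cst| |].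
  - by move=> k; exact: measurable_indic.
  - by move=> k w; rewrite indicE; case: (_ \in _); rewrite ?normr1 ?normr0.
  - move=> w; apply: cvg_near_cst; exists (Num.truncn `|Z w|).+1 => // k /= kw.
    rewrite indicE memNset// /I /= => h.
    have := truncnS_gt `|Z w|; rewrite ltNge => /negP; apply.
    by apply: le_trans h; rewrite ler_nat.
have [k _ /(_ k (leqnn k)) /= Pk] := cvgr_lt 0 cv0 _ delta0.
exists k%:R; rewrite -(fineK (fin_num_measure P _ (mZI k))) lee_fin.
by rewrite -mean_indic// ltW.
Qed.

End prob_le.

Definition unlikely (R : realType) (d : measure_display) (Om : measurableType d)
    (P : probability Om R) (Q : R -> set Om) : Prop :=
  forall delta : R, 0 < delta -> \forall t \near +oo, prob_le P (Q t) delta.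

Section unlikely.
Context (R : realType) (d : measure_display) (Om : measurableType d).
Variable P : probability Om R.
Implicit Types Q : R -> set Om.

Lemma unlikelyS Q1 Q2 : (\forall t \near +oo, Q1 t `<=` Q2 t) ->
  unlikely P Q2 -> unlikely P Q1.
Proof.
move=> Q12 uQ2 e e0; near=> t; apply: (@prob_leS _ _ _ _ _ (Q2 t) _ e) => //.
  by near: t.
by near: t; exact: uQ2.
Unshelve. all: by end_near. Qed.

Lemma unlikelyU Q1 Q2 : unlikely P Q1 -> unlikely P Q2 ->
  unlikely P (fun t => Q1 t `|` Q2 t).
Proof.
move=> u1 u2 e e0; have e20 : 0 < e / 2 by rewrite divr_gt0.
near=> t; rewrite (splitr e); apply: prob_leU; near: t.
  exact: u1.
exact: u2.
Unshelve. all: by end_near. Qed.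

Lemma unlikely0 : unlikely P (fun=> set0).
Proof. by move=> e e0; near=> t; apply: prob_le0; exact: ltW.
Unshelve. all: by end_near. Qed.

Lemma unlikely_bigcup n (Q : nat -> R -> set Om) : (forall i, unlikely P (Q i)) ->
  unlikely P (fun t => \bigcup_(i < n) Q i t).
Proof.
move=> uQ; elim: n => [|n IHn].
  by apply: (unlikelyS _ unlikely0); apply: nearW => t w [i /=]; rewrite ltn0.
apply: (unlikelyS _ (unlikelyU IHn (uQ n))); apply: nearW => t w [i /=].
rewrite ltnS leq_eqVlt => /predU1P[->|iln] Qw; first by right.
by left; exists i.
Qed.

End unlikely.

(** * Second moments of block sums *)

Definition pairwise_iid (R : realType) (d0 d : measure_display)
    (Om0 : measurableType d0) (Om : measurableType d)
    (P0 : probability Om0 R) (P : probability Om R)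
    (x : Om0 -> R) (xs : nat -> Om -> R) : Prop :=
  [/\ forall i, measurable_fun setT (xs i),
      forall i j, i != j -> indep P (xs i) (xs j) &
      forall i, same_law P P0 (xs i) x].

Lemma indep_comp (R : realType) (d e1 e2 e1' e2' : measure_display)
    (Om : measurableType d) (E1 : measurableType e1) (E2 : measurableType e2)
    (E1' : measurableType e1') (E2' : measurableType e2')
    (P : probability Om R) (X : Om -> E1) (Y : Om -> E2)
    (f : E1 -> E1') (g : E2 -> E2') :
  measurable_fun setT f -> measurable_fun setT g ->
  indep P X Y -> indep P (f \o X) (g \o Y).
Proof.
move=> mf mg iXY A B mA mB.
apply: (iXY (f @^-1` A) (g @^-1` B)); rewrite -[_ @^-1` _]setTI.
  exact: mf.
exact: mg.
Qed.

Section blocks.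
Context (R : realType) (d0 d : measure_display).
Context (Om0 : measurableType d0) (Om : measurableType d).
Variables (P0 : probability Om0 R) (P : probability Om R) (x : Om0 -> R).
Hypothesis mx : measurable_fun setT x.
Variables (h : R -> R).
Hypothesis mh : measurable_fun setT h.
Hypothesis Lh2 : L1 P0 (fun w => h (x w) ^+ 2).
Hypothesis Eh : mean P0 (h \o x) = 0.

Lemma L1_of_sqr (d' : measure_display) (T : measurableType d')
    (P' : probability T R) (f : T -> R) : measurable_fun setT f ->
  L1 P' (fun w => f w ^+ 2) -> L1 P' f.
Proof.
move=> mf Lf2; apply: (le_L1 mf _ (L1D (L1_cst P' 1) Lf2)) => w.
rewrite [leRHS]ger0_norm; last by rewrite addr_ge0// sqr_ge0.
by rewrite -[f w ^+ 2]real_normK ?num_real//; have := sqr_ge0 (`|f w| - 1); nra.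
Qed.

Lemma L1_sqrB (d' : measure_display) (T : measurableType d')
    (P' : probability T R) (f : T -> R) (c : R) : L1 P' f ->
  L1 P' (fun w => f w ^+ 2) -> L1 P' (fun w => (f w - c) ^+ 2).
Proof.
move=> Lf Lf2; have -> : (fun w => (f w - c) ^+ 2) =
    (fun w => f w ^+ 2 - (2 * c) * f w + c ^+ 2).
  by apply/funext => w; ring.
by apply: L1D; [apply: L1B => //; exact: L1Z|exact: L1_cst].
Qed.

Lemma L1_prod (d' : measure_display) (T : measurableType d')
    (P' : probability T R) (f g : T -> R) :
  measurable_fun setT f -> measurable_fun setT g ->
  L1 P' (fun w => f w ^+ 2) -> L1 P' (fun w => g w ^+ 2) ->
  L1 P' (fun w => f w * g w).
Proof.
move=> mf mg Lf2 Lg2; apply: (le_L1 _ _ (L1D Lf2 Lg2)).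
  exact: measurable_funM.
move=> w; rewrite [leRHS]ger0_norm; last by rewrite addr_ge0// sqr_ge0.
rewrite ler_norml; have := sqr_ge0 (f w - g w); have := sqr_ge0 (f w + g w).
have := sqr_ge0 (f w); have := sqr_ge0 (g w); nra.
Qed.

Variable xs : nat -> Om -> R.
Hypothesis iidxs : pairwise_iid P0 P x xs.

Let y i w := h (xs i w).
Let v := mean P0 (fun w => h (x w) ^+ 2).

Let my i : measurable_fun setT (y i).
Proof. by have [mxs _ _] := iidxs; exact: (measurableT_comp mh (mxs i)). Qed.

Let Ly2 i : L1 P (fun w => y i w ^+ 2) /\ mean P (fun w => y i w ^+ 2) = v.
Proof.
have [mxs _ lxs] := iidxs.
have mh2 : measurable_fun setT (fun z => h z ^+ 2) by exact: measurable_funX.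
split; first exact: (L1_same_law (mxs i) mx (lxs i) mh2 Lh2).
exact: (mean_same_law (mxs i) mx (lxs i) mh2 Lh2).
Qed.

Let Ey i : mean P (y i) = 0.
Proof.
have [mxs _ lxs] := iidxs; rewrite -Eh.
apply: (mean_same_law (mxs i) mx (lxs i) mh).
by apply: L1_of_sqr => //; exact: measurableT_comp.
Qed.

Let Ly i : L1 P (y i).
Proof. by apply: L1_of_sqr => //; case: (Ly2 i). Qed.

Let uncorrelated i j : i != j -> mean P (fun w => y i w * y j w) = 0.
Proof.
move=> ij; have [_ ixs _] := iidxs.
rewrite mean_indepM ?Ey ?mul0r//.
- exact: (indep_comp mh mh (ixs _ _ ij)).
- by apply: L1_prod => //; [case: (Ly2 i)|case: (Ly2 j)].
Qed.

Lemma mean_block_sqr a k :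
  L1 P (fun w => (\sum_(a <= i < a + k) y i w) ^+ 2) /\
  mean P (fun w => (\sum_(a <= i < a + k) y i w) ^+ 2) = k%:R * v.
Proof.
elim: k => [|k [LS ES]].
  rewrite addn0; under [X in L1 P X]eq_fun do rewrite big_geq// expr0n/=.
  under eq_mean do rewrite big_geq// expr0n/=.
  by rewrite mean_cst mul0r; split => //; exact: L1_cst.
pose S w := \sum_(a <= i < a + k) y i w.
have mS : measurable_fun setT S by exact: measurable_sum.
have SE w : (\sum_(a <= i < a + k.+1) y i w) ^+ 2 =
    S w ^+ 2 + 2 * (S w * y (a + k)%N w) + y (a + k)%N w ^+ 2.
  by rewrite addnS big_nat_recr ?leq_addr//= -/(S w); ring.
have [Lk Ek] := Ly2 (a + k).
have LSy : L1 P (fun w => S w * y (a + k)%N w) by exact: L1_prod.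
have LSy2 : L1 P (fun w => 2 * (S w * y (a + k)%N w)) by exact: L1Z.
have L12 : L1 P (fun w => S w ^+ 2 + 2 * (S w * y (a + k)%N w)) by exact: L1D.
split; first by under eq_fun do rewrite SE; exact: L1D.
under eq_mean do rewrite SE.
rewrite !meanD// meanZ// ES Ek.
have -> : mean P (fun w => S w * y (a + k)%N w) = 0.
  under eq_mean do rewrite /S big_distrl/=.
  rewrite mean_sum; last first.
    by move=> i; apply: L1_prod => //; case: (Ly2 i).
  rewrite big_nat_cond big1// => i; rewrite andbT => /andP[_ ik].
  by apply: uncorrelated; rewrite ltn_eqF.
by rewrite mulr0 addr0 -natr1 mulrDl mul1r.
Qed.

(** Chebyshev's inequality: for pairwise independent variables the variances
    add up. *)
Lemma chebyshev_block a k (e : R) : 0 < e ->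
  prob_le P [set w | e <= `|\sum_(a <= i < a + k) y i w|] (k%:R * v / e ^+ 2).
Proof.
move=> e0; have [LS ES] := mean_block_sqr a k.
apply: (prob_le_markov (e := e ^+ 2) _ LS) => //.
- by rewrite exprn_gt0.
- by move=> w; exact: sqr_ge0.
- move=> w /= ew; rewrite -[leRHS]real_normK ?num_real//.
  by rewrite lerXn2r ?nnegrE// ltW.
- by rewrite ES.
Qed.

End blocks.

(** * Linear lower bounds for random walks, and for perturbations *)

(** By comparison with a telescoping sum. *)
Lemma sum_inv_sqr_le (R : realType) (N m : nat) :
  \sum_(n < m) (n%:R + N.+2%:R) ^- 2 <= N.+1%:R^-1 :> R.
Proof.
suff : \sum_(n < m) (n%:R + N.+2%:R) ^- 2 <=
    N.+1%:R^-1 - (m%:R + N.+1%:R)^-1 :> R.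
  by move=> /le_trans; apply; rewrite gerBl invr_ge0.
elim: m => [|m IHm]; first by rewrite big_ord0 add0r subrr.
rewrite big_ord_recr/=; apply: (le_trans (lerD IHm (lexx _))).
have -> : m.+1%:R + N.+1%:R = m%:R + N.+2%:R :> R.
  by rewrite -!natrD addSnnS.
have -> : m%:R + N.+1%:R = (m%:R + N.+2%:R) - 1 :> R.
  by rewrite -[N.+2%:R]natr1 addrA addrK.
have : 2 <= m%:R + N.+2%:R :> R by rewrite -natrD ler_nat; lia.
move: (m%:R + N.+2%:R : R) => y y2.
have y0 : y != 0 by rewrite lt0r_neq0//; lra.
have y1 : y - 1 != 0 by rewrite lt0r_neq0//; lra.
rewrite -lerBrDl opprB addrC addrA subrK -subr_ge0.
have -> : (y - 1)^-1 - y^-1 - y ^- 2 = (y ^+ 2 * (y - 1))^-1.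
  by field; rewrite y0 y1.
by rewrite invr_ge0 mulr_ge0 ?sqr_ge0//; lra.
Qed.

Lemma sqr_bracket (j : nat) : exists m : nat, (m ^ 2 <= j < m.+1 ^ 2)%N.
Proof.
elim: j => [|j [m /andP[m1 m2]]]; first by exists 0%N.
have [e|ne] := eqVneq j.+1 (m.+1 ^ 2)%N.
  exists m.+1; rewrite e leqnn/= !expnS !expn0; lia.
by exists m; apply/andP; split; [lia|rewrite ltn_neqAle ne m2].
Qed.

Section maximal.
Context (R : realType) (d0 d : measure_display).
Context (Om0 : measurableType d0) (Om : measurableType d).
Variables (P0 : probability Om0 R) (P : probability Om R).

(** With a linear drift to spare, the walk is controlled along the squares
    [m ^ 2] by Chebyshev's inequality, whose bounds are summable, and between
    two squares by the sum of the negative parts of the steps. The constant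
    depends on the law of the steps only. *)
Lemma walk_lower (x : Om0 -> R) (mu delta : R) :
  measurable_fun setT x -> 0 < mu -> mean P0 x = mu ->
  L1 P0 (fun w => x w ^+ 2) -> 0 < delta ->
  exists K : R, forall xs, pairwise_iid P0 P x xs ->
    prob_le P [set w | exists j : nat,
      \sum_(0 <= l < j) xs l w < mu / 2 * j%:R - K] delta.
Proof.
move=> mx mu0 Ex Lx2 delta0.
have Lx : L1 P0 x by exact: L1_of_sqr.
pose neg (z : R) := Num.max (- z) 0.
have mneg : measurable_fun setT neg by apply: measurable_maxr.
have neg0 z : 0 <= neg z by rewrite /neg le_max lexx orbT.
have negz z : - z <= neg z by rewrite /neg le_max lexx.
have neg_norm z : neg z <= `|z|.
  by rewrite /neg ge_max normr_ge0 andbT -normrN ler_norm.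
have Lneg : L1 P0 (neg \o x).
  apply: (le_L1 _ _ Lx); first exact: measurableT_comp.
  by move=> w /=; rewrite ger0_norm.
pose nu := mean P0 (neg \o x).
pose h1 z := z - mu; pose h2 z := neg z - nu.
have mh1 : measurable_fun setT h1 by exact: measurable_funB.
have mh2 : measurable_fun setT h2 by exact: measurable_funB.
have Lneg2 : L1 P0 (fun w => neg (x w) ^+ 2).
  apply: (le_L1 _ _ Lx2).
    by apply: measurable_funX; exact: measurableT_comp.
  move=> w; rewrite !ger0_norm ?sqr_ge0// -[leRHS]real_normK ?num_real//.
  by rewrite lerXn2r// nnegrE.
have Lh1 : L1 P0 (fun w => h1 (x w) ^+ 2) by exact: L1_sqrB.
have Lh2 : L1 P0 (fun w => h2 (x w) ^+ 2) by exact: (@L1_sqrB _ _ _ _ (neg \o x)).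
have Eh1 : mean P0 (h1 \o x) = 0.
  by rewrite /h1 meanB//; [rewrite mean_cst Ex subrr|exact: L1_cst].
have Eh2 : mean P0 (h2 \o x) = 0.
  by rewrite /h2 meanB//; [rewrite mean_cst subrr|exact: L1_cst].
pose v1 := mean P0 (fun w => h1 (x w) ^+ 2).
pose v2 := mean P0 (fun w => h2 (x w) ^+ 2).
have v10 : 0 <= v1 by apply: mean_ge0 => w; exact: sqr_ge0.
have v20 : 0 <= v2 by apply: mean_ge0 => w; exact: sqr_ge0.
(* The two deviations allowed at [m ^ 2], of size [c * q m ^ 2] each, cost a
   constant and [mu / 4 * m ^ 2], half of the drift to spare; the other half
   absorbs the terms linear in [m]. *)
pose c := mu / 16; have c0 : 0 < c by rewrite divr_gt0.
pose V := (v1 + 2 * v2) / c ^+ 2.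
have V0 : 0 <= V by rewrite divr_ge0 ?sqr_ge0// addr_ge0// mulr_ge0.
pose N := Num.truncn (V / delta).
have VN : V * N.+1%:R^-1 <= delta.
  by rewrite ler_pdivrMr// mulrC -ler_pdivrMr// ltW// truncnS_gt.
pose q (m : nat) : R := m%:R + N.+2%:R.
have q2 m : 2 <= q m by rewrite /q -natrD ler_nat; lia.
have q0 m : 0 < q m by have := q2 m; lra.
pose beta := nu + mu / 2.
pose K := mu / 4 * N.+2%:R ^+ 2 + beta + 4 * beta ^+ 2 / mu.
exists K => xs iidxs.
pose r m : R := c * q m ^+ 2.
have r0 m : 0 < r m by rewrite mulr_gt0// exprn_gt0.
pose bad1 (m : nat) :=
  [set w | r m <= `|\sum_(0 <= i < 0 + m ^ 2) h1 (xs i w)|].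
pose bad2 (m : nat) :=
  [set w | r m <= `|\sum_(m ^ 2 <= i < m ^ 2 + (m.*2.+1)) h2 (xs i w)|].
have bad m : prob_le P (bad1 m `|` bad2 m) (V * (q m) ^- 2).
  have := prob_leU (chebyshev_block mx mh1 Lh1 Eh1 iidxs 0 (m ^ 2) (r0 m))
    (chebyshev_block mx mh2 Lh2 Eh2 iidxs (m ^ 2) m.*2.+1 (r0 m)).
  rewrite -/v1 -/v2; apply: prob_leS => //.
  have mq : m%:R <= q m by rewrite lerDl.
  have -> : V / q m ^+ 2 = (q m ^+ 2 * v1 + 2 * q m ^+ 2 * v2) / r m ^+ 2.
    rewrite /V /r; field; by rewrite !lt0r_neq0.
  rewrite -mulrDl ler_wpM2r ?invr_ge0 ?sqr_ge0//; apply: lerD.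
    by rewrite ler_wpM2r// natrX lerXn2r ?nnegrE// ltW.
  rewrite ler_wpM2r// -natr1 -mul2n natrM.
  have := q2 m; nra.
apply: (@prob_leS _ _ _ _ _ (\bigcup_m (bad1 m `|` bad2 m)) _ delta) => //; last first.
  apply: (prob_le_bigcup (dl := fun m => V * q m ^- 2)) => //.
  - by move=> m; rewrite mulr_ge0// invr_ge0 sqr_ge0.
  - move=> M; rewrite -mulr_sumr; apply: le_trans VN.
    by rewrite ler_wpM2l// sum_inv_sqr_le.
move=> w [j hj]; have [m /andP[mj jm]] := sqr_bracket j.
exists m => //; apply: contrapT => /not_orP[/negP + /negP].
rewrite -!ltNge !ltr_norml add0n => /andP[l1 _] /andP[_ u2].
have m2 : (m ^ 2 + m.*2.+1 = m.+1 ^ 2)%N by rewrite !expnS !expn0; lia.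
rewrite m2 in u2.
have E1 : \sum_(0 <= i < m ^ 2) h1 (xs i w) =
    \sum_(0 <= i < m ^ 2) xs i w - mu * m%:R ^+ 2.
  by rewrite sumrB sumr_const_nat subn0 -natrX mulr_natr.
have E2 : \sum_(m ^ 2 <= i < m.+1 ^ 2) h2 (xs i w) =
    \sum_(m ^ 2 <= i < m.+1 ^ 2) neg (xs i w) - nu * (2 * m%:R + 1).
  by rewrite sumrB sumr_const_nat -m2 addKn -[nu *+ _]mulr_natr
    -[m.*2.+1%:R]natr1 -mul2n natrM.
have Sj : \sum_(0 <= l < j) xs l w >=
    \sum_(0 <= i < m ^ 2) xs i w - \sum_(m ^ 2 <= i < m.+1 ^ 2) neg (xs i w).
  rewrite [leRHS](@big_cat_nat _ _ _ (m ^ 2)%N)//= lerD2l.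
  rewrite (@big_cat_nat _ _ _ j (m ^ 2)%N)//=; last exact: ltnW.
  rewrite opprD -[leRHS]subr0 lerB ?sumr_ge0// -sumrN.
  by apply: ler_sum => i _; rewrite lerNl.
have jM : j%:R <= (m%:R + 1) ^+ 2 :> R.
  by rewrite natr1 -natrX ler_nat ltnW.
move: hj; apply/negP; rewrite -leNgt.
apply: le_trans Sj.
move: l1 u2; rewrite E1 E2 /r /q /c.
set S1 := \sum_(0 <= i < _) _; set S2 := \sum_(m ^ 2 <= i < _) _.
move=> l1 u2.
have muj : mu / 2 * j%:R <= mu / 2 * (m%:R + 1) ^+ 2 by rewrite ler_wpM2l// divr_ge0// ltW.
have qm : (m%:R + N.+2%:R : R) ^+ 2 <= 2 * m%:R ^+ 2 + 2 * N.+2%:R ^+ 2.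
  by have := sqr_ge0 (m%:R - N.+2%:R : R); lra.
have cq : mu / 16 * (m%:R + N.+2%:R : R) ^+ 2 <=
    mu / 16 * (2 * m%:R ^+ 2 + 2 * N.+2%:R ^+ 2) by rewrite ler_wpM2l// ltW.
have sq : 0 <= mu^-1 * (mu * m%:R / 2 - 2 * beta) ^+ 2.
  by rewrite mulr_ge0 ?sqr_ge0// invr_ge0 ltW.
have sqE : mu^-1 * (mu * m%:R / 2 - 2 * beta) ^+ 2 =
    mu / 4 * m%:R ^+ 2 - 2 * m%:R * beta + 4 * beta ^+ 2 / mu.
  by field; rewrite lt0r_neq0.
rewrite sqE in sq; rewrite /K.
move: l1 u2 muj cq sq; rewrite /beta.
move: (m%:R : R) (N.+2%:R : R) (j%:R : R) => m' N' j'.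
set bb := 4 * _ / mu.
by move=> l1 u2 muj cq sq; lra.
Qed.

(** At most [y / a] of the indicators differ from 0. *)
Lemma sum_indic_le (y a : R) (m : nat) : 0 < a ->
  \sum_(l < m) (a * l.+1%:R < y)%R%:R <= Num.max y 0 / a.
Proof.
move=> a0; elim: m => [|m IHm].
  by rewrite big_ord0 divr_ge0 ?(ltW a0)// le_max lexx orbT.
rewrite big_ord_recr/=; case: ltP => [lt_y|_]; last by rewrite addr0.
apply: (@le_trans _ _ m.+1%:R).
  rewrite -natr1 lerD// -[X in _ <= X%:R]card_ord -sum1_card natr_sum.
  by apply: ler_sum => i _; case: (_ < _).
by rewrite ler_pdivlMr// mulrC le_max ltW.
Qed.

(** A perturbation with integrable positive part stays below any line of positive
    slope: the probabilities of exceeding it are dominated by the expectation. *)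
Lemma perturbation_upper (x : Om0 -> R) (a delta : R) :
  measurable_fun setT x -> 0 < a ->
  L1 P0 (fun w => Num.max (x w) 0) -> 0 < delta ->
  exists K : R, forall xs : nat -> Om -> R,
    (forall i, measurable_fun setT (xs i)) ->
    (forall i, same_law P P0 (xs i) x) ->
    prob_le P [set w | exists l : nat, a * l%:R + K < xs l w] delta.
Proof.
move=> mx a0 Lx delta0.
pose f N w := Num.max (x w - a * N%:R) 0.
have mf N : measurable_fun setT (f N).
  by apply: measurable_maxr => //; exact: measurable_funB.
have f0 N w : 0 <= f N w by rewrite /f le_max lexx orbT.
have fle N w : f N w <= Num.max (x w) 0.
  have aN : 0 <= a * N%:R by rewrite mulr_ge0// ltW.
  rewrite /f ge_max !le_max lexx orbT andbT; apply/orP; left; lra.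
have Lf N : L1 P0 (f N).
  apply: (le_L1 (mf N) _ Lx) => w.
  by rewrite !ger0_norm ?f0// le_max lexx orbT.
have cvf : mean P0 (f N) @[N --> \oo] --> 0.
  apply: (mean_dominated_cvg0 mf Lx) => [n w|w]; first by rewrite ger0_norm.
  apply: cvg_near_cst; exists (Num.truncn (x w / a)).+1 => // n /= nx.
  rewrite /f max_r// subr_le0 mulrC -ler_pdivrMr//.
  by rewrite (le_trans (ltW (truncnS_gt _)))// ler_nat.
have [N _ /(_ N (leqnn N)) /= fN] := cvgr_lt 0 cvf _ (mulr_gt0 a0 delta0).
exists (a * N.+1%:R) => xs mxs lxs.
pose I l : set R := `]a * l%:R + a * N.+1%:R, +oo[%classic.
have mI l : measurable (I l) by exact: measurable_itv.
have mxI l : measurable (x @^-1` I l) by rewrite -[X in measurable X]setTI; exact: mx.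
have indE l w : \1_(x @^-1` I l) w = (a * l.+1%:R < x w - a * N%:R)%R%:R :> R.
  have eN : N.+1%:R = N%:R + 1 :> R by rewrite natr1.
  have el : l.+1%:R = l%:R + 1 :> R by rewrite natr1.
  rewrite indicE; congr (nat_of_bool _)%:R; apply/idP/idP.
    rewrite inE /I/= in_itv/= andbT eN el; lra.
  rewrite inE /I/= in_itv/= andbT eN el; lra.
apply: (@prob_leS _ _ _ _ _ (\bigcup_l (xs l @^-1` I l)) _ delta) => //.
  by move=> w [l hl]; exists l => //; rewrite /preimage /I /= in_itv/= andbT.
apply: (prob_le_bigcup (dl := fun l => fine (P0 (x @^-1` I l)))).
- by move=> l; exact: fine_ge0.
- move=> l; exists (xs l @^-1` I l); split => //.
    by rewrite -[X in measurable X]setTI; exact: mxs.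
  by rewrite fineK ?fin_num_measure// (lxs l _ (mI l)).
move=> m; under eq_bigr do rewrite -mean_indic//.
rewrite -mean_sum; last by move=> l; exact: L1_indic.
apply: (@le_trans _ _ (mean P0 (fun w => a^-1 * f N w))); last first.
  by rewrite meanZ// mulrC ler_pdivrMr// mulrC ltW.
apply: le_mean; [by apply: L1_sum => l; exact: L1_indic|exact: L1Z|].
move=> w; under eq_bigr do rewrite indE.
by rewrite [leRHS]mulrC; exact: sum_indic_le.
Qed.

End maximal.

(** * Passage times, visits and exits of a fixed path *)

Section path.
Context (R : realType) (T : Type) (xi eta : nat -> T -> R) (t : R) (w : T).
Local Notation Tn := (perturbed_walk xi eta).
Local Notation tau := (first_passage xi eta t w).
Local Notation rho := (last_exit xi eta t w).
Local Notation N := (nb_visits xi eta t w).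

Lemma before_first_passage (m : nat) : (1 <= m)%N -> (m%:R%:E < tau)%E ->
  Tn m w <= t.
Proof.
move=> m1 mtau; rewrite leNgt; apply/negP => tm.
move: mtau; rewrite ltNge => /negP; apply; apply: ereal_inf_lbound.
by exists m.
Qed.

Lemma first_passage_attained (y : R) : (tau <= y%:E)%E ->
  exists m : nat, [/\ (1 <= m)%N, m%:R <= y & t < Tn m w].
Proof.
move=> tauy; apply: contrapT => no.
have : ((Num.truncn y).+1%:R%:E <= tau)%E.
  apply: le_ereal_inf_tmp => _ [m [m1 tm] <-].
  rewrite lee_fin ler_nat ltnNge; apply/negP => my; apply: no; exists m; split => //.
  have y0 : 0 <= y.
    rewrite leNgt; apply/negP => y0; move: (leq_trans m1 my).
    by rewrite truncn_gt0 leNgt (lt_trans y0).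
  by rewrite -truncn_ge_nat.
move=> /le_trans /(_ tauy); rewrite lee_fin leNgt truncnS_gt.
by [].
Qed.

Lemma after_last_exit (m : nat) : (1 <= m)%N -> (rho < m%:R%:E)%E -> t < Tn m w.
Proof.
move=> m1 mrho; rewrite ltNge; apply/negP => tm.
move: mrho; rewrite ltNge => /negP; apply; apply: ereal_sup_ubound.
by right; exists m.
Qed.

Lemma last_exit_ge0 : (0 <= rho)%E.
Proof. by apply: ereal_sup_ubound; left. Qed.

Lemma last_exit_approached (y : R) : 0 <= y -> (y%:E < rho)%E ->
  exists m : nat, [/\ (1 <= m)%N, y < m%:R & Tn m w <= t].
Proof.
move=> y0 /ereal_sup_gt[_ [->|[m [m1 tm] <-]]].
  by rewrite lte_fin ltNge y0.
by rewrite lte_fin => ym; exists m.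
Qed.

(** All visits occur up to the last exit. *)
Lemma nb_visits_le_last_exit : (N <= rho)%E.
Proof.
have [->|] := eqVneq rho +oo%E; first exact: leey.
rewrite -ltey -ge0_fin_numE ?last_exit_ge0// => frho.
pose r := Num.truncn (fine rho).
have r0 : 0 <= fine rho by rewrite fine_ge0// last_exit_ge0.
have tail n : (r < n)%N -> \1_[set x : R | x <= t] (Tn n w) = 0 :> R.
  move=> rn; rewrite indicE memNset//= => tn.
  have : (rho < n%:R%:E)%E.
    by rewrite -(fineK frho) lte_fin -truncn_lt_nat.
  by move=> /after_last_exit => /(_ (leq_ltn_trans (leq0n _) rn)); rewrite ltNge tn.
apply: (@le_trans _ _ r%:R%:E); last first.
  by rewrite -(fineK frho) lee_fin truncn_le.
apply: lime_le; first by apply: is_cvg_nneseries => n _ _; rewrite lee_fin.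
apply: nearW => m; rewrite sumEFin lee_fin.
have ind1 n : \1_[set x : R | x <= t] (Tn n w) <= 1 :> R.
  by rewrite indicE; case: (_ \in _).
apply: (@le_trans _ _ (\sum_(1 <= n < r.+1) 1)); last first.
  by rewrite sumr_const_nat subn1.
have [mr|rm] := leqP m r.+1.
  have [m1|m1] := leqP m 1; first by rewrite big_geq// sumr_ge0.
  rewrite (@big_cat_nat _ _ _ m 1 r.+1)//=; last exact: ltnW.
  rewrite -[leLHS]addr0 lerD ?sumr_ge0//.
  by apply: ler_sum => n _.
rewrite (@big_cat_nat _ _ _ r.+1)//=; last exact: ltnW.
rewrite [X in _ + X]big_nat_cond [X in _ + X]big1 ?addr0.
  by apply: ler_sum => n _.
by move=> n; rewrite andbT => /andP[rn _]; exact: tail.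
Qed.

(** All indices before the first passage are visits. *)
Lemma first_passage_le_nb_visits : (tau <= N + 1)%E.
Proof.
have N0 : (0 <= N)%E by apply: nneseries_ge0 => n _ _; rewrite lee_fin.
have [->|] := eqVneq N +oo%E; first by rewrite addye ?leey.
rewrite -ltey -ge0_fin_numE// => fN; rewrite leNgt; apply/negP => Ntau.
pose m := (Num.truncn (fine N)).+1.
have fN0 : 0 <= fine N by rewrite fine_ge0.
have mtau : (m%:R%:E < tau)%E.
  apply: le_lt_trans Ntau; rewrite -(fineK fN) -EFinD lee_fin.
  by rewrite /m -natr1 lerD2r truncn_le.
have : (m%:R%:E <= N)%E.
  apply: le_trans (nneseries_lim_ge m.+1 _); last first.
    by move=> n _ _; rewrite lee_fin.
  rewrite sumEFin lee_fin.
  rewrite (eq_big_nat _ _ (F2 := fun=> 1)); last first.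
    move=> n /andP[n1 nm]; rewrite indicE mem_set//=.
    apply: before_first_passage => //; apply: le_lt_trans mtau.
    by rewrite lee_fin ler_nat.
  by rewrite sumr_const_nat subn1.
by rewrite -(fineK fN) lee_fin leNgt truncnS_gt.
Qed.

End path.

(** * Measurability *)

Section measurability.
Context (R : realType) (d : measure_display) (Om : measurableType d).
Variables (xi eta : nat -> Om -> R).
Hypothesis mxi : forall i, measurable_fun setT (xi i).
Hypothesis meta : forall i, measurable_fun setT (eta i).
Implicit Type t : R.

Lemma measurable_perturbed_walk n : measurable_fun setT (perturbed_walk xi eta n).
Proof. by apply: measurable_funD => //; exact: measurable_sum. Qed.

Let measurable_le n t : measurable [set w | perturbed_walk xi eta n w <= t].
Proof.
rewrite (_ : mkset _ = perturbed_walk xi eta n @^-1` `]-oo, t]); last first.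
  by apply/seteqP; split => w /=; rewrite in_itv.
by rewrite -[_ @^-1` _]setTI; apply: measurable_perturbed_walk.
Qed.

Lemma measurable_first_passage t : measurable_fun setT (first_passage xi eta t).
Proof.
pose h n w : \bar R := if (1 <= n)%N && (t < perturbed_walk xi eta n w) then n%:R%:E else +oo%E.
have -> : first_passage xi eta t = fun w => einfs (h ^~ w) 0.
  apply/funext => w; rewrite /einfs /sdrop; apply/eqP; rewrite eq_le; apply/andP; split.
    apply: le_ereal_inf_tmp => _ [n _ <-]; rewrite /h; case: ifPn => [/andP[n1 tn]|_].
      by apply: ereal_inf_lbound; exists n.
    exact: leey.
  apply: le_ereal_inf_tmp => _ [n [n1 tn] <-]; apply: ereal_inf_lbound.
  by exists n => //; rewrite /h n1 tn.
apply: measurable_fun_einfs => n; rewrite /h; case: (1 <= n)%N => /=; last exact: measurable_cst.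
apply: measurable_fun_ifT => //.
by apply: measurable_fun_ltr => //; exact: measurable_perturbed_walk.
Qed.

Lemma measurable_last_exit t : measurable_fun setT (last_exit xi eta t).
Proof.
pose h n w : \bar R := if (1 <= n)%N && (perturbed_walk xi eta n w <= t) then n%:R%:E else 0%E.
have -> : last_exit xi eta t = fun w => esups (h ^~ w) 0.
  apply/funext => w; rewrite /esups /sdrop; apply/eqP; rewrite eq_le; apply/andP; split.
    apply: ge_ereal_sup => _ [->|[n [n1 tn] <-]]; apply: ereal_sup_ubound.
      by exists 0%N.
    by exists n => //; rewrite /h n1 tn.
  apply: ge_ereal_sup => _ [n _ <-]; apply: ereal_sup_ubound; rewrite /h.
  case: ifPn => [/andP[n1 tn]|_]; last by left.
  by right; exists n.
apply: measurable_fun_esups => n; rewrite /h; case: (1 <= n)%N => /=; last exact: measurable_cst.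
apply: measurable_fun_ifT => //.
by apply: measurable_fun_ler => //; exact: measurable_perturbed_walk.
Qed.

Lemma measurable_nb_visits t : measurable_fun setT (nb_visits xi eta t).
Proof.
pose h n w : \bar R := (\1_[set x : R | x <= t] (perturbed_walk xi eta n w))%:E.
have -> : nb_visits xi eta t =
    fun w => (\sum_(n <oo | n \in [pred k : nat | (1 <= k)%N]) h n w)%E.
  apply/funext => w; rewrite /nb_visits eseries_cond.
  by apply: eq_eseriesl => n; rewrite inE.
apply: ge0_emeasurable_sum => [n w _ _|n _]; first by rewrite lee_fin.
apply/measurable_EFinP.
rewrite (_ : (fun w => _) = \1_[set w | perturbed_walk xi eta n w <= t]).
  exact: measurable_indic.
by apply/funext => w; rewrite !indicE; congr (nat_of_bool _)%:R; apply/idP/idP; rewrite !inE.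
Qed.

Lemma measurable_rescaled (mu sigma2 : R) (V : R -> Om -> \bar R) t u :
  (forall s, measurable_fun setT (V s)) ->
  measurable_fun setT (rescaled mu sigma2 V t u).
Proof.
move=> mV; apply: emeasurable_funM; last exact: measurable_cst.
by apply: emeasurable_funB => //; exact: measurable_cst.
Qed.

End measurability.

(** * Passage times follow the walk at a deterministic time *)

Section passage_limit.
Context (R : realType) (d0 d : measure_display).
Context (Om0 : measurableType d0) (Om : measurableType d).
Variables (P0 : probability Om0 R) (P : probability Om R).
Variables (xi eta : Om0 -> R) (xs es : nat -> Om -> R) (mu sigma2 : R).
Hypotheses (mu_gt0 : 0 < mu) (sigma2_gt0 : 0 < sigma2).
Hypotheses (mxi : measurable_fun setT xi) (Exi : mean P0 xi = mu).
Hypothesis (Lxi2 : L1 P0 (fun w => xi w ^+ 2)).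
Hypothesis (Vxi : mean P0 (fun w => (xi w - mu) ^+ 2) = sigma2).
Hypothesis (iidxs : pairwise_iid P0 P xi xs).
Hypothesis (meta : measurable_fun setT eta).
Hypothesis (mes : forall i, measurable_fun setT (es i)).
Hypothesis (lawes : forall i, same_law P P0 (es i) eta).
Variable u : R.
Hypothesis u_ge0 : 0 <= u.

Local Notation sc := (scale mu sigma2).
Local Notation steps := (nsteps mu).
Local Notation S := (random_walk xs).
Local Notation Tn := (perturbed_walk xs es).

(** The common approximation of the three rescaled processes. *)
Definition walk_approx (t : R) (w : Om) : R :=
  \sum_(0 <= i < steps t u) scaled_step mu sigma2 t (xs i w).

(** The value of a passage time whose rescaling is [r]. *)
Definition level (t r : R) : R := u * t / mu + r * (sc t)^-1 / mu.

Let z t : R := (sc t)^-1.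
Let n t := steps t u.
Let dev (a b : nat) w : R := S a w - S b w - (a%:R - b%:R) * mu.

Let Lxi : L1 P0 xi. Proof. exact: L1_of_sqr. Qed.

Let Lxic2 : L1 P0 (fun w => (xi w - mu) ^+ 2).
Proof. exact: L1_sqrB. Qed.

Let z_gt0 t : 0 < t -> 0 < z t.
Proof. by move=> t0; rewrite invr_gt0 scale_gt0. Qed.

Lemma scale_inv_large (Z : R) : \forall t \near +oo, Z <= (sc t)^-1.
Proof.
near=> t.
have t0 : 0 < t by near: t; exact: nbhs_pinfty_gt.
have tZ : Z ^+ 2 * mu / sigma2 <= t by near: t; apply: nbhs_pinfty_ge; exact: num_real.
have [Z0|Z0] := leP Z 0; first by rewrite (le_trans Z0)// ltW// z_gt0.
rewrite /scale invrK -[leLHS](ger0_norm (ltW Z0)) -sqrtr_sqr ler_wsqrtr//.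
by rewrite ler_pdivlMr// [leRHS]mulrC -ler_pdivrMr.
Unshelve. all: by end_near. Qed.

Let z_large (Z : R) : \forall t \near +oo, Z <= z t := scale_inv_large Z.

Let z_sqr t : 0 < t -> (z t) ^- 2 = mu / (sigma2 * t).
Proof. by move=> t0; rewrite exprVn invrK scale_sqr. Qed.

Let random_walk_nat k w : S k w = \sum_(0 <= i < k) xs i w.
Proof. by rewrite /random_walk big_mkord. Qed.

Lemma walk_approxE t w :
  walk_approx t w = - (S (n t) w - (n t)%:R * mu) * sc t.
Proof.
rewrite /walk_approx /scaled_step -mulr_sumr sumrB sumr_const_nat subn0.
by rewrite random_walk_nat -[mu *+ _]mulr_natl; ring.
Qed.

Let approx_z t w : 0 < t ->
  S (n t) w - (n t)%:R * mu = - walk_approx t w * z t.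
Proof.
by move=> t0; rewrite walk_approxE /z; field; rewrite lt0r_neq0// scale_gt0.
Qed.

Let devE a k w : dev (a + k) a w = \sum_(a <= i < a + k) (xs i w - mu).
Proof.
rewrite /dev sumrB sumr_const_nat addKn -[mu *+ k]mulr_natl natrD.
by rewrite !random_walk_nat (@big_cat_nat _ _ _ a 0 (a + k))//= ?leq_addr//; ring.
Qed.

Let dev_sym a b w : dev a b w = - dev b a w.
Proof. by rewrite /dev; ring. Qed.

Let dev_cheb a b (e : R) : 0 < e ->
  prob_le P [set w | e <= `|dev a b w|] (`|a%:R - b%:R| * sigma2 / e ^+ 2).
Proof.
have mh : measurable_fun setT (fun x : R => x - mu) by exact: measurable_funB.
have Eh : mean P0 ((fun x : R => x - mu) \o xi) = 0.
  by rewrite /= meanB ?mean_cst ?Exi ?subrr//; exact: L1_cst.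
have cheb k l : 0 < e ->
    prob_le P [set w | e <= `|dev (k + l) k w|] (l%:R * sigma2 / e ^+ 2).
  move=> e0; have := chebyshev_block mxi mh Lxic2 Eh iidxs k l e0.
  rewrite Vxi; apply: prob_leS => // w /=.
  by rewrite devE.
move=> e0; have [ab|ba] := leqP a b.
  have := cheb a (b - a)%N e0; rewrite subnKC// natrB// => h.
  rewrite distrC ger0_norm ?subr_ge0 ?ler_nat//.
  by apply: prob_leS h => // w /=; rewrite dev_sym normrN.
have ba' := ltnW ba.
have := cheb b (a - b)%N e0; rewrite subnKC// natrB// => h.
by rewrite ger0_norm ?subr_ge0 ?ler_nat.
Qed.

(** Over a stretch of order [sqrt t] the centered walk moves by [o(sqrt t)]. *)
Lemma dev_unlikely (p : R -> nat) (C e : R) : 0 < e ->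
  (\forall t \near +oo, `|(p t)%:R - u * t / mu| <= C * z t) ->
  unlikely P (fun t => [set w | e * z t <= `|dev (p t) (n t) w|]).
Proof.
move=> e0 pC delta delta0; near=> t.
have t0 : 0 < t by near: t; exact: nbhs_pinfty_gt.
have z1 : 1 <= z t by near: t; exact: z_large.
have zd : (C + 1) * sigma2 / (e ^+ 2 * delta) <= z t by near: t; exact: z_large.
have ptC : `|(p t)%:R - u * t / mu| <= C * z t by near: t.
have zt0 := z_gt0 t0.
have ez : 0 < e * z t by rewrite mulr_gt0.
apply: prob_leS (dev_cheb (p t) (n t) ez) => //.
have /andP[n1 n2] := nsteps_itv mu_gt0 t0 u_ge0.
have : `|(p t)%:R - (n t)%:R| <= (C + 1) * z t.
  move: ptC; rewrite !ler_norml -/(n t) in n1 n2 * => /andP[h1 h2].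
  by rewrite mulrDl mul1r; apply/andP; split; rewrite /n; lra.
move=> h; apply: (@le_trans _ _ ((C + 1) * z t * sigma2 / (e * z t) ^+ 2)).
  by rewrite ler_wpM2r ?invr_ge0 ?sqr_ge0// ler_wpM2r// ltW.
have -> : (C + 1) * z t * sigma2 / (e * z t) ^+ 2 =
    (C + 1) * sigma2 / e ^+ 2 / z t.
  by field; rewrite !lt0r_neq0.
rewrite ler_pdivrMr// ler_pdivrMr ?exprn_gt0//.
move: zd; rewrite ler_pdivrMr ?mulr_gt0 ?exprn_gt0// => /le_trans; apply.
by rewrite le_eqVlt; apply/orP; left; apply/eqP; ring.
Unshelve. all: by end_near. Qed.

Lemma noise_unlikely (p : R -> nat) (e : R) : 0 < e ->
  unlikely P (fun t => [set w | e * z t <= `|es (p t) w|]).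
Proof.
move=> e0 delta delta0; have [K PK] := tail_small P0 meta delta0.
near=> t.
have zk : K / e <= z t by near: t; exact: z_large.
have mK := measurable_norm_ge K.
exists (es (p t) @^-1` [set y | K <= `|y|]); split.
- by rewrite -[X in measurable X]setTI; exact: mes.
- by rewrite (lawes (p t) mK).
- by move=> w /= h; apply: le_trans h; rewrite mulrC -ler_pdivrMr.
Unshelve. all: by end_near. Qed.

Lemma walk_approx_tight (delta : R) : 0 < delta ->
  exists K : R, \forall t \near +oo, prob_le P [set w | K <= `|walk_approx t w|] delta.
Proof.
move=> delta0; pose K := Num.sqrt (u / delta) + 1.
have K0 : 0 < K by rewrite ltr_wpDl// sqrtr_ge0.
have uK : u / K ^+ 2 <= delta.
  rewrite ler_pdivrMr ?exprn_gt0// mulrC -ler_pdivrMr//.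
  rewrite -[leLHS]sqr_sqrtr ?divr_ge0 ?(ltW delta0)//.
  by rewrite lerXn2r ?nnegrE ?sqrtr_ge0 ?(ltW K0)// /K lerDl.
exists K; near=> t.
have t0 : 0 < t by near: t; exact: nbhs_pinfty_gt.
have zt0 := z_gt0 t0.
apply: prob_leS (dev_cheb (n t) 0 (mulr_gt0 K0 zt0)).
  move=> w /=; have S0 : S 0%N w = 0 by rewrite /random_walk big_ord0.
  rewrite /dev S0 mulr0n !subr0 approx_z// normrM normrN (gtr0_norm zt0).
  by rewrite ler_pM2r.
have /andP[n1 _] := nsteps_itv mu_gt0 t0 u_ge0.
rewrite subr0 ger0_norm//; apply: le_trans uK.
have -> : (n t)%:R * sigma2 / (K * z t) ^+ 2 = (n t)%:R * (sigma2 * z t ^- 2) / K ^+ 2.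
  by field; rewrite !lt0r_neq0.
rewrite ler_wpM2r ?invr_ge0 ?sqr_ge0// z_sqr//.
have -> : sigma2 * (mu / (sigma2 * t)) = mu / t by field; rewrite !lt0r_neq0.
apply: (@le_trans _ _ (u * t / mu * (mu / t))).
  by rewrite ler_wpM2r// ltW// divr_gt0.
by rewrite le_eqVlt; apply/orP; left; apply/eqP; field; rewrite !lt0r_neq0.
Unshelve. all: by end_near. Qed.

Let level_large (r L : R) : 0 < u \/ 0 < r -> \forall t \near +oo, L <= level t r.
Proof.
move=> ur; near=> t.
have t0 : 0 < t by near: t; exact: nbhs_pinfty_gt.
have z0 := z_gt0 t0.
have -> : level t r = z t * (u / sigma2 * z t + r / mu).
  have tE : t = mu / sigma2 * z t ^+ 2.
    rewrite -[z t ^+ 2]invrK z_sqr//; field; by rewrite !lt0r_neq0.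
  rewrite /level -/(z t) {1}tE; move: (z t) => zt.
  by field; rewrite !lt0r_neq0.
have [u0|u0] := ltP 0 u.
  have z1 : (1 + `|r| / mu) * sigma2 / u <= z t by near: t; exact: z_large.
  have zL : `|L| <= z t by near: t; exact: z_large.
  have : 1 <= u / sigma2 * z t + r / mu.
    have : 1 + `|r| / mu <= u / sigma2 * z t.
      rewrite mulrAC ler_pdivlMr// [leRHS]mulrC -ler_pdivrMr//.
    have : - (`|r| / mu) <= r / mu.
      by rewrite -mulNr ler_wpM2r ?invr_ge0 ?(ltW mu_gt0)// lerNl -normrN ler_norm.
    by lra.
  move=> h; apply: (le_trans (ler_norm L)); apply: (le_trans zL).
  by rewrite ler_peMr// ltW.
have r0 : 0 < r by case: ur => //; rewrite ltNge u0.
have zL : L * mu / r <= z t by near: t; exact: z_large.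
have -> : u = 0 by apply/eqP; rewrite eq_le u0 u_ge0.
by rewrite !mul0r add0r mulrA ler_pdivlMr// -ler_pdivrMr.
Unshelve. all: by end_near. Qed.

Let walk_approx_u0 t w : u = 0 -> walk_approx t w = 0.
Proof.
move=> u0; rewrite /walk_approx u0 big_geq// /nsteps.
by rewrite !mul0r truncn0.
Qed.

(** At a single index close to the level, the perturbed walk is where the
    approximation says it is. *)
Let near_level (p : R -> nat) (r e : R) : 0 < e ->
  (\forall t \near +oo, `|(p t)%:R - level t r| <= 2) ->
  unlikely P (fun t => [set w | e * z t <= `|dev (p t) (n t) w|]) /\
  unlikely P (fun t => [set w | e * z t <= `|es (p t) w|]).
Proof.
move=> e0 pr; split; last exact: noise_unlikely.
apply: (@dev_unlikely _ (`|r| / mu + 2)) => //; near=> t.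
have z1 : 1 <= z t by near: t; exact: z_large.
have : `|(p t)%:R - level t r| <= 2 by near: t.
rewrite /level -/(z t) => h.
have -> : (p t)%:R - u * t / mu = ((p t)%:R - (u * t / mu + r * z t / mu)) + r / mu * z t by ring.
apply: (le_trans (ler_normD _ _)); rewrite mulrDl addrC; apply: lerD.
  have z0 : 0 <= z t by lra.
  by rewrite !normrM (ger0_norm z0) normfV (gtr0_norm mu_gt0).
by apply: (le_trans h); lra.
Unshelve. all: by end_near. Qed.

Let mu_level t r : mu * level t r = u * t + r * z t.
Proof. by rewrite /level -/(z t); field; rewrite lt0r_neq0. Qed.

Let Wz t w (x : R) : 0 < t -> walk_approx t w <= x ->
  - x * z t <= S (n t) w - (n t)%:R * mu.
Proof.
move=> t0 Wx; rewrite approx_z// ler_wpM2r ?lerN2//; exact/ltW/z_gt0.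
Qed.

Let zW t w (x : R) : 0 < t -> x <= walk_approx t w ->
  S (n t) w - (n t)%:R * mu <= - x * z t.
Proof.
move=> t0 Wx; rewrite approx_z// ler_wpM2r ?lerN2//; exact/ltW/z_gt0.
Qed.

(** At the index just below the level [x + e] the perturbed walk has not passed
    [u t] yet, so that the walk is late there; it was then late at the index of
    [walk_approx], too. *)
Lemma first_passage_upper (x e : R) : 0 < e ->
  unlikely P (fun t => [set w | ((level t (x + e))%:E <
    first_passage xs es (u * t) w)%E /\ walk_approx t w <= x]).
Proof.
move=> e0; have [[u0 x0]|ux] := pselect (u = 0 /\ x < 0).
  apply: (unlikelyS _ (unlikely0 _)); apply: nearW => t w /= [_].
  by rewrite (walk_approx_u0 t w u0) leNgt x0.
have lev2 : \forall t \near +oo, 2 <= level t (x + e).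
  apply: level_large; have [u0|u0] := ltP 0 u; [by left|right].
  have /ltr_wpDl : 0 <= x; last exact.
  rewrite leNgt; apply/negP => x0; apply: ux; split => //.
  by apply/eqP; rewrite eq_le u0 u_ge0.
pose p t := (Num.truncn (level t (x + e))).-1.
have e40 : 0 < e / 4 by rewrite divr_gt0.
have pE t : 2 <= level t (x + e) ->
    [/\ (p t).+1%:R <= level t (x + e), level t (x + e) < (p t)%:R + 2 &
        (0 < (p t).+1)%N].
  move=> l2; have l0 : 0 <= level t (x + e) by lra.
  have tr : (0 < Num.truncn (level t (x + e)))%N by rewrite truncn_gt0; lra.
  have /andP[h1 h2] := truncn_itv l0; rewrite /p prednK//; split => //.
  move: h2; rewrite -(prednK tr) -!natr1; lra.
have [|uD uE] := near_level (p := p) (r := x + e) e40.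
  near=> t; have l2 : 2 <= level t (x + e) by near: t.
  have [h1 h2 _] := pE t l2; rewrite -natr1 in h1.
  by rewrite ler_norml; apply/andP; split; lra.
apply: (unlikelyS _ (unlikelyU uD uE)); near=> t => w /= [ltau Wx].
have t0 : 0 < t by near: t; exact: nbhs_pinfty_gt.
have l2 : 2 <= level t (x + e) by near: t.
have zb : 4 * mu / e + 1 <= z t by near: t; exact: z_large.
have [h1 h2 h3] := pE t l2.
have Tm : Tn (p t).+1 w <= u * t.
  apply: before_first_passage => //; apply: le_lt_trans ltau.
  by rewrite lee_fin.
apply: contrapT => /not_orP[/negP + /negP].
rewrite -!ltNge !ltr_norml => /andP[d1 d2] /andP[n1 n2].
have := Wz t0 Wx; move: Tm; rewrite /perturbed_walk /= => Tm SW.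
have mup : u * t + (x + e) * z t < mu * ((p t)%:R + 2).
  by rewrite -mu_level ltr_pM2l.
have ze : 4 * mu + e <= e * z t.
  move: zb; rewrite -(ler_pM2l e0) mulrDr mulr1 mulrCA divff ?mulr1//.
  exact: lt0r_neq0.
by rewrite /dev in d1 d2; lra.
Unshelve. all: by end_near. Qed.

Let level_ge0 r : u = 0 /\ r < 0 \/ (\forall t \near +oo, 0 <= level t r).
Proof.
have [u0|u0] := ltP 0 u; first by right; apply: level_large; left.
have uE : u = 0 by apply/eqP; rewrite eq_le u0 u_ge0.
have [r0|r0] := ltP r 0; [by left|right; near=> t].
have t0 : 0 < t by near: t; exact: nbhs_pinfty_gt.
rewrite /level uE !mul0r add0r divr_ge0 ?mulr_ge0 ?(ltW mu_gt0)//.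
exact/ltW/z_gt0.
Unshelve. all: by end_near. Qed.

Let level_lt0 t r : 0 < t -> u = 0 -> r < 0 -> level t r < 0.
Proof.
move=> t0 u0 r0; rewrite /level u0 !mul0r add0r.
by rewrite pmulr_llt0 ?invr_gt0// pmulr_llt0//; exact: z_gt0.
Qed.

(** Just above the level [x] the perturbed walk has left for good, so that the
    walk is early there. *)
Lemma last_exit_lower (x e : R) : 0 < e ->
  unlikely P (fun t => [set w | (last_exit xs es (u * t) w <
    (level t x)%:E)%E /\ x + e <= walk_approx t w]).
Proof.
move=> e0; have [[u0 x0]|lev0] := level_ge0 x.
  apply: (unlikelyS _ (unlikely0 _)); near=> t => w /= [+ _].
  have t0 : 0 < t by near: t; exact: nbhs_pinfty_gt.
  move=> /(le_lt_trans (last_exit_ge0 _ _ _ _)); rewrite lte_fin ltNge.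
  by rewrite ltW// level_lt0.
pose p t := Num.truncn (level t x).
have e40 : 0 < e / 4 by rewrite divr_gt0.
have [|uD uE] := near_level (p := p) (r := x) e40.
  near=> t; have l0 : 0 <= level t x by near: t.
  have /andP[h1 h2] := truncn_itv l0; rewrite -natr1 in h2.
  by rewrite ler_norml; apply/andP; split; rewrite /p; lra.
apply: (unlikelyS _ (unlikelyU uD uE)); near=> t => w /= [lrho xW].
have t0 : 0 < t by near: t; exact: nbhs_pinfty_gt.
have l0 : 0 <= level t x by near: t.
have zt0 := z_gt0 t0.
have /andP[h1 h2] := truncn_itv l0.
have Tm : u * t < Tn (p t).+1 w.
  apply: after_last_exit => //; apply: (lt_trans lrho).
  by rewrite lte_fin.
apply: contrapT => /not_orP[/negP + /negP].
rewrite -!ltNge !ltr_norml => /andP[d1 d2] /andP[n1 n2].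
have := zW t0 xW; move: Tm; rewrite /perturbed_walk /= => Tm SW.
have mup : mu * (p t)%:R <= u * t + x * z t by rewrite -mu_level ler_pM2l.
have ze : 0 < e * z t by rewrite mulr_gt0.
by rewrite /dev in d1 d2; lra.
Unshelve. all: by end_near. Qed.

Let reindex (pi : nat -> nat) : injective pi ->
  pairwise_iid P0 P xi (fun i => xs (pi i)).
Proof.
move=> inj_pi; have [mxs ixs lxs] := iidxs; split => [i|i j ij|i] //.
by apply: ixs; rewrite (inj_eq inj_pi).
Qed.

(** The time reversal that turns a maximum over the past into a supremum over
    the future of an identically distributed walk. *)
Let rev_index (M i : nat) : nat := if (i < M)%N then (M - i.+1)%N else i.

Let rev_index_inj M : injective (rev_index M).
Proof. by move=> i j; rewrite /rev_index; do 2 case: ltnP => ?; lia. Qed.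

Let rev_sum M k w : (k <= M)%N ->
  \sum_(0 <= i < k) xs (rev_index M i) w = S M w - S (M - k) w.
Proof.
elim: k => [|k IHk] kM; first by rewrite big_geq// subn0 subrr.
rewrite big_nat_recr//= IHk ?(ltnW kM)// /rev_index kM !random_walk_nat.
have -> : (M - k = (M - k.+1).+1)%N by lia.
by rewrite [in LHS](big_nat_recr (M - k.+1))//=; ring.
Qed.

Let pred_rev M m : (0 < m)%N -> (m <= M)%N ->
  [/\ m.-1 = (M - (M - m).+1)%N, m.-1 = rev_index M (M - m) & (M - m < M)%N].
Proof. by move=> m0 mM; rewrite /rev_index; case: ltnP => ?; split; lia. Qed.

Let pred_shift M m : (M < m)%N -> m.-1 = (M + (m.-1 - M))%N.
Proof. by move=> Mm; rewrite subnKC// -ltnS (ltn_predK Mm). Qed.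

(** A passage at an index [m] before the level [x], where the walk is late by a
    multiple of [sqrt t], means that between [m] and the level the walk has gained
    less than the perturbation at [m]. Seen backwards from the level, such a large
    perturbation or so slow a walk are unlikely. *)
Lemma first_passage_lower (x e : R) : L1 P0 (fun w => Num.max (eta w) 0) ->
  0 < e ->
  unlikely P (fun t => [set w | (first_passage xs es (u * t) w <
    (level t x)%:E)%E /\ x + e <= walk_approx t w]).
Proof.
move=> Leta e0; have [[u0 x0]|lev0] := level_ge0 x.
  apply: (unlikelyS _ (unlikely0 _)); near=> t => w /= [+ _].
  have t0 : 0 < t by near: t; exact: nbhs_pinfty_gt.
  move=> /ltW h; have [m [m1 ml _]] := first_passage_attained h.
  have := level_lt0 t0 u0 x0; rewrite ltNge => /negP; apply.
  by apply: le_trans ml.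
pose p t := Num.truncn (level t x).
have e20 : 0 < e / 2 by rewrite divr_gt0.
have [|uD _] := near_level (p := p) (r := x) e20.
  near=> t; have l0 : 0 <= level t x by near: t.
  have /andP[h1 h2] := truncn_itv l0; rewrite -natr1 in h2.
  by rewrite ler_norml; apply/andP; split; rewrite /p; lra.
move=> delta delta0; have d40 : 0 < delta / 4 by rewrite divr_gt0.
have mu20 : 0 < mu / 2 by rewrite divr_gt0.
have [K1 HK1] := walk_lower P mxi mu_gt0 Exi Lxi2 d40.
have [K2 HK2] := perturbation_upper P meta mu20 Leta d40.
near=> t.
have t0 : 0 < t by near: t; exact: nbhs_pinfty_gt.
have l0 : 0 <= level t x by near: t.
have zt0 := z_gt0 t0.
have zK : 2 * (K1 + K2) / e <= z t by near: t; exact: z_large.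
have D : prob_le P [set w | e / 2 * z t <= `|dev (p t) (n t) w|] (delta / 4).
  by near: t; exact: uD.
have B1 := HK1 _ (reindex (@rev_index_inj (p t))).
have B2 := HK2 (fun i => es (rev_index (p t) i)) (fun i => mes _) (fun i => lawes _).
apply: prob_leS (prob_leU (prob_leU B1 B2) D); last by lra.
move=> w /= [ltau xW].
have [m [m1 ml Tm]] := first_passage_attained (ltW ltau).
have mp : (m <= p t)%N by rewrite truncn_ge_nat.
have /andP[h1 _] := truncn_itv l0.
apply: contrapT => /not_orP[/not_orP[nB1 nB2] /negP].
rewrite -ltNge ltr_norml => /andP[d1 d2].
have [] := pred_rev m1 mp; set l := (p t - m)%N => ml1 ml2 lp.
have b1 : mu / 2 * l.+1%:R - K1 <= S (p t) w - S m.-1 w.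
  rewrite ml1 -rev_sum//.
  by rewrite leNgt; apply/negP => h; apply: nB1; exists l.+1.
have b2 : es m.-1 w <= mu / 2 * l%:R + K2.
  rewrite ml2.
  by rewrite leNgt; apply/negP => h; apply: nB2; exists l.
have := zW t0 xW; move: Tm; rewrite /perturbed_walk => Tm SW.
have mup : mu * (p t)%:R <= u * t + x * z t by rewrite -mu_level ler_pM2l.
have ze : 2 * (K1 + K2) <= e * z t by rewrite [leRHS]mulrC -ler_pdivrMr.
rewrite -[l.+1%:R]natr1 in b1; rewrite /dev in d1 d2.
have : u * t - K1 - K2 < S (p t) w by lra.
by move=> ?; lra.
Unshelve. all: by end_near. Qed.

(** A visit after the level [x + e], where the walk is early, means that the walk
    has gained less since the level than a negative perturbation takes back. *)
Lemma last_exit_upper (x e : R) : L1 P0 (fun w => Num.max (- eta w) 0) ->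
  0 < e ->
  unlikely P (fun t => [set w | ((level t (x + e))%:E <
    last_exit xs es (u * t) w)%E /\ walk_approx t w <= x]).
Proof.
move=> Leta e0; have [[u0 x0]|ux] := pselect (u = 0 /\ x < 0).
  apply: (unlikelyS _ (unlikely0 _)); apply: nearW => t w /= [_].
  by rewrite (walk_approx_u0 t w u0) leNgt x0.
have lev0 : \forall t \near +oo, 0 <= level t (x + e).
  apply: level_large; have [u0|u0] := ltP 0 u; [by left|right].
  have /ltr_wpDl : 0 <= x; last exact.
  rewrite leNgt; apply/negP => x0; apply: ux; split => //.
  by apply/eqP; rewrite eq_le u0 u_ge0.
pose p t := Num.truncn (level t (x + e)).
have e20 : 0 < e / 2 by rewrite divr_gt0.
have [|uD _] := near_level (p := p) (r := x + e) e20.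
  near=> t; have l0 : 0 <= level t (x + e) by near: t.
  have /andP[h1 h2] := truncn_itv l0; rewrite -natr1 in h2.
  by rewrite ler_norml; apply/andP; split; rewrite /p; lra.
move=> delta delta0; have d40 : 0 < delta / 4 by rewrite divr_gt0.
have mu20 : 0 < mu / 2 by rewrite divr_gt0.
have mN : measurable_fun setT (fun y : R => - y) by exact: oppr_measurable.
have [K1 HK1] := walk_lower P mxi mu_gt0 Exi Lxi2 d40.
have [K2 HK2] := perturbation_upper P (measurableT_comp mN meta) mu20 Leta d40.
near=> t.
have t0 : 0 < t by near: t; exact: nbhs_pinfty_gt.
have l0 : 0 <= level t (x + e) by near: t.
have zt0 := z_gt0 t0.
have zK : 2 * (K1 + K2 + mu) / e <= z t by near: t; exact: z_large.
have D : prob_le P [set w | e / 2 * z t <= `|dev (p t) (n t) w|] (delta / 4).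
  by near: t; exact: uD.
have B1 := HK1 _ (reindex (@addnI (p t))).
have B2 : prob_le P [set w | exists l : nat,
    mu / 2 * l%:R + K2 < - es (p t + l) w] (delta / 4).
  apply: (HK2 (fun i w => - es (p t + i) w)).
    by move=> i; exact: (measurableT_comp mN (mes _)).
  move=> i A mA; apply: (lawes _ (A := -%R @^-1` A)).
  by rewrite -[X in measurable X]setTI; exact: mN.
apply: prob_leS (prob_leU (prob_leU B1 B2) D); last by lra.
move=> w /= [lrho Wx].
have [m [m1 ml Tm]] := last_exit_approached l0 lrho.
have /andP[_ h2] := truncn_itv l0.
have pm : (p t < m)%N by rewrite truncn_lt_nat.
apply: contrapT => /not_orP[/not_orP[nB1 nB2] /negP].
rewrite -ltNge ltr_norml => /andP[d1 d2].
pose l := (m.-1 - p t)%N.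
have ml' : m.-1 = (p t + l)%N by exact: pred_shift.
have b1 : mu / 2 * l%:R - K1 <= S m.-1 w - S (p t) w.
  have -> : S m.-1 w - S (p t) w = \sum_(0 <= i < l) xs (p t + i) w.
    rewrite !random_walk_nat ml' (@big_cat_nat _ _ _ (p t) 0 (p t + l))//= ?leq_addr//.
    rewrite addrAC subrr add0r -{1}[p t]add0n big_addn addKn.
    by apply: eq_bigr => i _; rewrite addnC.
  by rewrite leNgt; apply/negP => h; apply: nB1; exists l.
have b2 : - es m.-1 w <= mu / 2 * l%:R + K2.
  rewrite ml'.
  by rewrite leNgt; apply/negP => h; apply: nB2; exists l.
have := Wz t0 Wx; move: Tm; rewrite /perturbed_walk => Tm SW.
have mup : u * t + (x + e) * z t < mu * ((p t)%:R + 1).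
  by rewrite -mu_level ltr_pM2l// natr1.
have ze : 2 * (K1 + K2 + mu) <= e * z t by rewrite [leRHS]mulrC -ler_pdivrMr.
rewrite /dev in d1 d2.
have : S (p t) w <= u * t + K1 + K2 by lra.
by move=> ?; lra.
Unshelve. all: by end_near. Qed.

End passage_limit.

(** * The three processes and the walk approximation are close in probability *)

Section grid.
Context (R : realType) (d : measure_display) (Om : measurableType d).
Variable P : probability Om R.

(** A comparison with the tight family [W] only has to be checked at finitely
    many deterministic levels. *)
Lemma unlikely_grid (U : R -> R -> set Om) (W : R -> Om -> R) :
  (forall t r r' w, r' <= r -> U t r w -> U t r' w) ->
  (forall x e : R, 0 < e ->
    unlikely P (fun t => [set w | U t (x + e) w /\ W t w <= x])) ->
  (forall delta : R, 0 < delta -> exists K : R,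
    \forall t \near +oo, prob_le P [set w | K <= `|W t w|] delta) ->
  forall e : R, 0 < e -> unlikely P (fun t => [set w | U t (W t w + e) w]).
Proof.
move=> Uanti HU tight e e0 delta delta0.
have d20 : 0 < delta / 2 by rewrite divr_gt0.
have e20 : 0 < e / 2 by rewrite divr_gt0.
have [K HK] := tight _ d20.
pose x (i : nat) := - K + i%:R * (e / 2).
pose n := (Num.truncn (2 * K / (e / 2))).+2.
have Hgrid := unlikely_bigcup n (fun i => HU (x i) _ e20).
near=> t.
have h1 : prob_le P [set w | K <= `|W t w|] (delta / 2) by near: t.
have h2 : prob_le P (\bigcup_(i < n) [set w | U t (x i + e / 2) w /\ W t w <= x i]) (delta / 2).
  by near: t; exact: Hgrid.
rewrite (splitr delta); apply: prob_leS (prob_leU h1 h2) => // w /= Uw.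
have [KW|WK] := leP K `|W t w|; [by left|right].
move: WK; rewrite ltr_norml => /andP[W1 W2].
pose y := (W t w + K) / (e / 2).
have y0 : 0 <= y by rewrite divr_ge0 ?(ltW e20)//; lra.
have yK : y <= 2 * K / (e / 2) by rewrite ler_wpM2r ?invr_ge0 ?(ltW e20)//; lra.
have /andP[t1 t2] := truncn_itv y0.
have yE : W t w = - K + y * (e / 2) by rewrite /y divfK ?lt0r_neq0//; ring.
exists (Num.truncn y).+1; first by rewrite /= /n !ltnS le_truncn.
split; last by rewrite yE /x lerD2l ler_pM2r// ltW.
apply: Uanti Uw; rewrite [in leRHS]yE /x -natr1 mulrDl mul1r.
have : (Num.truncn y)%:R * (e / 2) <= y * (e / 2) by rewrite ler_pM2r.
lra.
Unshelve. all: by end_near. Qed.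

End grid.

Definition close_in_prob (R : realType) (d : measure_display) (Om : measurableType d)
    (P : probability Om R) (Z : R -> Om -> \bar R) (W : R -> Om -> R) : Prop :=
  forall e : R, 0 < e -> unlikely P (fun t =>
    [set w | ~ ((W t w - e)%:E <= Z t w <= (W t w + e)%:E)%E]).

Section closeness.
Context (R : realType) (d0 d : measure_display).
Context (Om0 : measurableType d0) (Om : measurableType d).
Variables (P0 : probability Om0 R) (P : probability Om R).
Variables (xi eta : Om0 -> R) (xs es : nat -> Om -> R) (mu sigma2 : R).
Hypotheses (mu_gt0 : 0 < mu) (sigma2_gt0 : 0 < sigma2).
Hypotheses (mxi : measurable_fun setT xi) (Exi : mean P0 xi = mu).
Hypothesis (Lxi2 : L1 P0 (fun w => xi w ^+ 2)).
Hypothesis (Vxi : mean P0 (fun w => (xi w - mu) ^+ 2) = sigma2).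
Hypothesis (iidxs : pairwise_iid P0 P xi xs).
Hypothesis (meta : measurable_fun setT eta).
Hypothesis (mes : forall i, measurable_fun setT (es i)).
Hypothesis (lawes : forall i, same_law P P0 (es i) eta).
Variable u : R.
Hypothesis u_ge0 : 0 <= u.

Local Notation W := (walk_approx xs mu sigma2 u).
Local Notation lev := (level mu sigma2 u).

Let z (t : R) := (scale mu sigma2 t)^-1.

Let rescaled_lt (V : R -> Om -> \bar R) (t r : R) w : 0 < t ->
  (r%:E < rescaled mu sigma2 V t u w)%E = ((lev t r)%:E < V (u * t)%R w)%E /\
  (rescaled mu sigma2 V t u w < r%:E)%E = (V (u * t)%R w < (lev t r)%:E)%E.
Proof.
move=> t0; rewrite /rescaled.
have c0 : 0 < Num.sqrt (sigma2 * mu ^- 3 * t).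
  by rewrite sqrtr_gt0 mulr_gt0// mulr_gt0// invr_gt0 exprn_gt0.
have cE : (scale mu sigma2 t)^-1 / mu = Num.sqrt (sigma2 * mu ^- 3 * t).
  rewrite /scale invrK -{2}[mu]gtr0_norm// -sqrtr_sqr -sqrtrV ?sqr_ge0//.
  rewrite -sqrtrM ?divr_ge0 ?mulr_ge0 ?(ltW mu_gt0) ?(ltW t0) ?(ltW sigma2_gt0)//.
  by congr Num.sqrt; field; rewrite lt0r_neq0.
have levE : lev t r = mu^-1 * (u * t) + r * Num.sqrt (sigma2 * mu ^- 3 * t).
  by rewrite /level -[r * _ / _]mulrA cE [_ / mu]mulrC.
rewrite levE; move: (Num.sqrt _) c0 => c c0.
case: (V (u * t) w) => [v| |].
- rewrite -EFinB -EFinM !lte_fin ltr_pdivlMr// ltr_pdivrMr//.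
  by rewrite ltrBrDl ltrBlDl.
- by rewrite addye// gt0_mulye ?lte_fin ?invr_gt0// !ltry !ltNge !leey.
- by rewrite addNye// gt0_mulNye ?lte_fin ?invr_gt0// !ltNyr !ltNge !leNye.
Qed.

Let level_mono (t r r' : R) : r' <= r -> lev t r' <= lev t r.
Proof.
move=> rr'; rewrite /level lerD2l -!mulrA ler_wpM2r// divr_ge0 ?(ltW mu_gt0)//.
by rewrite invr_ge0 /scale invr_ge0 sqrtr_ge0.
Qed.

(** Being above a level is antitone in the level, so that the comparisons at
    fixed levels give a comparison at the random level [W]. *)
Let above (V : R -> Om -> \bar R) :
  (forall x e : R, 0 < e -> unlikely P (fun t =>
    [set w | ((lev t (x + e))%:E < V (u * t)%R w)%E /\ W t w <= x])) ->
  forall e : R, 0 < e -> unlikely P (fun t =>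
    [set w | ((lev t (W t w + e))%:E < V (u * t)%R w)%E]).
Proof.
move=> HV; apply: (unlikely_grid (U := fun t r => [set w | ((lev t r)%:E < V (u * t)%R w)%E])) => //.
  move=> t r r' w rr' /=; apply: le_lt_trans.
  by rewrite lee_fin level_mono.
by move=> delta; exact: (walk_approx_tight mu_gt0 sigma2_gt0 mxi Exi Lxi2 Vxi iidxs u_ge0).
Qed.

Let below (V : R -> Om -> \bar R) :
  (forall x e : R, 0 < e -> unlikely P (fun t =>
    [set w | (V (u * t)%R w < (lev t x)%:E)%E /\ x + e <= W t w])) ->
  forall e : R, 0 < e -> unlikely P (fun t =>
    [set w | (V (u * t)%R w < (lev t (W t w - e))%:E)%E]).
Proof.
move=> HV e e0.
have := @unlikely_grid _ _ _ P
  (fun t r => [set w | (V (u * t)%R w < (lev t (- r))%:E)%E])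
  (fun t w => - W t w) _ _ _ e e0.
have -> : (fun t => [set w | (V (u * t)%R w < (lev t (W t w - e))%:E)%E]) =
    (fun t => [set w | (V (u * t)%R w < (lev t (- (- W t w + e)))%:E)%E]).
  by apply/funext => t; apply/seteqP; split => w /=; rewrite opprD opprK.
apply.
- move=> t r r' w rr' /= /lt_le_trans; apply.
  by rewrite lee_fin level_mono// lerN2.
- move=> x e' e'0; apply: (unlikelyS _ (HV (- x - e') e' e'0)).
  apply: nearW => t w /= [h1 h2]; rewrite opprD in h1; split => //.
  by rewrite subrK lerNl.
move=> delta delta0.
have [K HK] := walk_approx_tight mu_gt0 sigma2_gt0 mxi Exi Lxi2 Vxi iidxs u_ge0 delta0.
exists K; near=> t.
have : prob_le P [set w | K <= `|W t w|] delta by near: t.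
by apply: prob_leS => // w /=; rewrite normrN.
Unshelve. all: by end_near. Qed.

Let close_of (V : R -> Om -> \bar R) :
  (forall e : R, 0 < e -> unlikely P (fun t =>
    [set w | ((lev t (W t w + e))%:E < V (u * t)%R w)%E])) ->
  (forall e : R, 0 < e -> unlikely P (fun t =>
    [set w | (V (u * t)%R w < (lev t (W t w - e))%:E)%E])) ->
  close_in_prob P (fun t => rescaled mu sigma2 V t u) W.
Proof.
move=> HA HB e e0; apply: (unlikelyS _ (unlikelyU (HA e e0) (HB e e0))).
near=> t => w /= /negP; rewrite negb_and -!ltNge => /orP h.
have t0 : 0 < t by near: t; exact: nbhs_pinfty_gt.
have [E1 _] := rescaled_lt V (W t w + e) w t0.
have [_ E2] := rescaled_lt V (W t w - e) w t0.
by rewrite -E1 -E2; case: h; [right|left].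
Unshelve. all: by end_near. Qed.

Let above_last_exit : L1 P0 (fun w => Num.max (- eta w) 0) ->
  forall e : R, 0 < e -> unlikely P (fun t =>
    [set w | ((lev t (W t w + e))%:E < last_exit xs es (u * t)%R w)%E]).
Proof.
move=> Leta; apply: above => x e e0.
exact: (last_exit_upper mu_gt0 sigma2_gt0 mxi Exi Lxi2 Vxi iidxs meta mes lawes).
Qed.

Let below_first_passage : L1 P0 (fun w => Num.max (eta w) 0) ->
  forall e : R, 0 < e -> unlikely P (fun t =>
    [set w | (first_passage xs es (u * t)%R w < (lev t (W t w - e))%:E)%E]).
Proof.
move=> Leta; apply: below => x e e0.
exact: (first_passage_lower mu_gt0 sigma2_gt0 mxi Exi Lxi2 Vxi iidxs meta mes lawes).
Qed.

Lemma close_first_passage : L1 P0 (fun w => Num.max (eta w) 0) ->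
  close_in_prob P (fun t => rescaled mu sigma2 (first_passage xs es) t u) W.
Proof.
move=> Leta; apply: close_of; last exact: below_first_passage.
apply: above => x e e0.
exact: (first_passage_upper mu_gt0 sigma2_gt0 mxi Exi Lxi2 Vxi iidxs meta mes lawes).
Qed.

Lemma close_last_exit : L1 P0 (fun w => Num.max (- eta w) 0) ->
  close_in_prob P (fun t => rescaled mu sigma2 (last_exit xs es) t u) W.
Proof.
move=> Leta; apply: close_of; first exact: above_last_exit.
apply: below => x e e0.
exact: (last_exit_lower mu_gt0 sigma2_gt0 mxi Exi Lxi2 Vxi iidxs meta mes lawes).
Qed.

(** The number of visits is squeezed between the two other processes, up to a
    unit that the rescaling makes negligible. *)
Lemma close_nb_visits :
  L1 P0 (fun w => Num.max (eta w) 0) -> L1 P0 (fun w => Num.max (- eta w) 0) ->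
  close_in_prob P (fun t => rescaled mu sigma2 (nb_visits xs es) t u) W.
Proof.
move=> Lp Ln; apply: close_of => e e0.
  apply: (unlikelyS _ (above_last_exit Ln e0)); apply: nearW => t w /= /lt_le_trans.
  by apply; exact: nb_visits_le_last_exit.
have e20 : 0 < e / 2 by rewrite divr_gt0.
apply: (unlikelyS _ (below_first_passage Lp e20)); near=> t => w /= Nlt.
have t0 : 0 < t by near: t; exact: nbhs_pinfty_gt.
have zZ : 2 * mu / e <= z t by near: t; exact: scale_inv_large.
apply: (le_lt_trans (first_passage_le_nb_visits _ _ _ _)).
apply: (@lt_le_trans _ _ ((lev t (W t w - e))%:E + 1)%E).
  by rewrite lteD2rE.
rewrite -EFinD lee_fin /level -/(z t).
have : 1 <= e / 2 * z t / mu.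
  by move: zZ; rewrite ler_pdivrMr// ler_pdivlMr// => ?; lra.
have -> : (W t w - e / 2) * z t / mu = (W t w - e) * z t / mu + e / 2 * z t / mu by field; rewrite lt0r_neq0.
by lra.
Unshelve. all: by end_near. Qed.

End closeness.

(** * Continuous functions of a random matrix *)

Section matrix_functions.
Context (R : realType) (m k : nat) (g : 'M[R]_(m, k) -> R).
Hypothesis cg : continuous g.

Let mx_continuous (A : 'M[R]_(m, k)) (e : R) : 0 < e -> exists2 rho : R, 0 < rho &
  forall B : 'M[R]_(m, k), (forall i j, `|A i j - B i j| < rho) -> `|g A - g B| < e.
Proof.
move=> e0; have /cvgrPdist_lt/(_ e e0)/nbhs_ballP[rho /= rho0 H] : g @ A --> g A by exact: cg.
by exists rho => // B AB; apply: H; split.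
Qed.

(** Cubes are compact, once matrices are unrolled into row vectors. *)
Lemma matrix_unif_continuous (K e : R) : 0 < e -> exists2 rho : R, 0 < rho &
  forall A B : 'M[R]_(m, k), (forall i j, `|A i j| <= K) ->
    (forall i j, `|A i j - B i j| <= rho) -> `|g A - g B| <= e.
Proof.
move=> e0; have e20 : 0 < e / 2 by rewrite divr_gt0.
pose box := [set v : 'rV[R]_(m * k) | forall i, `[- K, K]%classic (v ord0 i)].
have /compact_near_coveringP cbox : compact box.
  by apply: (rV_compact (A := fun=> `[- K, K]%classic)) => i; exact: segment_compact.
pose Q (rho : R) (v : 'rV[R]_(m * k)) := forall B : 'M[R]_(m, k),
  (forall i j, `|vec_mx v i j - B i j| <= rho) -> `|g (vec_mx v) - g B| <= e.
have [v _|rho0 /= rho00 H] := cbox R 0^'+ Q _.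
  have [rho rho0 H] := mx_continuous (vec_mx v) e20.
  have rho20 : 0 < rho / 2 by rewrite divr_gt0.
  exists ([set v' | ball v (rho / 2) v'], [set d | d < rho / 2]).
    split => /=; first exact: nbhsx_ballx.
    exact: nbhs_right_lt.
  move=> [v' d] /= [[_ vv'] drho] B v'B.
  have vv'2 i j : `|vec_mx v i j - vec_mx v' i j| < rho / 2.
    by rewrite !mxE; exact: vv'.
  have h1 : `|g (vec_mx v) - g (vec_mx v')| < e / 2.
    by apply: H => i j; apply: lt_trans (vv'2 i j) _; rewrite ltr_pdivrMr// ltr_pMr// ltr1n.
  have h2 : `|g (vec_mx v) - g B| < e / 2.
    apply: H => i j; rewrite (splitr rho).
    apply: le_lt_trans (ler_distD (vec_mx v' i j) _ _) _.
    by rewrite ltrD// (le_lt_trans (v'B i j)).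
  rewrite (splitr e); apply: le_trans (ler_distD (g (vec_mx v)) _ _) _.
  by rewrite lerD ?(ltW h2)// distrC ltW.
exists (rho0 / 2) => [|A B AK AB]; first by rewrite divr_gt0.
have r20 : 0 < rho0 / 2 by rewrite divr_gt0.
have boxQ : box `<=` Q (rho0 / 2).
  apply: H => //=; rewrite distrC subr0 gtr0_norm//.
  by rewrite ltr_pdivrMr// ltr_pMr// ltr1n.
have := boxQ (mxvec A); rewrite /Q mxvecK; apply=> //.
- move=> i /=; rewrite in_itv/= -ler_norml.
  by case: (mxvec_indexP i) => i' j'; rewrite mxvecE.
Qed.

(** An open set of matrices is a countable union of balls with rational
    centers, and the entries tell whether the matrix is in such a ball. *)
Lemma measurable_continuous_matrix (d : measure_display) (T : measurableType d)
    (h : 'I_m -> 'I_k -> T -> R) :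
  (forall i j, measurable_fun setT (h i j)) ->
  measurable_fun setT (fun w => g (\matrix_(i, j) h i j w)).
Proof.
move=> mh; apply: (measurability _ (RGenOInfty.measurableE R)).
move=> _ [_ [x ->] <-]; rewrite setTI.
pose r (n : nat) : R := n.+1%:R^-1.
pose near_center (p : 'M[rat]_(m, k) * nat) : set T :=
  \bigcap_(ij in [set: 'I_m * 'I_k])
    [set w | `|ratr (p.1 ij.1 ij.2) - h ij.1 ij.2 w| < r p.2].
pose inside (p : 'M[rat]_(m, k) * nat) : Prop := forall B : 'M[R]_(m, k),
  (forall i j, `|ratr (p.1 i j) - B i j| < r p.2) -> x < g B.
rewrite (_ : _ @^-1` _ = \bigcup_(p in [set: 'M[rat]_(m, k) * nat])
    (if pselect (inside p) then near_center p else set0)).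
  apply: countable_bigcupT_measurable => // p; case: (pselect (inside p)) => [ip|nip]; last first.
    exact: measurable0.
  apply: fin_bigcap_measurable => // -[i j] _ /=.
  rewrite (_ : mkset _ = (fun w => `|ratr (p.1 i j) - h i j w|) @^-1` `]-oo, r p.2[).
    rewrite -[X in measurable X]setTI; apply: measurableT_comp => //.
    exact: measurable_funB.
  by apply/seteqP; split => w /=; rewrite in_itv.
apply/seteqP; split => w /=; last first.
  move=> [p _]; case: (pselect (inside p)) => //= Ip pw; rewrite in_itv/= andbT.
  by apply: Ip => i j; rewrite mxE; exact: (pw (i, j)).
rewrite in_itv/= andbT => xg.
set A := \matrix_(i, j) h i j w in xg *.
have [rho rho0 H] : exists2 rho : R, 0 < rho &
    forall B : 'M[R]_(m, k), (forall i j, `|A i j - B i j| < rho) -> x < g B.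
  have gx0 : 0 < g A - x by rewrite subr_gt0.
  have [rho rho0 H] := mx_continuous A gx0.
  by exists rho => // B /H; rewrite ltr_norml => /andP[_]; rewrite ltrD2l ltrN2.
have [n _ /(_ n (leqnn n)) /= nrho] : \forall n \near \oo, r n < rho / 2.
  by apply: (cvgr_lt 0 (@cvg_harmonic R)); rewrite divr_gt0.
have [f Hf] : {f : 'I_m -> 'I_k -> rat & forall i j, `|ratr (f i j) - A i j| < r n}.
  have ex i j : {q : rat | `|ratr q - A i j| < r n}.
    apply: cid; have rn0 : 0 < r n by rewrite invr_gt0.
    have [|q] := @rat_in_itvoo R (A i j - r n) (A i j + r n).
      by rewrite ltrD2l gtrN.
    by rewrite in_itv/= => /andP[h1 h2]; exists q; rewrite ltr_norml; lra.
  by exists (fun i j => sval (ex i j)) => i j; exact: svalP (ex i j).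
exists (\matrix_(i, j) f i j, n) => //; case: (pselect _) => /= [_ [i j] _|].
  by rewrite mxE; have := Hf i j; rewrite mxE.
case => B hB; apply: H => i j; rewrite (splitr rho).
apply: le_lt_trans (ler_distD (ratr (f i j)) _ _) _; apply: ltrD.
  by rewrite distrC (lt_trans (Hf i j)).
by apply: lt_trans nrho; have := hB i j; rewrite mxE.
Qed.

End matrix_functions.

(** * Approximation by sums of product functions *)

Section spline_approx.
Context (R : realType) (I : finType) (delta : R) (M : nat).
Hypothesis delta_gt0 : 0 < delta.

Definition spline_node (nu : {ffun I -> 'I_(M + M)}) (q : I) : R :=
  delta * ((nu q)%:R - M%:R).

Definition spline_factor (i : 'I_(M + M)) (y : R) : R :=
  bspline (delta^-1 * y + (M%:R - i%:R)).

(** The splines form a partition of unity over the cube of half-width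
    [(M - 3) * delta]; sampling [G] at the nodes approximates it there by a
    combination of products of functions of a single coordinate. *)
Definition spline_approx (G : (I -> R) -> R) (x : I -> R) : R :=
  \sum_(nu : {ffun I -> 'I_(M + M)})
    G (spline_node nu) * \prod_q spline_factor (nu q) (x q).

Let weight_ge0 nu (x : I -> R) : 0 <= \prod_q spline_factor (nu q) (x q).
Proof. by apply: prodr_ge0 => q _; exact: bspline_ge0. Qed.

Let sum_factor y : \sum_i spline_factor i y =
  ramp (delta^-1 * y + M%:R) - ramp (delta^-1 * y - M%:R).
Proof.
have := sum_bspline (- M%:R) (M + M) (delta^-1 * y).
rewrite opprK natrD => E; rewrite -[X in ramp _ - ramp X](_ : delta^-1 * y + M%:R - (M%:R + M%:R) = _).
  by rewrite -E; apply: eq_bigr => i _; rewrite /spline_factor addrA.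
by rewrite opprD addrA addrK.
Qed.

Let sum_weight (x : I -> R) :
  \sum_(nu : {ffun I -> 'I_(M + M)}) \prod_q spline_factor (nu q) (x q) =
  \prod_q (ramp (delta^-1 * x q + M%:R) - ramp (delta^-1 * x q - M%:R)).
Proof.
rewrite -(bigA_distr_bigA (fun q i => spline_factor i (x q))).
by apply: eq_bigr => q _; exact: sum_factor.
Qed.

Let sum_weight_le1 (x : I -> R) :
  \sum_(nu : {ffun I -> 'I_(M + M)}) \prod_q spline_factor (nu q) (x q) <= 1.
Proof.
rewrite sum_weight; apply: prodr_ile1 => q _; rewrite -sum_factor; apply/andP; split.
  by apply: sumr_ge0 => i _; exact: bspline_ge0.
rewrite sum_factor.
have /andP[h1 h2] := ramp_itv (delta^-1 * x q + M%:R).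
have /andP[h3 h4] := ramp_itv (delta^-1 * x q - M%:R).
by lra.
Qed.

Lemma spline_approx_bounded G (C : R) x : (forall y, `|G y| <= C) ->
  `|spline_approx G x| <= C.
Proof.
move=> GC; have C0 : 0 <= C := le_trans (normr_ge0 _) (GC x).
apply: (le_trans (ler_norm_sum _ _ _)).
apply: (@le_trans _ _ (C * \sum_(nu : {ffun I -> 'I_(M + M)}) \prod_q spline_factor (nu q) (x q))).
  rewrite mulr_sumr; apply: ler_sum => nu _.
  by rewrite normrM [X in _ * X]ger0_norm// ler_wpM2r.
by rewrite -[leRHS]mulr1 ler_wpM2l.
Qed.

Lemma spline_approx_close G (e K : R) x : K + 3 * delta <= M%:R * delta ->
  (forall q, `|x q| <= K) ->
  (forall a : I -> R, (forall q, `|x q - a q| <= 4 * delta) -> `|G x - G a| <= e) ->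
  `|G x - spline_approx G x| <= e.
Proof.
move=> KM xK Ge.
have sum1 : \sum_(nu : {ffun I -> 'I_(M + M)}) \prod_q spline_factor (nu q) (x q) = 1.
  rewrite sum_weight big1// => q _.
  have /andP[h1 h2] : - K <= x q <= K by rewrite -ler_norml.
  have xE : x q = delta * (delta^-1 * x q) by rewrite mulrA divff ?mul1r ?lt0r_neq0.
  rewrite [M%:R * _]mulrC in KM; rewrite ramp_ge3 ?ramp_le0 ?subr0//.
    rewrite -(ler_pM2l delta_gt0) mulrBr mulr0 -xE subr_le0 (le_trans h2)//.
    by apply: le_trans KM; rewrite lerDl mulr_ge0// ltW.
  rewrite -(ler_pM2l delta_gt0) [X in _ <= X]mulrDr -xE -lerBlDl [delta * 3]mulrC.
  by apply: le_trans KM; rewrite addrC lerD2r lerNl.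
have -> : G x - spline_approx G x = \sum_(nu : {ffun I -> 'I_(M + M)})
    (G x - G (spline_node nu)) * \prod_q spline_factor (nu q) (x q).
  rewrite (eq_bigr _ (fun nu _ => mulrBl _ _ _)) sumrB -mulr_sumr.
  by rewrite sum1 mulr1.
apply: (le_trans (ler_norm_sum _ _ _)); rewrite -[leRHS]mulr1 -[in leRHS]sum1.
rewrite mulr_sumr; apply: ler_sum => nu _.
rewrite normrM [X in _ * X]ger0_norm//.
have [/existsP[q /eqP q0]|/existsPn far] :=
  boolP [exists q, spline_factor (nu q) (x q) == 0].
  by rewrite (bigD1 q)//= q0 mul0r !mulr0.
rewrite ler_wpM2r//; apply: Ge => q.
have xE : x q = delta * (delta^-1 * x q) by rewrite mulrA divff ?mul1r ?lt0r_neq0.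
have [l0|l0] := leP (delta^-1 * x q + (M%:R - (nu q)%:R)) 0.
  by have := far q; rewrite /spline_factor bspline_support ?eqxx//; left.
have [l4|l4] := leP 4 (delta^-1 * x q + (M%:R - (nu q)%:R)).
  by have := far q; rewrite /spline_factor bspline_support ?eqxx//; right.
rewrite {1}xE /spline_node -mulrBr normrM gtr0_norm// [leRHS]mulrC ler_pM2l//.
by rewrite ler_norml; apply/andP; split; lra.
Qed.

Lemma taylor2_spline_factor : exists K : R, forall i, taylor2 K (spline_factor i).
Proof.
have [K HK] := taylor2_affine delta^-1 (taylor2_bspline R).
by exists K => i; exact: HK.
Qed.

End spline_approx.

Section mean_spline_approx.
Context (R : realType) (I : finType) (delta : R) (M : nat) (G : (I -> R) -> R).

Let measurable_factor (i : 'I_(M + M)) : measurable_fun setT (spline_factor delta i).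
Proof.
have [K HK] := taylor2_spline_factor delta M.
by case: (taylor2_bounded (HK i)).
Qed.

Let measurable_weight (d : measure_display) (T : measurableType d)
    (Z : I -> T -> R) (nu : {ffun I -> 'I_(M + M)}) :
  (forall q, measurable_fun setT (Z q)) ->
  measurable_fun setT (fun w => \prod_q spline_factor delta (nu q) (Z q w)).
Proof. by move=> mZ; apply: measurable_prod => q _; exact: measurableT_comp. Qed.

Lemma measurable_spline_approx (d : measure_display) (T : measurableType d)
    (Z : I -> T -> R) : (forall q, measurable_fun setT (Z q)) ->
  measurable_fun setT (fun w => spline_approx delta M G (Z ^~ w)).
Proof.
move=> mZ; apply: measurable_sum => nu; apply: measurable_funM => //.
exact: measurable_weight.
Qed.

(** Convergence of the means of products of smooth functions of the coordinates
    passes to spline approximations, which are linear combinations of such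
    products. *)
Lemma mean_spline_approx_cvg (d d' : measure_display)
    (Om : measurableType d) (Om' : measurableType d')
    (P : probability Om R) (P' : probability Om' R)
    (D : R -> I -> Om -> R) (D' : I -> Om' -> R) :
  (forall t q, measurable_fun setT (D t q)) ->
  (forall q, measurable_fun setT (D' q)) ->
  (forall (f : I -> R -> R) (K : R), (forall q, taylor2 K (f q)) ->
    mean P (fun w => \prod_q f q (D t q w)) @[t --> +oo] -->
    mean P' (fun w => \prod_q f q (D' q w))) ->
  mean P (fun w => spline_approx delta M G (D t ^~ w)) @[t --> +oo] -->
  mean P' (fun w => spline_approx delta M G (D' ^~ w)).
Proof.
move=> mD mD' HD; have [K HK] := taylor2_spline_factor delta M.
have bK (i : 'I_(M + M)) y : `|spline_factor delta i y| <= K by case: (taylor2_bounded (HK i)).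
have L1prod (dT : measure_display) (T : measurableType dT) (Q : probability T R)
    (Z : I -> T -> R) (nu : {ffun I -> 'I_(M + M)}) : (forall q, measurable_fun setT (Z q)) ->
    L1 Q (fun w => \prod_q spline_factor delta (nu q) (Z q w)).
  move=> mZ; apply: (@bounded_L1 _ _ _ _ _ (\prod_(q : I) K)).
    exact: measurable_weight.
  by move=> w; rewrite normr_prod; apply: ler_prod => q _; rewrite normr_ge0/=.
have E (dT : measure_display) (T : measurableType dT) (Q : probability T R)
    (Z : I -> T -> R) : (forall q, measurable_fun setT (Z q)) ->
    mean Q (fun w => spline_approx delta M G (Z ^~ w)) =
    \sum_(nu : {ffun I -> 'I_(M + M)}) G (spline_node delta nu) *
      mean Q (fun w => \prod_q spline_factor delta (nu q) (Z q w)).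
  move=> mZ; rewrite mean_sum; last by move=> nu; apply: L1Z; exact: L1prod.
  by apply: eq_bigr => nu _; exact/meanZ/L1prod.
rewrite E//; under eq_fun do rewrite E//.
have H (s : seq {ffun I -> 'I_(M + M)}) :
    \sum_(nu <- s) G (spline_node delta nu) *
      mean P (fun w => \prod_q spline_factor delta (nu q) (D t q w)) @[t --> +oo] -->
    \sum_(nu <- s) G (spline_node delta nu) *
      mean P' (fun w => \prod_q spline_factor delta (nu q) (D' q w)); last exact: H.
elim: s => [|nu s IHs].
  under eq_fun do rewrite big_nil; rewrite big_nil; exact: cvg_cst.
under eq_fun do rewrite big_cons; rewrite big_cons.
apply: cvgD => //; apply: cvgM; first exact: cvg_cst.
by apply: (HD (fun q => spline_factor delta (nu q)) K) => q.
Qed.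

End mean_spline_approx.

(** * Convergence of the distribution of a matrix of sums of increments *)

Section finite_families.
Context (R : realType) (d : measure_display) (Om : measurableType d).
Variable P : probability Om R.

Lemma unlikely_exists (I : finType) (Q : I -> R -> set Om) :
  (forall i, unlikely P (Q i)) ->
  unlikely P (fun t => [set w | exists i, Q i t w]).
Proof.
move=> uQ; have H (s : seq I) :
    unlikely P (fun t => [set w | exists2 i, i \in s & Q i t w]).
  elim: s => [|i s IHs].
    by apply: (unlikelyS _ (@unlikely0 _ _ _ P)); apply: nearW => t w [].
  apply: (unlikelyS _ (unlikelyU (uQ i) IHs)); apply: nearW => t w [j].
  by rewrite inE => /predU1P[->|js] Qw; [left|right; exists j].
apply: (unlikelyS _ (H (enum I))); apply: nearW => t w [i Qw].
by exists i => //; rewrite mem_enum.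
Qed.

Lemma tight_exists (I : finType) (V : R -> I -> Om -> R) :
  (forall q (delta : R), 0 < delta -> exists K : R,
    \forall t \near +oo, prob_le P [set w | K <= `|V t q w|] delta) ->
  forall delta : R, 0 < delta -> exists K : R,
    \forall t \near +oo, prob_le P [set w | exists q, K <= `|V t q w|] delta.
Proof.
move=> tV; have H (s : seq I) : forall delta : R, 0 < delta -> exists K : R,
    \forall t \near +oo, prob_le P [set w | exists2 q, q \in s & K <= `|V t q w|] delta.
  elim: s => [|q s IHs] delta delta0.
    exists 0; apply: nearW => t.
    by apply: prob_leS (prob_le0 P (ltW delta0)) => // w [].
  have d20 : 0 < delta / 2 by rewrite divr_gt0.
  have [K1 HK1] := tV q _ d20; have [K2 HK2] := IHs _ d20.
  exists (Num.max K1 K2); near=> t.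
  have h1 : prob_le P [set w | K1 <= `|V t q w|] (delta / 2) by near: t.
  have h2 : prob_le P [set w | exists2 q, q \in s & K2 <= `|V t q w|] (delta / 2).
    by near: t.
  rewrite (splitr delta); apply: prob_leS (prob_leU h1 h2) => // w [j].
  rewrite inE ge_max => /predU1P[->|js] /andP[k1 k2]; first by left.
  by right; exists j.
move=> delta /(H (enum I))[K HK]; exists K; near=> t.
have : prob_le P [set w | exists2 q, q \in enum I & K <= `|V t q w|] delta.
  by near: t.
by apply: prob_leS => // w [q Kq]; exists q => //; rewrite mem_enum.
Unshelve. all: by end_near. Qed.

Lemma norm_mean_sub_le (f1 f2 : Om -> R) (e C delta : R) :
  measurable_fun setT f1 -> measurable_fun setT f2 ->
  (forall w, `|f1 w| <= C) -> (forall w, `|f2 w| <= C) -> 0 <= e ->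
  prob_le P [set w | e < `|f1 w - f2 w|] delta ->
  `|mean P f1 - mean P f2| <= e + 2 * C * delta.
Proof.
move=> mf1 mf2 f1C f2C e0 [A [mA PA QA]].
have [Lf1 Lf2] : L1 P f1 /\ L1 P f2 by split; apply: bounded_L1.
have C0 : 0 <= C.
  exact: le_trans (normr_ge0 _) (norm_mean_bounded P mf1 f1C).
rewrite -meanB//; apply: (@le_trans _ _ (mean P (fun w => e + 2 * C * \1_A w))).
  apply: norm_mean_le.
  - by apply: L1D; [exact: L1_cst|apply: L1Z; exact: L1_indic].
  - exact: measurable_funB.
  - move=> w; rewrite indicE; have [wA|wA] := boolP (w \in A).
      rewrite mulr1; apply: (le_trans (ler_normB _ _)).
      by have := f1C w; have := f2C w; lra.
    rewrite mulr0 addr0 leNgt; apply/negP => h; move/negP: wA; apply.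
    by rewrite inE; exact: QA.
rewrite meanD ?meanZ ?mean_cst ?mean_indic ?lerD2l//; first last.
- by apply: L1Z; exact: L1_indic.
- exact: L1_cst.
- exact: L1_indic.
rewrite ler_wpM2l ?mulr_ge0//.
by rewrite -lee_fin fineK// fin_num_measure.
Qed.

End finite_families.

Section matrix_limit.
Context (R : realType) (d d' : measure_display).
Context (Om : measurableType d) (Om' : measurableType d').
Variables (P : probability Om R) (P' : probability Om' R).
Variables (m k : nat) (I : finType) (S : 'I_k -> pred I).
Variables (X : 'I_m -> 'I_k -> R -> Om -> \bar R).
Variables (D : R -> I -> Om -> R) (D' : I -> Om' -> R).
Hypothesis mX : forall i j t, measurable_fun setT (X i j t).
Hypothesis mD : forall t q, measurable_fun setT (D t q).
Hypothesis mD' : forall q, measurable_fun setT (D' q).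
Hypothesis tightD : forall q (delta : R), 0 < delta -> exists K : R,
  \forall t \near +oo, prob_le P [set w | K <= `|D t q w|] delta.
Hypothesis closeX : forall i j,
  close_in_prob P (X i j) (fun t w => \sum_(q | S j q) D t q w).
Hypothesis cvg_products : forall (f : I -> R -> R) (K : R), (forall q, taylor2 K (f q)) ->
  mean P (fun w => \prod_q f q (D t q w)) @[t --> +oo] -->
  mean P' (fun w => \prod_q f q (D' q w)).
Variable g : 'M[R]_(m, k) -> R.
Hypotheses (cg : continuous g) (C : R) (gC : forall A, `|g A| <= C).

Let L (x : I -> R) : 'M[R]_(m, k) := \matrix_(i, j) \sum_(q | S j q) x q.
Let fin t : set Om := [set w | forall i j, X i j t w \is a fin_num].
Let F t w : R := g (\matrix_(i, j) fine (X i j t w)) * \1_(fin t) w.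
Let F' w : R := g (L (D' ^~ w)).

Let mF t : measurable_fun setT (F t).
Proof.
apply: measurable_funM.
  apply: measurable_continuous_matrix => // i j.
  by apply: measurableT_comp => //; exact: mX.
apply: measurable_indic; rewrite /fin (_ : mkset _ =
    \bigcap_(ij in [set: 'I_m * 'I_k]) [set w | X ij.1 ij.2 t w \is a fin_num]).
  apply: fin_bigcap_measurable => // ij _.
  by rewrite -[X in measurable X]setTI; apply: emeasurable_fin_num => //; exact: mX.
by apply/seteqP; split => [w h [i j] _|w h i j]; [exact: h|exact: (h (i, j))].
Qed.

Let FC t w : `|F t w| <= C.
Proof.
rewrite normrM indicE -[leRHS]mulr1; apply: ler_pM => //.
by case: (_ \in _); rewrite ?normr1 ?normr0.
Qed.

Let mL (dT : measure_display) (T : measurableType dT) (Z : I -> T -> R) :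
  (forall q, measurable_fun setT (Z q)) ->
  measurable_fun setT (fun w => g (L (Z ^~ w))).
Proof.
move=> mZ; apply: measurable_continuous_matrix => // i j.
rewrite (_ : (fun w => _) = fun w => \sum_(q <- [seq q <- enum I | S j q]) Z q w).
  exact: measurable_sum.
by apply/funext => w; rewrite big_filter big_enum_cond.
Qed.

Let integral_F t : (\int[P]_(w in fin t)
  (g (\matrix_(i, j) fine (X i j t w)))%:E = (mean P (F t))%:E)%E.
Proof.
rewrite EFin_mean; last exact: bounded_L1 (mF t) (FC t).
rewrite integral_mkcond; apply: eq_integral => w _.
by rewrite /F /patch indicE; case: (w \in _); rewrite ?mulr1 ?mulr0.
Qed.

Let L_close (x y : I -> R) (e : R) i j : (forall q, `|x q - y q| <= e) -> 0 <= e ->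
  `|L x i j - L y i j| <= #|I|%:R * e.
Proof.
move=> xy e0; rewrite !mxE -sumrB; apply: (le_trans (ler_norm_sum _ _ _)).
rewrite mulr_natl -sumr_const [leRHS](bigID (S j))/= -[leLHS]addr0 lerD//.
  by apply: ler_sum.
by apply: sumr_ge0.
Qed.

(** On a cube that contains the increments with high probability [g] is uniformly
    continuous: there it is close to a spline approximation, whose mean converges,
    and insensitive to the replacement of [X] by the sums of increments. *)
Lemma fdd_limit :
  (\int[P]_(w in [set w | forall i j, X i j t w \is a fin_num])
    (g (\matrix_(i, j) fine (X i j t w)))%:E)%E @[t --> +oo] -->
  (\int[P']_w (g (\matrix_(i, j) \sum_(q | S j q) D' q w))%:E)%E.
Proof.
have LF' : L1 P' F' by exact: bounded_L1 (mL mD') (fun w => gC _).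
rewrite -(EFin_mean LF').
rewrite (_ : (fun t => _) = (fun t => (mean P (F t))%:E)); last first.
  by apply/funext => t; exact: integral_F.
apply: cvg_EFin; first exact: nearW.
rewrite /comp /=; apply/cvgrPdist_le => e e0.
pose e8 := e / 8; have e80 : 0 < e8 by rewrite divr_gt0.
have C0 : 0 <= C := le_trans (normr_ge0 _) (gC 0).
pose dl := e8 / (2 * C + 1).
have dl0 : 0 < dl by rewrite divr_gt0// ltr_wpDl// mulr_ge0.
have Cdl : 2 * C * dl <= e8.
  by rewrite /dl mulrCA ler_piMr ?(ltW e80)// ler_pdivrMr ?mul1r ?lerDl// ltr_wpDl// mulr_ge0.
have [K1 HK1] := tight_exists tightD dl0.
have [K2 HK2] : exists K : R, prob_le P' [set w | exists q, K <= `|D' q w|] dl.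
  have [q delta delta0|K HK] := @tight_exists _ _ _ P' _ (fun=> D') _ _ dl0.
    have [K HK] := tail_small P' (mD' q) delta0; exists K; apply: nearW => _.
    exists (D' q @^-1` [set y | K <= `|y|]); split => //.
    rewrite -[X in measurable X]setTI; apply: mD' => //.
    exact: measurable_norm_ge.
  by exists K; have [t] := filter_ex HK.
pose K := Num.max (Num.max K1 K2) 0.
have K0 : 0 <= K by rewrite le_max lexx orbT.
have K1K : K1 <= K by rewrite !le_max lexx.
have K2K : K2 <= K by rewrite !le_max lexx orbT.
have [rho rho0 Hg] := matrix_unif_continuous cg (#|I|%:R * K) e80.
pose delta := rho / (4 * (#|I|%:R + 1)).
have I0 : 0 <= #|I|%:R :> R by [].
have delta0 : 0 < delta by rewrite divr_gt0// mulr_gt0// ltr_wpDl.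
have Idelta : #|I|%:R * (4 * delta) <= rho.
  rewrite /delta invfM !mulrA (_ : #|I|%:R * 4 * rho / 4 = rho * #|I|%:R); last by field.
  by rewrite ler_pdivrMr ?ltr_wpDl// ler_pM2l// lerDl.
pose M := (Num.truncn ((K + 3 * delta) / delta)).+1.
have MK : K + 3 * delta <= M%:R * delta.
  by rewrite -ler_pdivrMr// ltW// truncnS_gt.
pose G (x : I -> R) := g (L x).
have GC x : `|G x| <= C by exact: gC.
have box x : (forall q, `|x q| <= K) -> forall i j, `|L x i j| <= #|I|%:R * K.
  move=> xK i j; have := @L_close x (fun=> 0) K i j _ _.
  rewrite [L (fun=> 0) i j]mxE big1// subr0; apply => //.
  by move=> q; rewrite subr0.
have approx x : (forall q, `|x q| <= K) ->
    `|G x - spline_approx delta M G x| <= e8.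
  move=> xK; apply: spline_approx_close MK _ _ => // a xa.
  apply: Hg; first exact: box.
  move=> i j; apply: le_trans Idelta; apply: L_close => //.
  by rewrite mulr_ge0// ltW.
have mA (dT : measure_display) (T : measurableType dT) (Z : I -> T -> R) :
    (forall q, measurable_fun setT (Z q)) ->
    measurable_fun setT (fun w => spline_approx delta M G (Z ^~ w)).
  exact: measurable_spline_approx.
have H' : `|mean P' F' - mean P' (fun w => spline_approx delta M G (D' ^~ w))|
    <= e8 + 2 * C * dl.
  apply: (norm_mean_sub_le (mL mD') (mA _ _ _ mD') (fun w => gC _) _ (ltW e80)).
    by move=> w; exact: spline_approx_bounded.
  apply: prob_leS HK2 => // w /=; apply: contraPP => /forallNP h.
  apply/negP; rewrite -leNgt; apply: approx => q.
  by have /negP := h q; rewrite -ltNge => /ltW/le_trans; exact.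
have HX : unlikely P (fun t => [set w | exists ij : 'I_m * 'I_k,
    ~ ((\sum_(q | S ij.2 q) D t q w - rho)%:E <= X ij.1 ij.2 t w <=
       (\sum_(q | S ij.2 q) D t q w + rho)%:E)%E]).
  by apply: unlikely_exists => -[i j]; exact: closeX.
have cvA := mean_spline_approx_cvg (delta := delta) (M := M) (G := G) mD mD' cvg_products.
near=> t.
have h1 : prob_le P [set w | exists q, K1 <= `|D t q w|] dl by near: t.
have h2 := near (HX _ dl0) t.
have h3 : `|mean P' (fun w => spline_approx delta M G (D' ^~ w)) -
    mean P (fun w => spline_approx delta M G (D t ^~ w))| <= e8.
  by near: t; move/cvgrPdist_le : cvA; apply.
have H : `|mean P (F t) - mean P (fun w => spline_approx delta M G (D t ^~ w))|
    <= (e8 + e8) + 2 * C * (dl + dl).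
  have e80' : 0 <= e8 + e8 by rewrite addr_ge0// ltW.
  apply: (norm_mean_sub_le (mF t) (mA _ _ _ (mD t)) (FC t) _ e80').
    by move=> w; exact: spline_approx_bounded.
  apply: prob_leS (prob_leU h1 (h2 _)) => // w /=; apply: contraPP.
  move=> /not_orP[/forallNP hD /forallNP hX].
  have DK q : `|D t q w| <= K.
    by have /negP := hD q; rewrite -ltNge => /ltW/le_trans; exact.
  have hX' i j : ((\sum_(q | S j q) D t q w - rho)%:E <= X i j t w <=
      (\sum_(q | S j q) D t q w + rho)%:E)%E by exact: contrapT (hX (i, j)).
  have finX : fin t w.
    move=> i j; have /andP[a b] := hX' i j.
    by rewrite fin_numE; apply/andP; split; apply/eqP => E; move: a b; rewrite E.
  apply/negP; rewrite -leNgt.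
  apply: le_trans (ler_distD (G (D t ^~ w)) _ _) _; apply: lerD; last exact: approx.
  rewrite /F indicE mem_set// mulr1 distrC; apply: Hg; first exact: box.
  move=> i j; rewrite !mxE; have := hX' i j.
  by rewrite -(fineK (finX i j)) !lee_fin ler_norml => /andP[a b]; lra.
have := H'; have := H; rewrite !ler_norml => /andP[a1 a2] /andP[b1 b2].
move: h3; rewrite ler_norml => /andP[c1 c2].
have e8E : e = 8 * e8 by rewrite /e8; field.
by apply/andP; split; lra.
Unshelve. all: by end_near. Qed.

End matrix_limit.

(** * Finite-dimensional convergence *)

Lemma sorted_times (R : realType) (k : nat) (u : 'I_k -> R) :
  (forall j, 0 <= u j) -> exists (s : nat -> R) (rank : 'I_k -> nat),
    [/\ s 0%N = 0, nondecreasing_seq s &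
        forall j, (rank j <= k)%N /\ s (rank j) = u j].
Proof.
move=> u0; pose l := sort <=%O (codom u).
have sl : size l = k by rewrite size_sort size_codom card_ord.
have ml j : u j \in l by rewrite mem_sort codom_f.
have sorted0 : sorted <=%O (0 :: l).
  rewrite /= path_min_sorted ?sort_le_sorted//.
  by apply/allP => y; rewrite mem_sort => /codomP[j ->].
exists (fun i => nth 0 (0 :: l) (minn i k)), (fun j => (index (u j) l).+1).
split => [|i j ij|j].
- by rewrite min0n.
- apply: (sorted_leq_nth le_trans le_refl) => //.
  + by rewrite inE/= sl ltnS geq_minr.
  + by rewrite inE/= sl ltnS geq_minr.
  + by rewrite leq_min geq_minr andbT (leq_trans (geq_minl _ _)).
- have jl : (index (u j) l < k)%N by rewrite -[X in (_ < X)%N]sl index_mem.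
  by split => //; rewrite (minn_idPl jl)/= nth_index.
Qed.

Lemma sum_increments (R : realType) (a : nat -> R) (k n : nat) : (n <= k)%N ->
  \sum_(q < k | (q < n)%N) (a q.+1 - a q) = a n - a 0%N.
Proof.
move=> nk; rewrite -(big_ord_widen _ (fun q => a q.+1 - a q) nk).
by rewrite -(big_mkord xpredT (fun q => a q.+1 - a q)) telescope_sumr.
Qed.

Section fdd.
Context (R : realType) (d0 d d' : measure_display).
Context (Om0 : measurableType d0) (Om : measurableType d).
Context (Om' : measurableType d').
Variables (P0 : probability Om0 R) (P : probability Om R).
Variables (P' : probability Om' R).
Variables (xi : Om0 -> R) (xs : nat -> Om -> R) (mu sigma2 : R).
Variable B : R -> {RV P' >-> R}.
Hypotheses (mu_gt0 : 0 < mu) (sigma2_gt0 : 0 < sigma2).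
Hypotheses (mxi : measurable_fun setT xi) (Exi : mean P0 xi = mu).
Hypothesis (Lxi2 : L1 P0 (fun w => xi w ^+ 2)).
Hypothesis (Vxi : mean P0 (fun w => (xi w - mu) ^+ 2) = sigma2).
Hypothesis (mxs : forall i, measurable_fun setT (xs i)).
Hypothesis (indxs : mutually_independent P xs).
Hypothesis (lawxs : forall i, same_law P P0 (xs i) xi).
Hypothesis BM : standard_brownian_motion B.

Local Notation W := (walk_approx xs mu sigma2).

Let iidxs : pairwise_iid P0 P xi xs.
Proof. by split => // i j ij; exact: mutually_independent_indep. Qed.

Let Lxi : L1 P0 xi. Proof. exact: L1_of_sqr. Qed.

Let Lxic2 : L1 P0 (fun w => (xi w - mu) ^+ 2).
Proof. exact: L1_sqrB. Qed.

Let mW u t : measurable_fun setT (W u t).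
Proof.
apply: measurable_sum => i.
exact: measurableT_comp (measurable_scaled_step _ _ _) (mxs i).
Qed.

Let walk_increments (s : nat -> R) (f : nat -> R -> R) (K : R) r :
  0 <= s 0%N -> nondecreasing_seq s -> (forall j, taylor2 K (f j)) ->
  mean P (fun w => \prod_(j < r) f j (W (s j.+1) t w - W (s j) t w))
    @[t --> +oo] -->
  mean P' (fun w => \prod_(j < r) f j (B (s j.+1) w - B (s j) w)).
Proof.
move=> s0 nds tf.
pose F t := mean P (fun w => \prod_(j < r) f j (\sum_(nsteps mu t (s j) <= i <
  nsteps mu t (s j.+1)) scaled_step mu sigma2 t (xs i w))).
apply: (@cvg_trans _ (F t @[t --> +oo])); last first.
  exact: (clt_prod mu_gt0 sigma2_gt0 Lxi Exi Lxic2 Vxi mxs indxs lawxs BM s0 nds tf).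
apply: near_eq_cvg; near=> t.
have t0 : 0 < t by near: t; exact: nbhs_pinfty_gt.
apply: eq_mean => w; apply: eq_bigr => j _; congr (f j _).
rewrite /walk_approx (@big_cat_nat _ _ _ (nsteps mu t (s j)) 0 (nsteps mu t (s j.+1)))//=.
  by rewrite addrAC subrr add0r.
by apply: le_nsteps => //; exact: nds.
Unshelve. all: by end_near. Qed.

Let increments_cvg (s : nat -> R) k (f : 'I_k -> R -> R) (K : R) :
  0 <= s 0%N -> nondecreasing_seq s -> (forall j, taylor2 K (f j)) ->
  mean P (fun w => \prod_(j < k) f j (W (s j.+1) t w - W (s j) t w))
    @[t --> +oo] -->
  mean P' (fun w => \prod_(j < k) f j (B (s j.+1) w - B (s j) w)).
Proof.
case: k f => [f _ _ _|k f s0 nds tf].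
  rewrite (eq_mean P' (fun w => big_ord0 _ _ _ _)) mean_cst.
  under eq_fun do rewrite (eq_mean P (fun w => big_ord0 _ _ _ _)) mean_cst.
  exact: cvg_cst.
have fE : f = (fun j : 'I_k.+1 => f (inord j)).
  by apply/funext => j; rewrite inord_val.
rewrite fE; exact: (@walk_increments s (fun j => f (inord j)) K).
Qed.

Let tight_increment (a b : R) : 0 <= a -> 0 <= b ->
  forall delta : R, 0 < delta -> exists K : R,
    \forall t \near +oo, prob_le P [set w | K <= `|W b t w - W a t w|] delta.
Proof.
move=> a0 b0 delta delta0; have d20 : 0 < delta / 2 by rewrite divr_gt0.
have tight := walk_approx_tight mu_gt0 sigma2_gt0 mxi Exi Lxi2 Vxi iidxs.
have [K1 HK1] := tight a a0 _ d20; have [K2 HK2] := tight b b0 _ d20.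
exists (K1 + K2); near=> t.
have h1 : prob_le P [set w | K1 <= `|W a t w|] (delta / 2) by near: t.
have h2 : prob_le P [set w | K2 <= `|W b t w|] (delta / 2) by near: t.
rewrite (splitr delta); apply: prob_leS (prob_leU h1 h2) => // w /= h.
have [k1|k1] := leP K1 `|W a t w|; [by left|right].
by have := ler_normB (W b t w) (W a t w); lra.
Unshelve. all: by end_near. Qed.

(** Between sorted times starting at 0, the increments of the walk and of Brownian
    motion are covered by [clt_prod]; the values at the given times are sums of
    them. *)
Lemma fdd_cvg_of_close m (X : 'I_m -> R -> R -> Om -> \bar R) :
  (forall i t u, measurable_fun setT (X i t u)) ->
  (forall i u, 0 <= u -> close_in_prob P (fun t => X i t u) (W u)) ->
  fdd_cvg P P' X (fun=> B).
Proof.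
move=> mX closeX k u u0 g cg [C0 [_ HC]].
have gC A : `|g A| <= C0 + 1 by apply: HC => //; rewrite ltrDl.
have [s [rank [s0 nds srank]]] := sorted_times u0.
have s_ge0 i : 0 <= s i by rewrite -s0 nds.
have rankk j : (rank j <= k)%N by case: (srank j).
have mB t : measurable_fun setT (B t) by exact: measurable_funPT.
have := @fdd_limit R d d' Om Om' P P' m k 'I_k (fun j q => (q < rank j)%N)
  (fun i j t => X i t (u j)) (fun t q w => W (s q.+1) t w - W (s q) t w)
  (fun q w => B (s q.+1) w - B (s q) w) _ _ _ _ _ _ g cg _ gC.
rewrite (_ : (\int[P']_w _)%E = (\int[P']_w (g (\matrix_(i, j) B (u j) w))%:E)%E); last first.
  apply: ae_eq_integral => //.
  - apply/measurable_EFinP/measurable_continuous_matrix => // i j.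
    rewrite (_ : (fun w => _) = fun w => B (s (rank j)) w - B (s 0%N) w).
      exact: measurable_funB.
    apply/funext => w.
    by rewrite (sum_increments (fun q => B (s q) w)).
  - exact/measurable_EFinP/measurable_continuous_matrix.
  case: BM => B0 _ _ _; apply: filterS B0 => w B0w _.
  congr (g _)%:E; apply/matrixP => i j; rewrite !mxE.
  rewrite (sum_increments (fun q => B (s q) w))// s0 B0w subr0.
  by case: (srank j) => _ ->.
apply.
- by move=> i j t; exact: mX.
- by move=> t q; exact: measurable_funB.
- by move=> q; exact: measurable_funB.
- by move=> q; exact: tight_increment.
- move=> i j; rewrite (_ : (fun t w => _) = W (u j)); first exact: closeX.
  apply/funext => t; apply/funext => w.
  rewrite (sum_increments (fun q => W (s q) t w))// s0.
  case: (srank j) => _ ->.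
  by rewrite {2}/walk_approx big_geq ?subr0// /nsteps !mul0r truncn0.
- by move=> f K tf; exact: increments_cvg tf.
Qed.

End fdd.

(** * From the hypotheses on moments and copies *)

Lemma independent_copies_comp (R : realType) (d0 d e e' : measure_display)
    (Om0 : measurableType d0) (P0 : probability Om0 R)
    (Om : measurableType d) (P : probability Om R)
    (E : measurableType e) (E' : measurableType e')
    (X : Om0 -> E) (Xs : nat -> Om -> E) (h : E -> E') :
  measurable_fun setT h -> independent_copies P0 P X Xs ->
  independent_copies P0 P (h \o X) (fun n => h \o Xs n).
Proof.
move=> mh [iX lX]; split; first exact: mutually_independent_comp.
move=> n A mA; apply: (lX n (h @^-1` A)).
by rewrite -[_ @^-1` _]setTI; exact: mh.
Qed.

Section moments.
Context (R : realType) (d : measure_display) (T : measurableType d).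
Variables (P : probability T R) (f : T -> R).
Hypothesis mf : measurable_fun setT f.

Lemma L1_of_ge0 : (forall w, 0 <= f w) ->
  (\int[P]_w (f w)%:E < +oo)%E -> L1 P f.
Proof.
move=> f0 foo; apply/integrableP; split; first exact/measurable_EFinP.
rewrite (_ : (fun w => `|(EFin \o f) w|%E) = (fun w => (f w)%:E))//.
by apply/funext => w /=; rewrite ger0_norm.
Qed.

(** As [+oo - +oo = -oo] in the extended reals, a finite integral has finite
    positive and negative parts. *)
Lemma L1_of_fin_num : (\int[P]_w (f w)%:E)%E \is a fin_num -> L1 P f.
Proof.
move=> fin; rewrite integralE in fin; apply/integrableP; split; first exact/measurable_EFinP.
have mEf : measurable_fun setT (EFin \o f) by exact/measurable_EFinP.
have p0 : (0 <= \int[P]_w (EFin \o f)^\+ w)%E by apply: integral_ge0.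
have n0 : (0 <= \int[P]_w (EFin \o f)^\- w)%E by apply: integral_ge0.
rewrite -/((abse \o (EFin \o f))) fune_abse ge0_integralD//; last 2 first.
- exact: measurable_funepos.
- exact: measurable_funeneg.
move: p0 n0 fin; case: (integral P setT (EFin \o f)^\+)%E => [p| |]//;
  case: (integral P setT (EFin \o f)^\-)%E => [q| |]//= _ _ _.
exact: ltry.
Qed.

End moments.

Local Open Scope ereal_scope.

Theorem theorem2p12 (R : realType)
  (d0 d d' : measure_display)
  (Om0 : measurableType d0) (P0 : probability Om0 R)
  (Om : measurableType d) (P : probability Om R)
  (Om' : measurableType d') (P' : probability Om' R)
  (xi eta : {RV P0 >-> R}) (xis etas : nat -> {RV P >-> R})
  (mu sigma2 : R) (B : R -> {RV P' >-> R}) :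
  independent_copies P0 P (fun w => (xi w, eta w))
    (fun n w => (xis n w, etas n w)) ->
  'E_P0[xi] = mu%:E -> (0 < mu)%R ->
  'V_P0[xi] = sigma2%:E -> (0 < sigma2)%R ->
  standard_brownian_motion B ->
  let X (V : R -> Om -> \bar R) := rescaled mu sigma2 V in
  let tau := first_passage xis etas in
  let N := nb_visits xis etas in
  let rho := last_exit xis etas in
  [/\ 'E_P0[eta^\+] < +oo ->
        fdd_cvg P P' (fun _ : 'I_1 => X tau) (fun _ : 'I_1 => B),
      'E_P0[eta^\-] < +oo ->
        fdd_cvg P P' (fun _ : 'I_1 => X rho) (fun _ : 'I_1 => B) &
      'E_P0[eta] \is a fin_num ->
        fdd_cvg P P' (tnth [tuple X tau; X N; X rho]) (fun _ : 'I_3 => B)].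
Proof.
move=> copies Exi mu_gt0 Vxi sigma2_gt0 BM X tau N rho.
have mxi : measurable_fun setT xi by exact: measurable_funPT.
have meta : measurable_fun setT eta by exact: measurable_funPT.
have mxs i : measurable_fun setT (xis i) by exact: measurable_funPT.
have mes i : measurable_fun setT (etas i) by exact: measurable_funPT.
have [indxs lawxs] := independent_copies_comp measurable_fst copies.
have [_ lawes] := independent_copies_comp measurable_snd copies.
rewrite expectation_def in Exi.
have Lxi : L1 P0 xi by apply: L1_of_fin_num => //; rewrite Exi.
have mean_xi : mean P0 xi = mu by rewrite /mean /Rintegral Exi.
have Vint : \int[P0]_w ((xi w - mu) ^+ 2)%:E = sigma2%:E.
  rewrite -Vxi /variance !unlock Exi.
  by apply: eq_integral => w _; rewrite expr2.
have mc2 : measurable_fun setT (fun w => (xi w - mu) ^+ 2)%R.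
  by apply: measurable_funX; exact: measurable_funB.
have Lxic2 : L1 P0 (fun w => (xi w - mu) ^+ 2)%R.
  by apply: L1_of_fin_num => //; rewrite Vint.
have mean_xic2 : mean P0 (fun w => (xi w - mu) ^+ 2)%R = sigma2.
  by rewrite /mean /Rintegral Vint.
have Lxi2 : L1 P0 (fun w => xi w ^+ 2)%R.
  rewrite (_ : (fun w => _) =
    (fun w => ((xi w - mu) ^+ 2 + (2 * mu) * xi w) - mu ^+ 2)%R); last first.
    by apply/funext => w; ring.
  by apply: L1B (L1_cst _ _); apply: L1D => //; exact: L1Z.
have iidxs : pairwise_iid P0 P xi xis.
  split => // i j ij; exact: (mutually_independent_indep ij indxs).
have fdd m (Z : 'I_m -> R -> R -> Om -> \bar R) :
    (forall i t u, measurable_fun setT (Z i t u)) ->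
    (forall i u, (0 <= u)%R ->
      close_in_prob P (fun t => Z i t u) (walk_approx xis mu sigma2 u)) ->
    fdd_cvg P P' Z (fun=> B).
  exact: (fdd_cvg_of_close mu_gt0 sigma2_gt0 mxi mean_xi Lxi2 mean_xic2 mxs indxs lawxs BM).
have mX V t u : (forall s, measurable_fun setT (V s)) ->
    measurable_fun setT (X V t u) by exact: measurable_rescaled.
have mtau t u : measurable_fun setT (X tau t u).
  by apply: mX => s; exact: measurable_first_passage.
have mN t u : measurable_fun setT (X N t u).
  by apply: mX => s; exact: measurable_nb_visits.
have mrho t u : measurable_fun setT (X rho t u).
  by apply: mX => s; exact: measurable_last_exit.
have close_tau := close_first_passage mu_gt0 sigma2_gt0 mxi mean_xi Lxi2
  mean_xic2 iidxs meta mes lawes.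
have close_N := close_nb_visits mu_gt0 sigma2_gt0 mxi mean_xi Lxi2
  mean_xic2 iidxs meta mes lawes.
have close_rho := close_last_exit mu_gt0 sigma2_gt0 mxi mean_xi Lxi2
  mean_xic2 iidxs meta mes lawes.
split => [Eeta|Eeta|Eeta].
- apply: fdd => // i u u0; apply: close_tau => //.
  rewrite unlock in Eeta; apply: L1_of_ge0 => //.
    by apply: measurable_maxr.
  by move=> w; rewrite le_max lexx orbT.
- apply: fdd => // i u u0; apply: close_rho => //.
  rewrite unlock in Eeta; apply: L1_of_ge0 => //.
    by apply: measurable_maxr => //; exact: measurableT_comp.
  by move=> w; rewrite le_max lexx orbT.
have Leta : L1 P0 eta by rewrite expectation_def in Eeta; exact: L1_of_fin_num.
have Lp : L1 P0 (fun w => Num.max (eta w) 0%R).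
  apply: (le_L1 _ _ Leta); first exact: measurable_maxr.
  by move=> w; case: (leP (eta w) 0%R) => ?; rewrite ?normr0.
have Ln : L1 P0 (fun w => Num.max (- eta w)%R 0%R).
  apply: (le_L1 _ _ Leta).
    by apply: measurable_maxr => //; exact: measurableT_comp.
  by move=> w; case: (leP (- eta w)%R 0%R) => ?; rewrite ?normr0 ?normrN.
by apply: fdd => -[[|[|[|?]]] ?]//= *; rewrite /tnth/=;
  [exact: close_tau|exact: close_N|exact: close_rho].
Qed.
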